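(* Let $\{\alpha_i\}_{i=1}^\infty$ be a list of positive real numbers such that $S_1^k(\{\alpha_i\}_i)\neq 1$ for all $k\in\mathbb{N}$. Then the family $\underline{X}(n;\{n^{-\alpha_i}\}_i)$ a.a.s. has a cup length of $1$ over $\mathbb{Q}$. Moreover, a.a.s. the image of the cup product in $H^{2l}$ is trivial over any ring of coefficients, where $l\in\mathbb{N}$ is any number such that $S_1^l(\{\alpha_i\}_i)>1$.
   Context: $\mathbb{N}=\{1,2,\dots\}$. Lower multiparametric model: for $n\in\mathbb{N}$ and probabilities $p_1,p_2,\dots\in[0,1]$, $\underline{X}(n;p_1,p_2,\dots)$ is the random simplicial complex on $n$ vertices (all vertices present) obtained as follows: in the hypergraph model include every subset of $i+1$ vertices, $i\ge 1$, independently with probability $p_i$, and take the maximal simplicial complex contained in this hypergraph. Equivalently, each edge is included independently with probability $p_1$, then each triangle whose boundary is present is included independently with probability $p_2$, then each tetrahedron whose boundary is present with probability $p_3$, and so on. $\underline{X}(n;\{n^{-\alpha_i}\}_i)$ is the model with $p_i=n^{-\alpha_i}$. $S_1^k(\{\alpha_i\}_i)=\sum_{i=1}^{k+1}\binom{k+1}{i}\alpha_i$. The cup length of a space $X$ over a ring $R$ is the maximal number of elements $a_i\in H^{n_i}(X;R)$ with all $n_i>0$ such that $\prod_i a_i\neq 0$. Triviality or non-triviality of the cup product always refers to products of classes of positive degree; so the image of the cup product in $H^{2l}$ being trivial means $a\cup b=0$ for all $a\in H^i$, $b\in H^j$ with $i,j>0$ and $i+j=2l$. A property holds a.a.s. (asymptotically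 almost surely) if its probability tends to $1$ as $n\to\infty$.
   Formalization: Cup length exactly 1 is asserted only when α_1 ≤ 1 (for α_1 > 1 the complex is a.a.s. a forest and its cup length is 0); for every list satisfying the hypotheses, cup length at most 1 is asserted. *)

(* Defs.v *)
From HB Require Import structures.
From mathcomp Require Import all_boot all_order all_algebra.
From mathcomp Require Import boolp.

Set Implicit Arguments.
Unset Strict Implicit.
Unset Printing Implicit Defensive.

Import Order.TTheory GRing.Theory Num.Theory.

Local Open Scope ring_scope.
Local Open Scope quotient_scope.

Structure scomplex (n : nat) := SComplex {
  faces :> {set {set 'I_n}};
  faces_neq0 : set0 \notin faces;
  faces_sub : forall s t : {set 'I_n},
    s \in faces -> t \subset s -> t != set0 -> t \in faces }.

Section SimplicialCohomology.
Local Open Scope nat_scope.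
Variables (n : nat).
Implicit Types (s t : {set 'I_n}) (v : 'I_n).

Definition vrank s v : nat := #|[set u in s | u < v]|.

(* For s = {v_0 < ... < v_m}: {v_0, ..., v_i} and {v_i, ..., v_m}. *)
Definition front s i : {set 'I_n} := [set v in s | vrank s v <= i].
Definition back s i : {set 'I_n} := [set v in s | i <= vrank s v].

Lemma front_sub s i : front s i \subset s.
Proof. by apply/subsetP => v; rewrite inE => /andP[]. Qed.

Lemma back_sub s i : back s i \subset s.
Proof. by apply/subsetP => v; rewrite inE => /andP[]. Qed.

Lemma vrank_lt s v : v \in s -> vrank s v < #|s|.
Proof.
move=> vs; apply: proper_card; apply/properP; split.
  by apply/subsetP => u; rewrite inE => /andP[].
by exists v => //; rewrite inE vs ltnn.
Qed.

Lemma ltn_vrank s u v : u \in s -> u < v -> vrank s u < vrank s v.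
Proof.
move=> us uv; apply: proper_card; apply/properP; split.
  apply/subsetP => w; rewrite !inE => /andP[-> wu] /=; exact: ltn_trans wu uv.
by exists u; rewrite !inE us ?uv ?ltnn.
Qed.

Lemma vrank_ltE s u v : u \in s -> v \in s ->
  (vrank s u < vrank s v) = (u < v).
Proof.
move=> us vs; apply/idP/idP; last exact: ltn_vrank.
apply: contraLR; rewrite -!leqNgt leq_eqVlt => /orP[/eqP/val_inj->//|vu].
exact/ltnW/ltn_vrank.
Qed.

Lemma vrank_inj s : {in s &, injective (vrank s)}.
Proof.
move=> u v us vs uv; apply: val_inj => /=.
case: (ltngtP u v) => // [/(ltn_vrank us)|/(ltn_vrank vs)]; by rewrite uv ltnn.
Qed.

Lemma card_vrank s (P : pred nat) :
  #|[set v in s | P (vrank s v)]| = count P (iota 0 #|s|).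
Proof.
have perm : perm_eq [seq vrank s v | v <- enum s] (iota 0 #|s|).
  apply: uniq_perm; rewrite ?iota_uniq //.
    rewrite map_inj_in_uniq ?enum_uniq // => u v.
    by rewrite !mem_enum; apply: vrank_inj.
  have U : uniq [seq vrank s v | v <- enum s].
    rewrite map_inj_in_uniq ?enum_uniq // => u v.
    by rewrite !mem_enum; apply: vrank_inj.
  apply: (uniq_min_size U _ _).2.
    move=> k /mapP[v]; rewrite mem_enum => vs ->.
    by rewrite mem_iota add0n vrank_lt.
  by rewrite size_iota size_map -cardE.
rewrite -(permP perm) count_map cardE -size_filter.
congr (size _); rewrite /enum_mem -filter_predI; apply: eq_filter => v.
by rewrite /= inE andbC.
Qed.

Lemma vrank_ex s k : k < #|s| -> exists2 v, v \in s & vrank s v = k.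
Proof.
move=> ks; have : 0 < #|[set v in s | pred1 k (vrank s v)]|.
  by rewrite (card_vrank s (pred1 k)) -has_count has_pred1 mem_iota.
by case/card_gt0P=> v; rewrite inE => /andP[vs /eqP]; exists v.
Qed.

Lemma card_front s i : i < #|s| -> #|front s i| = i.+1.
Proof.
move=> ltis; rewrite (card_vrank s (fun r => r <= i)).
rewrite -(subnKC ltis) iotaD count_cat add0n.
rewrite (_ : count _ (iota 0 i.+1) = i.+1); last first.
  rewrite -[RHS](size_iota 0); apply/eqP; rewrite -all_count.
  by apply/allP => r; rewrite mem_iota.
rewrite (_ : count _ _ = 0) ?addn0 //; apply/eqP.
rewrite -leqn0 leqNgt -has_count; apply/hasPn => r.
by rewrite mem_iota -ltnNge => /andP[].
Qed.

Lemma card_back s i : #|back s i| = #|s| - i.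
Proof.
rewrite (card_vrank s (fun r => i <= r)).
case: (leqP i #|s|) => [le|lt].
  rewrite -{1}(subnKC le) iotaD count_cat add0n.
  rewrite (_ : count _ (iota 0 i) = 0); last first.
    apply/eqP; rewrite -leqn0 leqNgt -has_count; apply/hasPn => r.
    by rewrite mem_iota -ltnNge => /andP[].
  rewrite add0n -[RHS](size_iota i); apply/eqP; rewrite -all_count.
  by apply/allP => r; rewrite mem_iota => /andP[].
rewrite (eqP (ltnW lt : #|s| - i == 0)); apply/eqP.
rewrite -leqn0 leqNgt -has_count; apply/hasPn => r.
by rewrite mem_iota -ltnNge add0n => /andP[_ rs]; apply: ltn_trans rs lt.
Qed.

Lemma vrankD1 s u v : v \in s ->
  vrank s u = if v < u then (vrank (s :\ v) u).+1 else vrank (s :\ v) u.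
Proof.
move=> vs; rewrite {1}/vrank (cardsD1 v) inE vs /=.
have -> : #|[set w in s | w < u] :\ v| = vrank (s :\ v) u.
  by apply: eq_card => w; rewrite !inE andbA.
by case: ltnP.
Qed.

Lemma vrank_front s i v : v \in front s i -> vrank (front s i) v = vrank s v.
Proof.
rewrite inE => /andP[vs vi]; apply: eq_card => u; rewrite !inE.
case us: (u \in s) => //=; case uv: (u < v); rewrite ?andbF ?andbT //.
by rewrite (leq_trans _ vi) // ltnW // ltn_vrank.
Qed.

Lemma vrank_back s i v : v \in back s i -> vrank s v = i + vrank (back s i) v.
Proof.
rewrite inE => /andP[vs vi].
have isz : i < #|s| := leq_ltn_trans vi (vrank_lt vs).
have [i0|i_gt0] := posnP i.
  by rewrite i0 add0n; apply: eq_card => u; rewrite !inE leq0n andbT.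
have lt_i : i.-1 < #|s| by rewrite prednK // ltnW.
set B := [set u in back s i | u < v].
have dis : front s i.-1 :&: B = set0.
  apply/setP=> u; rewrite !inE.
  case: (u \in s) => //=; case: (leqP i) => //=; rewrite ?andbF // => iu.
  by rewrite leqNgt prednK // iu.
rewrite [RHS](_ : _ = #|front s i.-1| + #|B|); last first.
  by rewrite card_front // prednK.
have <- : #|front s i.-1 :|: B| = #|front s i.-1| + #|B|.
  by rewrite cardsU dis cards0 subn0.
apply: eq_card => u; rewrite !inE.
case us: (u \in s) => //=.
have -> : (vrank s u <= i.-1) = (vrank s u < i) by rewrite -ltnS prednK.
case: (ltnP (vrank s u) i) => //= ui.
by rewrite -(vrank_ltE us vs) (leq_trans ui vi).
Qed.

Lemma frontD1_le s i v : v \in s -> vrank s v <= i ->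
  front (s :\ v) i = front s i.+1 :\ v.
Proof.
move=> vs vi; apply/setP=> u; rewrite !inE.
case: (eqVneq u v) => //= uv; case us: (u \in s) => //=.
have := vrankD1 u vs; case: (ltngtP v u) => [vu|vu|/val_inj vu] e.
- by rewrite e ltnS.
- have lt := leq_trans (ltn_vrank us vu) vi.
  by rewrite -e (ltnW lt) (leqW (ltnW lt)).
- by rewrite vu eqxx in uv.
Qed.

Lemma backD1_le s i v : v \in s -> vrank s v <= i ->
  back (s :\ v) i = back s i.+1.
Proof.
move=> vs vi; apply/setP=> u; rewrite !inE.
case: (eqVneq u v) => [->|uv] /=; first by rewrite vs ltnNge vi.
case us: (u \in s) => //=.
have := vrankD1 u vs; case: (ltngtP v u) => [vu|vu|/val_inj vu] e.
- by rewrite e ltnS.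
- have lt := leq_trans (ltn_vrank us vu) vi.
  by rewrite -e leqNgt lt ltnNge (ltnW lt).
- by rewrite vu eqxx in uv.
Qed.

Lemma frontD1_gt s i v : v \in s -> i < vrank s v ->
  front (s :\ v) i = front s i.
Proof.
move=> vs vi; apply/setP=> u; rewrite !inE.
case: (eqVneq u v) => [->|uv] /=; first by rewrite vs leqNgt vi.
case us: (u \in s) => //=.
have := vrankD1 u vs; case: (ltngtP v u) => [vu|vu|/val_inj vu] e.
- have lt := leq_ltn_trans vi (ltn_vrank vs vu).
  by rewrite (leqNgt (vrank s u)) (ltnW lt) /= leqNgt -ltnS -e lt.
- by rewrite e.
- by rewrite vu eqxx in uv.
Qed.

Lemma backD1_gt s i v : v \in s -> i < vrank s v ->
  back (s :\ v) i = back s i :\ v.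
Proof.
move=> vs vi; apply/setP=> u; rewrite !inE.
case: (eqVneq u v) => //= uv; case us: (u \in s) => //=.
have := vrankD1 u vs; case: (ltngtP v u) => [vu|vu|/val_inj vu] e.
- have lt := leq_ltn_trans vi (ltn_vrank vs vu).
  by rewrite (ltnW (ltnW lt)) -ltnS -e (ltnW lt).
- by rewrite e.
- by rewrite vu eqxx in uv.
Qed.

Variable X : scomplex n.

Definition simplex (k : nat) := {s : {set 'I_n} | (s \in X) && (#|s| == k.+1)}.

Section Cochains.
Local Open Scope ring_scope.
Variable A : pzRingType.

Definition cochain (k : nat) := {ffun simplex k -> A}.

(* Extension of a cochain by 0 to all vertex sets. *)
Definition coval k (f : cochain k) s : A := oapp f 0 (insub s).

Definition delta k (f : cochain k) : cochain k.+1 :=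
  [ffun s : simplex k.+1 =>
     \sum_(v in val s) (-1) ^+ vrank (val s) v * coval f (val s :\ v)].

Definition cocup i j (f : cochain i) (g : cochain j) : cochain (i + j) :=
  [ffun s => coval f (front (val s) i) * coval g (back (val s) i)].

Definition cochain1 : cochain 0 := [ffun => 1].

Lemma coval_simplex k (f : cochain k) (s : simplex k) : coval f (val s) = f s.
Proof. by rewrite /coval valK. Qed.

Lemma covalD k (f g : cochain k) s : coval (f + g) s = coval f s + coval g s.
Proof. by rewrite /coval; case: insub => [t|] /=; rewrite ?ffunE ?addr0. Qed.

Lemma covalN k (f : cochain k) s : coval (- f) s = - coval f s.
Proof. by rewrite /coval; case: insub => [t|] /=; rewrite ?ffunE ?oppr0. Qed.

Lemma coval0 k s : coval (0 : cochain k) s = 0.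
Proof. by rewrite /coval; case: insub => [t|] //=; rewrite ffunE. Qed.

Lemma coval_inj k (f g : cochain k) : coval f =1 coval g -> f = g.
Proof. by move=> fg; apply/ffunP=> s; rewrite -!coval_simplex fg. Qed.

Lemma coval_delta k (f : cochain k) s : s \in X -> #|s| = k.+2 ->
  coval (delta f) s = \sum_(v in s) (-1) ^+ vrank s v * coval f (s :\ v).
Proof.
move=> sX ks; have h : (s \in X) && (#|s| == k.+2) by rewrite sX ks eqxx.
by rewrite -[s]/(val (exist _ s h : simplex k.+1)) coval_simplex ffunE.
Qed.

Lemma coval_cup i j (f : cochain i) (g : cochain j) s :
  s \in X -> #|s| = (i + j).+1 ->
  coval (cocup f g) s = coval f (front s i) * coval g (back s i).
Proof.
move=> sX ks; have h : (s \in X) && (#|s| == (i + j).+1) by rewrite sX ks eqxx.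
by rewrite -[s]/(val (exist _ s h : simplex (i + j))) coval_simplex ffunE.
Qed.

Lemma coval_out k (f : cochain k) s :
  ~~ ((s \in X) && (#|s| == k.+1)) -> coval f s = 0.
Proof. by move=> h; rewrite /coval insubN. Qed.

Lemma deltaB k : {morph @delta k : f g / f - g}.
Proof.
move=> f g; apply/ffunP=> s; rewrite !ffunE -sumrB; apply: eq_bigr => v _.
by rewrite covalD covalN mulrBr.
Qed.

Lemma deltaZ k (f : cochain k) m s :
  coval (delta [ffun t => (-1) ^+ m * f t]) s = (-1) ^+ m * coval (delta f) s.
Proof.
rewrite /coval; case: insub => [t|] /=; last by rewrite mulr0.
rewrite !ffunE mulr_sumr; apply: eq_bigr => v _.
rewrite !mulrA -[_ ^+ m * _]commr_sign -!mulrA; congr (_ * _).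
by rewrite /coval; case: insub => [u|] /=; rewrite ?ffunE ?mulr0.
Qed.

Lemma delta0 k : delta (0 : cochain k) = 0.
Proof. by rewrite -(subrr (0 : cochain k)) deltaB subrr. Qed.

Lemma delta_delta k (f : cochain k) : delta (delta f) = 0.
Proof.
apply: coval_inj => s; rewrite coval0.
have [/andP[sX /eqP cs]|nX] := boolP ((s \in X) && (#|s| == k.+3)); last first.
  by rewrite coval_out.
rewrite coval_delta //.
pose F (v u : 'I_n) := coval f (s :\ v :\ u).
have FC v u : F v u = F u v by rewrite /F !setDDl setUC.
transitivity (\sum_(v in s) \sum_(u in s | u != v)
    (-1) ^+ vrank s v * ((-1) ^+ vrank (s :\ v) u * F v u)).
  apply: eq_bigr => v vs; have cv : #|s :\ v| = k.+2.
    by move: cs; rewrite (cardsD1 v) vs => -[].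
  rewrite coval_delta //; last first.
    by rewrite (faces_sub sX) ?subD1set // -card_gt0 cv.
  by rewrite mulr_sumr; apply: eq_bigl => u; rewrite !inE andbC.
pose G (v u : 'I_n) := (-1) ^+ vrank s v * ((-1) ^+ vrank s u * F v u).
transitivity (\sum_(v in s) (\sum_(u in s | (u < v)%N) G v u
                             - \sum_(u in s | (v < u)%N) G v u)).
  apply: eq_bigr => v vs; rewrite (bigID (fun u : 'I_n => (u < v)%N)) /= -sumrN.
  congr (_ + _); apply: eq_big => [u|u /andP[/andP[us ne] uv]].
  - rewrite -andbA; case: (u \in s) => //=.
    by rewrite -(inj_eq val_inj); case: (ltngtP u v).
  - by rewrite /G (vrankD1 u vs) ltnNge (ltnW uv).
  - rewrite -andbA; case: (u \in s) => //=.
    by rewrite -(inj_eq val_inj); case: (ltngtP u v).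
  - have vu : (v < u)%N by rewrite ltn_neqAle leqNgt uv andbT eq_sym.
    by rewrite /G (vrankD1 u vs) vu exprS mulN1r mulNr mulrN opprK.
rewrite sumrB; apply/eqP; rewrite subr_eq0; apply/eqP.
rewrite (exchange_big_dep (mem s)) /=; last by move=> v u _ /andP[].
apply: eq_bigr => v vs; apply: eq_big => [u|u _]; first by rewrite vs.
by rewrite /G FC !mulrA; congr (_ * _); rewrite commr_sign.
Qed.

Lemma delta_cup i j (f : cochain i) (g : cochain j) s :
  coval (delta (cocup f g)) s =
  coval (cocup (delta f) g) s + (-1) ^+ i * coval (cocup f (delta g)) s.
Proof.
have [/andP[sX /eqP cs]|nX] :=
  boolP ((s \in X) && (#|s| == (i + j).+2)); last first.
  by rewrite !coval_out ?mulr0 ?addr0 // addnS.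
rewrite coval_delta // !coval_cup ?addnS //.
have faceX (t : {set 'I_n}) : t \subset s -> (0 < #|t|)%N -> t \in X.
  by move=> ts t0; apply: faces_sub sX ts _; rewrite -card_gt0.
have i1s : (i.+1 < #|s|)%N by rewrite cs !ltnS leq_addr.
have i0s := ltnW i1s.
have cF := card_front i1s; have cB : #|back s i| = j.+2.
  by rewrite card_back cs -addnS -addnS addKn.
rewrite (coval_delta f) ?cF //; last by rewrite faceX ?front_sub ?cF.
rewrite (coval_delta g) ?cB //; last by rewrite faceX ?back_sub ?cB.
have [p ps pi] := vrank_ex i0s; have [q qs qi] := vrank_ex i1s.
have qF : q \in front s i.+1 by rewrite inE qs qi leqnn.
have pB : p \in back s i by rewrite inE ps pi leqnn.
have Fq : front s i.+1 :\ q = front s i.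
  apply/setP=> u; rewrite !inE; case us: (u \in s); rewrite ?andbF //=.
  have -> : (u != q) = (vrank s u != i.+1).
    by rewrite -qi (inj_in_eq (@vrank_inj s)).
  by rewrite -ltn_neqAle.
have Bp : back s i :\ p = back s i.+1.
  apply/setP=> u; rewrite !inE; case us: (u \in s); rewrite ?andbF //=.
  have -> : (u != p) = (i != vrank s u).
    by rewrite -pi eq_sym (inj_in_eq (@vrank_inj s)).
  by rewrite -ltn_neqAle.
rewrite [\sum_(v in front s i.+1) _](bigD1 q) //=.
rewrite [\sum_(v in back s i) _](bigD1 p) //= vrank_front // qi Fq Bp.
have -> : vrank (back s i) p = 0%N.
  by apply/(@addnI i); rewrite -vrank_back // pi addn0.
rewrite expr0 mul1r mulrDl mulrDr mulrDr exprS mulN1r mulNr addrACA.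
rewrite mulNr !mulrA addNr add0r mulr_suml mulr_sumr.
rewrite (bigID (fun v => (vrank s v <= i)%N)) /=; congr (_ + _).
  apply: eq_big => [v|v /andP[vs vi]].
    rewrite !inE; case vs: (v \in s) => //=.
    have -> : (v != q) = (vrank s v != i.+1).
      by rewrite -qi (inj_in_eq (@vrank_inj s)).
    by rewrite andbC -ltn_neqAle.
  have cv : #|s :\ v| = (i + j).+1.
    by move: cs; rewrite (cardsD1 v) vs => -[].
  rewrite coval_cup //; last by rewrite faceX ?subD1set // cv.
  rewrite frontD1_le // backD1_le // mulrA vrank_front //.
  by rewrite inE vs leqW.
apply: eq_big => [v|v /andP[vs]].
  rewrite !inE; case vs: (v \in s) => //=.
  have -> : (v != p) = (i != vrank s v).
    by rewrite -pi eq_sym (inj_in_eq (@vrank_inj s)).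
  by rewrite andbC -ltn_neqAle ltnNge.
rewrite -ltnNge => vi.
have cv : #|s :\ v| = (i + j).+1.
  by move: cs; rewrite (cardsD1 v) vs => -[].
rewrite coval_cup //; last by rewrite faceX ?subD1set // cv.
rewrite frontD1_gt // backD1_gt // (@vrank_back s i) ?inE ?vs ?(ltnW vi) //.
rewrite exprD -!mulrA; congr (_ * _).
by rewrite !mulrA; congr (_ * _); rewrite commr_sign.
Qed.

Record cocycle k := Cocycle {
  cocycle_val :> cochain k;
  _ : cocycle_val \in [pred f | delta f == 0] }.

Lemma cocycles_zmod k : zmod_closed [pred f : cochain k | delta f == 0].
Proof.
split=> [|f g]; rewrite !inE ?delta0 // deltaB => /eqP -> /eqP ->.
by rewrite subr0.
Qed.
HB.instance Definition _ k :=
  GRing.isZmodClosed.Build _ [pred f : cochain k | delta f == 0]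
    (cocycles_zmod k).
HB.instance Definition _ k := [isSub for @cocycle_val k].
HB.instance Definition _ k := [Choice of cocycle k by <:].
HB.instance Definition _ k := [SubChoice_isSubZmodule of cocycle k by <:].

Lemma delta_cocycle k (f : cocycle k) : delta f = 0.
Proof. by case: f => f /= /eqP. Qed.

Definition coboundary k : {pred cocycle k} :=
  match k with
  | 0%N => fun f => f == 0
  | j.+1 => fun f => `[< exists h : cochain j, cocycle_val f = delta h >]
  end.

Lemma coboundary_zmod k : zmod_closed (@coboundary k).
Proof.
case: k => [|k]; split=> [|f g]; rewrite /in_mem /=.
- exact: eqxx.
- by move=> /eqP -> /eqP ->; rewrite subrr.
- by apply/asboolP; exists 0; rewrite delta0.
move=> /asboolP[h fh] /asboolP[h' gh']; apply/asboolP; exists (h - h').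
by rewrite deltaB -fh -gh'.
Qed.
HB.instance Definition _ k :=
  GRing.isZmodClosed.Build (cocycle k) (@coboundary k) (@coboundary_zmod k).

Definition cohomology k := Quotient.quot (@coboundary k).
HB.instance Definition _ k := GRing.Zmodule.on (cohomology k).

Definition cohom_class k (f : cocycle k) : cohomology k := \pi_(cohomology k) f.

Lemma cup_cocycle i j (f : cocycle i) (g : cocycle j) :
  cocup f g \in [pred h | delta h == 0].
Proof.
rewrite inE; apply/eqP/coval_inj => s.
rewrite delta_cup !delta_cocycle coval0.
have cup0l : cocup (0 : cochain i.+1) g = 0.
  by apply/ffunP=> t; rewrite !ffunE coval0 mul0r.
have cup0r : cocup f (0 : cochain j.+1) = 0.
  by apply/ffunP=> t; rewrite !ffunE coval0 mulr0.
by rewrite cup0l cup0r !coval0 mulr0 addr0.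
Qed.

Definition cup_cocycles i j (f : cocycle i) (g : cocycle j) : cocycle (i + j) :=
  Cocycle (cup_cocycle f g).

Definition cup i j (x : cohomology i) (y : cohomology j) : cohomology (i + j) :=
  cohom_class (cup_cocycles (repr x) (repr y)).

Lemma coboundaryP k (f : cocycle k) :
  f \in @coboundary k <->
  f = 0 \/ exists j (h : cochain j), k = j.+1 /\ coval f =1 coval (delta h).
Proof.
case: k f => [|k] f; rewrite /in_mem /=; split.
- by move/eqP; left.
- by case=> [->//|[j [h []]]].
- by move=> /asboolP[h fh]; right; exists k, h; split=> // s; rewrite fh.
case=> [->|[j [h [[kj] fh]]]]; apply/asboolP.
  by exists 0; rewrite delta0.
by subst j; exists h; apply/coval_inj.
Qed.

Lemma cup_coboundaryl i j (f : cocycle i) (g : cocycle j) :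
  f \in @coboundary i -> cup_cocycles f g \in @coboundary (i + j).
Proof.
case/coboundaryP => [->|[k [h [ik fh]]]]; apply/coboundaryP.
  by left; apply/val_inj/ffunP=> t; rewrite !ffunE coval0 mul0r.
right; subst i; exists (k + j)%N, (cocup h g); split=> // s.
rewrite delta_cup delta_cocycle /= (coval_inj fh).
have -> : cocup h (0 : cochain j.+1) = 0.
  by apply/ffunP=> t; rewrite !ffunE coval0 mulr0.
by rewrite coval0 mulr0 addr0.
Qed.

Lemma cup_coboundaryr i j (f : cocycle i) (g : cocycle j) :
  g \in @coboundary j -> cup_cocycles f g \in @coboundary (i + j).
Proof.
case/coboundaryP => [->|[k [h [jk gh]]]]; apply/coboundaryP.
  by left; apply/val_inj/ffunP=> t; rewrite !ffunE coval0 mulr0.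
right; subst j; exists (i + k)%N, [ffun t => (-1) ^+ i * cocup f h t].
split=> [|s]; first by rewrite addnS.
rewrite deltaZ delta_cup delta_cocycle /= (coval_inj gh).
have -> : cocup (0 : cochain i.+1) h = 0.
  by apply/ffunP=> t; rewrite !ffunE coval0 mul0r.
by rewrite coval0 add0r mulrA -expr2 sqrr_sign mul1r.
Qed.

Lemma cup_class i j (f : cocycle i) (g : cocycle j) :
  cup (cohom_class f) (cohom_class g) = cohom_class (cup_cocycles f g).
Proof.
have reprP k (u : cocycle k) : repr (cohom_class u) - u \in @coboundary k.
  by rewrite Quotient.idealrBE reprK.
apply/eqP; rewrite -Quotient.idealrBE.
set f' := repr _; set g' := repr _.
rewrite -(subrK (cup_cocycles f g') (cup_cocycles f' g')) -addrA.
apply: rpredD.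
  have -> : cup_cocycles f' g' - cup_cocycles f g' = cup_cocycles (f' - f) g'.
    apply/val_inj/ffunP=> t; rewrite !ffunE /= covalD covalN mulrBl.
    by [].
  by apply: cup_coboundaryl; apply: reprP.
have -> : cup_cocycles f g' - cup_cocycles f g = cup_cocycles f (g' - g).
  by apply/val_inj/ffunP=> t; rewrite !ffunE /= covalD covalN mulrBr.
by apply: cup_coboundaryr; apply: reprP.
Qed.

Lemma cochain1_cocycle : cochain1 \in [pred h | delta h == 0].
Proof.
rewrite inE; apply/eqP/ffunP=> s; rewrite !ffunE.
have /andP[sX /eqP cs] := valP s.
have face v : v \in val s -> coval cochain1 (val s :\ v) = 1.
  move=> vs; have cv : #|val s :\ v| = 1%N.
    by move: cs; rewrite (cardsD1 v) vs => -[].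
  have h : (val s :\ v \in X) && (#|val s :\ v| == 1%N).
    by rewrite cv eqxx andbT (faces_sub sX) ?subD1set // -card_gt0 cv.
  by rewrite -[val s :\ v]/(val (exist _ (val s :\ v) h : simplex 0)) coval_simplex ffunE.
have [p ps p0] : exists2 v, v \in val s & vrank (val s) v = 0%N.
  by apply: vrank_ex; rewrite cs.
have [q qs q1] : exists2 v, v \in val s & vrank (val s) v = 1%N.
  by apply: vrank_ex; rewrite cs.
have qp : q != p by apply: contra_eq_neq q1 => ->; rewrite p0.
rewrite (bigD1 p) //= (bigD1 q) ?qs //= big1 => [|v /andP[/andP[vs vp] vq]].
  by rewrite p0 q1 !face // expr0 expr1 mul1r mulN1r addr0 subrr.
have nr w : w \in val s -> v != w -> vrank (val s) v != vrank (val s) w.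
  by move=> ws; rewrite (inj_in_eq (@vrank_inj (val s))).
have := leq_trans (vrank_lt vs) (eq_leq cs).
move: (nr p ps vp) (nr q qs vq); rewrite p0 q1.
by case: (vrank _ v) => [|[|]].
Qed.

Definition cohomology1 : cohomology 0 :=
  cohom_class (Cocycle cochain1_cocycle).

(* [cup_product m x]: x is the product of m classes of positive degree. *)
Inductive cup_product : nat -> forall k, cohomology k -> Prop :=
| cup_product0 : cup_product 0 cohomology1
| cup_productS m i j (x : cohomology i) (y : cohomology j) :
    (0 < i)%N -> cup_product m y -> cup_product m.+1 (cup x y).

Definition has_cup_product m : Prop :=
  exists k (x : cohomology k), cup_product m x /\ x <> 0.

Definition cup_length_le m : Prop :=
  forall m', has_cup_product m' -> (m' <= m)%N.

Definition cup_length_eq m : Prop := has_cup_product m /\ cup_length_le m.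

Definition cup_trivial d : Prop :=
  forall i j (x : cohomology i) (y : cohomology j),
    (0 < i)%N -> (0 < j)%N -> (i + j)%N = d -> cup x y = 0.

End Cochains.
End SimplicialCohomology.

Lemma lower_faces_sub n (H : {set {set 'I_n}}) (s t : {set 'I_n}) :
  let F := [set s | (s != set0) && [forall t : {set 'I_n},
                     (t \subset s) && (1 < #|t|)%N ==> (t \in H)]] in
  s \in F -> t \subset s -> t != set0 -> t \in F.
Proof.
move=> F; rewrite !inE => /andP[_ /forallP sH] ts ->.
apply/forallP=> u; apply/implyP => /andP[ut cu].
by apply: (implyP (sH u)); rewrite cu (subset_trans ut ts).
Qed.

Lemma lower_faces_neq0 n (H : {set {set 'I_n}}) :
  set0 \notin [set s | (s != set0) && [forall t : {set 'I_n},
                     (t \subset s) && (1 < #|t|)%N ==> (t \in H)]].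
Proof. by rewrite inE eqxx. Qed.

Definition lower_complex n (H : {set {set 'I_n}}) : scomplex n :=
  SComplex (lower_faces_neq0 H) (@lower_faces_sub n H).

Lemma lower_complex_vertex n (H : {set {set 'I_n}}) (v : 'I_n) :
  [set v] \in lower_complex H.
Proof.
rewrite inE; apply/andP; split; first by apply/set0Pn; exists v; rewrite inE.
apply/forallP=> t; apply/implyP => /andP[/subset_leq_card]; rewrite cards1.
by move=> t1 t2; have := leq_trans t2 t1.
Qed.

Lemma lower_complex_sub n (H : {set {set 'I_n}}) (s : {set 'I_n}) :
  s \in lower_complex H -> (1 < #|s|)%N -> s \in H.
Proof.
by rewrite inE => /andP[_ /forallP/(_ s)]; rewrite subxx => /implyP sH /sH.
Qed.

Lemma lower_complex_max n (H : {set {set 'I_n}}) (Y : scomplex n) :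
  (forall s : {set 'I_n}, s \in Y -> (1 < #|s|)%N -> s \in H) ->
  Y \subset lower_complex H.
Proof.
move=> YH; apply/subsetP => s sY; rewrite inE; apply/andP; split.
  by apply: contraNneq (faces_neq0 Y) => <-.
apply/forallP => t; apply/implyP => /andP[ts t1]; apply: YH => //.
by apply: faces_sub sY ts _; rewrite -card_gt0 ltnW.
Qed.

From mathcomp Require Import all_classical all_reals all_analysis.
Import numFieldNormedType.Exports.
Local Open Scope classical_set_scope.

Section LowerModel.
Variable R : realType.

(* A hyperedge with i + 1 vertices, i >= 1, is present with probability p i;
   [hypergraph_prob p H] is the probability that H is the set of hyperedges. *)
Definition hypergraph_prob n (p : nat -> R) (H : {set {set 'I_n}}) : R :=
  \prod_(t : {set 'I_n} | (1 < #|t|)%N)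
    (if t \in H then p #|t|.-1 else 1 - p #|t|.-1).

Definition lower_prob n (p : nat -> R) (P : scomplex n -> Prop) : R :=
  \sum_(H : {set {set 'I_n}} |
         [forall t in H, (1 < #|t|)%N] && `[< P (lower_complex H) >])
    hypergraph_prob p H.

Definition aas_lower (alpha : nat -> R) (P : forall n, scomplex n -> Prop) :=
  (fun n => lower_prob (fun i => n%:R `^ (- alpha i)) (P n)) @ \oo --> (1 : R).

Definition S1 (k : nat) (alpha : nat -> R) : R :=
  \sum_(1 <= i < k.+2) 'C(k.+1, i)%:R * alpha i.

End LowerModel.

(* Main.v *)
(* A face with [k + 1] vertices has about [n ^ (1 - S1 k alpha)] cofaces, and [S1] is
   increasing in [k]; let [l] be the least degree with [1 < S1 l alpha].

   Above. By a first moment bound, a.a.s. no bounded set [W] of vertices spans faces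
   of total weight (the sum of [alpha]) at least [S' * #|W|], for some fixed
   [1 < S' < S1 l alpha].  Hence the components of the faces of dimension at least
   [l], joined by inclusion, are bounded, and one of them carries any non-trivial
   product of degree [d >= 2 * l]. There, a vertex can be deleted without killing the
   product unless its link has cohomology in degree [d - 1]; such a link has at least
   as many faces as the boundary of a [d]-simplex, and counting faces shows that a
   complex all of whose links are of this kind is too dense. (Links equal to the
   boundary of a simplex are dealt with by undoing a stellar subdivision.)

   Below. If [S1 j alpha < 1], then [H^j] vanishes over the rationals by Garland's
   method: a harmonic cocycle restricts to functions of mean zero on the links of
   the faces with [j] vertices; these links are random graphs of large degree, whose
   spectral gap comes from the trace of an even power of the centred adjacency matrix.
   So a product of two classes of positive degree has degree at least [2 * l].

   At [l]. If [alpha 1 < 1], there are more [l]-dimensional faces than faces of the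
   two neighbouring dimensions together, so [H^l] is non-zero. If [alpha 1 = 1], then
   [l = 1]: there is no triangle, and the second moment of the number of cycles of
   bounded length, whose mean is a partial sum of the harmonic series, shows that the
   graph is not a forest. *)

Require Import Defs.
From HB Require Import structures.
From mathcomp Require Import all_boot all_order all_algebra.
From mathcomp Require Import all_classical all_reals all_analysis.
From mathcomp Require Import ring lra zify.
(* Imported again because classical_sets shadows finite-set lemmas such as [subsetP]. *)
From mathcomp Require Import ssrbool eqtype ssrnat fintype bigop finset.

Set Implicit Arguments.
Unset Strict Implicit.
Unset Printing Implicit Defensive.

Import Order.TTheory GRing.Theory Num.Theory.
Import numFieldNormedType.Exports.

Local Open Scope ring_scope.

(** * Cochains on families of vertex sets *)

Section Cochains.
Variables (n : nat) (A : pzRingType).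
Local Notation T := 'I_n.
Implicit Types (K L : {set {set T}}) (s t : {set T}) (g h c : {set T} -> A).

(** The density [S1 l alpha] per vertex asks each link for at least [i.+1 * 'C(l.+1, i)] faces with
    [i] vertices. The boundary of a [2 * l]-simplex has that many for [2 <= i <= l.+1], but for
    [i = 1] it has [2 * l + 1] vertices where [2 * l + 2] are asked. This deficit of one vertex is
    the obstacle, and the only point where the product matters. When a link is the boundary of a
    [d]-simplex, that simplex and the cone over it are filled in; this puts no new condition on
    cocycles of degree below [d], so both factors survive, while a general cocycle of degree [d]
    would have to satisfy one more equation on the cone.

    The number [S'] has slack on both sides: [1 < S'] makes the expected number of dense vertex sets
    tend to 0, and [S' < S1 l alpha] lets a growing component overtake [S'] per vertex after
    boundedly many steps. Sparsity mentions no ring, so one negligible event serves all rings and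
    degrees.

    Reals enter the vanishing below [l] only in estimates: the harmonic representative is found over
    the rationals by solving normal equations. *)

Definition dlt g s : A := \sum_(v in s) (-1) ^+ vrank s v * g (s :\ v).

(** Cochains are functions on all vertex sets, so that restriction to a subcomplex leaves the
    function unchanged. The index [m] counts vertices and exceeds the degree by one. *)
Definition cocyc K m g := forall s, s \in K -> #|s| = m.+1 -> dlt g s = 0.

Definition cobdy K m g :=
  exists h, forall s, s \in K -> #|s| = m -> g s = dlt h s.

(* Vanishing of the reduced cohomology in degree [m - 1]: the empty set counts
   as a face, of size 0. *)
Definition acyclic K m := forall g, cocyc K m g -> cobdy K m g.

Definition down K := forall s t, s \in K -> t \subset s -> t \in K.

(** The part of [g] on faces through [v], read as a cochain on the link; the sign moves [v] to the
    front of the ordering. *)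
Definition slice (v : T) g s : A := (-1) ^+ vrank s v * g (v |: s).

Definition lk K v : {set {set T}} := [set s in K | (v \notin s) && (v |: s \in K)].

Definition del K (v : T) : {set {set T}} := [set s in K | v \notin s].

Lemma vrank_setU1 s v u : v \notin s -> u != v ->
  vrank (v |: s) u = (vrank s u + (v < u))%N.
Proof.
move=> vs uv; rewrite (vrankD1 u (setU11 v s)) setU1K //.
by case: (v < u)%N; rewrite ?addn1 ?addn0.
Qed.

Lemma vrank_setU1_id s v : vrank (v |: s) v = vrank s v.
Proof.
by apply: eq_card => w; rewrite !inE; case: eqVneq => //= ->; rewrite ltnn andbF.
Qed.

Lemma setU1D s (v u : T) : u != v -> (v |: s) :\ u = v |: (s :\ u).
Proof.
move=> uv; apply/setP=> w; rewrite !inE.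
by case: (eqVneq w v) => [->|_] //=; rewrite eq_sym uv.
Qed.

Lemma sum_setU1 (V : nmodType) s (v : T) (F : T -> V) : v \notin s ->
  \sum_(u in v |: s) F u = F v + \sum_(u in s) F u.
Proof. by move=> vs; rewrite big_setU1. Qed.

(** With [v] in front, removing [v] has sign [+] and every other vertex is shifted by one position.
    This homotopy formula of a cone carries all inductions on vertices below. *)
Lemma slice_dlt v g s : v \notin s ->
  slice v (dlt g) s = g s - dlt (slice v g) s.
Proof.
move=> vs; rewrite /slice {1}/dlt sum_setU1 // mulrDr setU1K // vrank_setU1_id.
rewrite mulrA -expr2 sqrr_sign mul1r; congr (_ + _).
rewrite mulr_sumr /dlt -sumrN; apply: eq_bigr => u us.
have uv : u != v by apply: contraNneq vs => <-.
have vu : v \notin s :\ u by rewrite !inE negb_and vs orbT.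
rewrite vrank_setU1 // setU1D // (vrankD1 v us).
case: (ltngtP u v) => [uv'|vu'|/val_inj e]; last by rewrite e eqxx in uv.
  by rewrite addn0 exprS mulN1r !mulNr !mulrA (commr_sign _ (vrank s u)) .
by rewrite addn1 exprS mulN1r !(mulNr, mulrN) !mulrA (commr_sign _ (vrank s u)).
Qed.

Lemma eq_dlt g h s : (forall v, v \in s -> g (s :\ v) = h (s :\ v)) ->
  dlt g s = dlt h s.
Proof. by move=> gh; apply: eq_bigr => v vs; rewrite gh. Qed.

Lemma dltD g h s : dlt (fun t => g t + h t) s = dlt g s + dlt h s.
Proof. by rewrite /dlt -big_split; apply: eq_bigr => v _; rewrite mulrDr. Qed.

Lemma dltB g h s : dlt (fun t => g t - h t) s = dlt g s - dlt h s.
Proof. by rewrite /dlt -sumrB; apply: eq_bigr => v _; rewrite mulrBr. Qed.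

Lemma dlt_eq0 g s : (forall v, v \in s -> g (s :\ v) = 0) -> dlt g s = 0.
Proof. by move=> g0; apply: big1 => v vs; rewrite g0 ?mulr0. Qed.

Lemma slice_eq0 v g s : (slice v g s == 0) = (g (v |: s) == 0).
Proof.
apply/eqP/eqP => [e|e]; last by rewrite /slice e mulr0.
by rewrite -[LHS](signrMK (vrank s v)) -/(slice v g s) e mulr0.
Qed.

Lemma slice_inj v g h s : slice v g s = slice v h s -> g (v |: s) = h (v |: s).
Proof. by move/(congr1 ( *%R ((-1) ^+ vrank s v))); rewrite !signrMK. Qed.

Lemma dlt_dlt g s : dlt (dlt g) s = 0.
Proof.
move: {2}#|s| (erefl #|s|) => m; elim: m g s => [|m IH] g s.
  by move/cards0_eq->; rewrite dlt_eq0 // => v; rewrite inE.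
move=> ms; have /card_gt0P[v vs] : (0 < #|s|)%N by rewrite ms.
have vn : v \notin s :\ v by rewrite !inE eqxx.
rewrite -(setD1K vs); apply/eqP; rewrite -slice_eq0 slice_dlt //.
rewrite (@eq_dlt (slice v _) (fun t => g t - dlt (slice v g) t)); last first.
  by move=> u us; rewrite slice_dlt // !inE eqxx andbF.
rewrite dltB IH ?subr0 ?subrr //.
by apply/eqP; rewrite -eqSS -ms (cardsD1 v s) vs.
Qed.

Lemma down_del K v : down K -> down (del K v).
Proof.
move=> dK s t; rewrite !inE => /andP[sK vs] ts; rewrite (dK s) //=.
exact: contra (subsetP ts v) vs.
Qed.

Lemma down_lk K v : down K -> down (lk K v).
Proof.
move=> dK s t; rewrite !inE => /and3P[sK vs vsK] ts.
have vt : v \notin t by apply: contra vs; apply: (subsetP ts).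
by apply/and3P; split=> //; [exact: dK sK ts|exact: dK vsK (setUS _ ts)].
Qed.

Lemma lkE K v s : down K -> (s \in lk K v) = (v \notin s) && (v |: s \in K).
Proof.
move=> dK; rewrite inE; apply: andb_idl => /andP[_ vsK].
exact: dK vsK (subsetUr _ _).
Qed.

(** The part of the Mayer-Vietoris sequence for [K] as the union of the deletion and the cone over
    the link: a primitive on the deletion extends over [v] up to a class of the link in one degree
    less. *)
Lemma cobdy_del K v m c : down K -> acyclic (lk K v) m -> cocyc K m.+1 c ->
  cobdy (del K v) m.+1 c -> cobdy K m.+1 c.
Proof.
move=> dK acL cK [b cb]; pose c' s := c s - dlt b s.
have c'0 s : s \in del K v -> #|s| = m.+1 -> c' s = 0.
  by move=> sK ms; rewrite /c' cb ?subrr.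
have c'K : cocyc K m.+1 c'.
  by move=> s sK ms; rewrite dltB cK // dlt_dlt subrr.
have [|h hE] := acL (slice v c').
  move=> s; rewrite lkE // => /andP[vs vsK] ms.
  have := slice_dlt c' vs; rewrite /slice c'K ?cardsU1 ?vs ?ms // mulr0.
  rewrite c'0 ?inE ?vs ?ms ?(dK _ _ vsK) ?subsetUr // -/(slice v c') sub0r.
  by move/eqP; rewrite eq_sym oppr_eq0 => /eqP.
(* The primitive found on the link, put back on the faces through [v]; the minus sign is the one in
   [slice_dlt]. *)
pose k t := if v \in t then - ((-1) ^+ vrank (t :\ v) v * h (t :\ v)) else 0.
have slk s : v \notin s -> slice v k s = - h s.
  move=> vs; rewrite /slice /k setU11 setU1K // mulrN.
  by rewrite signrMK.
exists (fun t => b t + k t) => s sK ms; rewrite dltD.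
apply/eqP; rewrite addrC -subr_eq; apply/eqP.
rewrite -/(c' s); have [vs|vs] := boolP (v \in s); last first.
  rewrite c'0 ?inE ?sK // dlt_eq0 // => u us; rewrite /k.
  by rewrite inE (negPf vs) andbF.
have vn : v \notin s :\ v by rewrite !inE eqxx.
have sz : #|s :\ v| = m by move: ms; rewrite (cardsD1 v) vs => -[].
rewrite -(setD1K vs); apply: (@slice_inj v); rewrite slice_dlt //.
rewrite hE // ?lkE ?vn ?setD1K //.
rewrite /k (negPf vn) sub0r.
rewrite (@eq_dlt (slice v _) (fun t => 0 - h t)) ?dltB.
  rewrite (@dlt_eq0 (fun=> 0)) // sub0r opprK //.
by move=> u us; rewrite -/k slk ?sub0r // !inE eqxx andbF.
Qed.

Lemma acyclic_cone K w m : down K -> (forall s, s \in K -> w |: s \in K) ->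
  acyclic K m.
Proof.
move=> dK cone c cK.
exists (fun t => if w \in t then 0 else slice w c t) => s sK ms.
have [ws|ws] := boolP (w \in s); last first.
  have := slice_dlt c ws; rewrite {1}/slice cK ?cone ?cardsU1 ?ws ?ms //.
  rewrite mulr0 => /eqP; rewrite eq_sym subr_eq0 => /eqP ->; apply: eq_dlt => v vs.
  by rewrite !inE (negPf ws) andbF.
have wn : w \notin s :\ w by rewrite !inE eqxx.
rewrite -{1 2}(setD1K ws); apply: (@slice_inj w); rewrite slice_dlt //.
rewrite (negPf wn) dlt_eq0 ?subr0 // => u us; rewrite /slice.
by rewrite setU11 mulr0.
Qed.

Lemma cobdyS K L m c : L \subset K -> cobdy K m c -> cobdy L m c.
Proof. by move=> LK [h hE]; exists h => s /(subsetP LK); apply: hE. Qed.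

Lemma cocycS K L m c : L \subset K -> cocyc K m c -> cocyc L m c.
Proof. by move=> LK cK s /(subsetP LK); apply: cK. Qed.

End Cochains.

(** * Face numbers of complexes with non-zero cohomology *)

Section FaceNumbers.
Variables (n : nat) (A : pzRingType).
Local Notation T := 'I_n.
Implicit Types (K L : {set {set T}}) (s t : {set T}).

Definition fcount K i := #|[set s in K | #|s| == i]|.

Definition verts K : {set T} := [set v | [set v] \in K].

Lemma fcount1 K : fcount K 1 = #|verts K|.
Proof.
rewrite -(card_imset (mem (verts K)) set1_inj); apply: eq_card => s.
rewrite inE; apply/andP/imsetP => [[sK /cards1P[v sv]]|[v vK ->]].
  by exists v => //; rewrite inE -sv.
by move: vK; rewrite inE cards1.
Qed.

Lemma fcountS K L i : K \subset L -> (fcount K i <= fcount L i)%N.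
Proof.
move=> KL; apply: subset_leq_card; apply/subsetP => s.
by rewrite !inE => /andP[/(subsetP KL) -> ->].
Qed.

Lemma sub_verts K s : down K -> s \in K -> s \subset verts K.
Proof.
by move=> dK sK; apply/subsetP => v vs; rewrite inE (dK s) // sub1set.
Qed.

Lemma sum_fcount_lk K i : down K ->
  (\sum_(v in verts K) fcount (lk K v) i = i.+1 * fcount K i.+1)%N.
Proof.
move=> dK; pose E v := [set t in K | (#|t| == i.+1) && (v \in t)].
transitivity (\sum_(v : T) #|E v|)%N.
  rewrite [RHS](bigID (mem (verts K))) /= [X in (_ + X)%N]big1 ?addn0.
    apply: eq_bigr => v _.
    have inj : {in [set s in lk K v | #|s| == i] &, injective (fun s => v |: s)}.
      move=> s t; rewrite !inE => /andP[/and3P[_ vs _] _] /andP[/and3P[_ vt _] _] e.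
      by rewrite -(setU1K vs) e setU1K.
    rewrite /fcount -(card_in_imset inj); apply: eq_card => t.
    apply/imsetP/idP => [[s]|].
      rewrite inE lkE // => /andP[/andP[vs vsK] /eqP si] ->.
      by rewrite !inE vsK cardsU1 vs si !eqxx.
    rewrite inE => /and3P[tK /eqP ti vt].
    have ct : #|t :\ v| = i by apply/eqP; rewrite -eqSS -ti (cardsD1 v t) vt.
    exists (t :\ v); last by rewrite setD1K.
    by rewrite inE lkE // setD1K // tK !inE eqxx /= ct.
  move=> v; rewrite inE => vK; apply: eq_card0 => t; rewrite !inE.
  apply/negP => /and3P[tK _ vt]; case/negP: vK.
  by rewrite (dK t) // sub1set.
under eq_bigr do rewrite -sum1_card.
rewrite (exchange_big_dep (mem [set t in K | #|t| == i.+1])) /=; last first.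
  by move=> v t _; rewrite !inE => /and3P[-> ->].
rewrite mulnC -sum_nat_const; apply: eq_bigr => t; rewrite inE => /andP[tK ti].
rewrite -(eqP ti) -sum1_card; apply: eq_bigl => v.
by rewrite inE tK ti.
Qed.

(** A face with [m] vertices uses up all vertices, so [K] is a full simplex and hence a cone. *)
Lemma acyclic_few K m : down K -> (0 < m)%N -> (#|verts K| <= m)%N ->
  acyclic A K m.
Proof.
move=> dK m0 Vm c cK.
have [[s [sK sm]]|no] := pselect (exists s, s \in K /\ #|s| = m); last first.
  by exists (fun=> 0) => s sK sm; case: no; exists s.
have sV : s = verts K.
  by apply/eqP; rewrite eqEcard sub_verts // sm.
have /card_gt0P[w ws] : (0 < #|s|)%N by rewrite sm.
apply: (@acyclic_cone _ _ _ w) => // t tK; apply: (dK s) => //.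
by rewrite subUset sub1set ws sV sub_verts.
Qed.

Lemma sub_del K (v : T) : del K v \subset K.
Proof. by apply/subsetP => s; rewrite inE => /andP[]. Qed.

Lemma sub_lk K (v : T) : lk K v \subset K.
Proof. by apply/subsetP => s; rewrite inE => /andP[]. Qed.

Lemma not_acyclic_lk K (v : T) m : down K -> acyclic A (del K v) m.+1 ->
  ~ acyclic A K m.+1 -> ~ acyclic A (lk K v) m.
Proof.
move=> dK ad na al; apply: na => c cK; apply: (cobdy_del dK al cK).
by apply: ad; apply: cocycS cK; apply: sub_del.
Qed.

(** The boundary of an [m]-simplex is extremal. Vertices are deleted while the cohomology survives;
    after that every link has cohomology one degree lower, there are at least [m.+1] vertices, and
    counting faces through their vertices gives the bound. *)
Lemma not_acyclic_fcount K m i : down K -> ~ acyclic A K m -> (i <= m)%N ->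
  ('C(m.+1, i) <= fcount K i)%N.
Proof.
move: {2}#|K|.+1 (ltnSn #|K|) => N; elim: N K m i => // N IH K m i KN dK na im.
have K0 : set0 \in K.
  apply: contrapT => /negP K0; apply: na => c _; exists (fun=> 0) => s sK _.
  by case/negP: K0; apply: dK sK (sub0set _).
case: i im => [|i] im.
  by rewrite bin0 card_gt0; apply/set0Pn; exists set0; rewrite inE K0 cards0 eqxx.
case: m im na => // m im na.
have [[v [vK nd]]|ad] :=
  pselect (exists v, v \in verts K /\ ~ acyclic A (del K v) m.+1).
  apply: (@leq_trans (fcount (del K v) i.+1)); last exact/fcountS/sub_del.
  apply: IH => //; last exact: down_del.
  rewrite -ltnS; apply: leq_trans KN; rewrite ltnS proper_card //.
  rewrite properE sub_del /=; apply/subsetPn; exists [set v].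
    by rewrite inE in vK.
  by rewrite !inE eqxx andbF.
have Vm : (m.+2 <= #|verts K|)%N.
  by rewrite ltnNge; apply/negP => le; apply: na; apply: acyclic_few.
rewrite -(leq_pmul2l (ltn0Sn i)) -mul_bin_diag -sum_fcount_lk //.
apply: (@leq_trans (\sum_(v in verts K) 'C(m.+1, i))).
  by rewrite sum_nat_const leq_mul2r Vm orbT.
apply: leq_sum => v vK; apply: IH => //; last 1 first.
- apply: not_acyclic_lk => //; apply: contrapT => nd.
  by apply: ad; exists v.
- rewrite -ltnS; apply: leq_trans KN; rewrite ltnS proper_card //.
  rewrite properE sub_lk /=; apply/subsetPn; exists [set v].
    by rewrite inE in vK.
  by rewrite !inE eqxx andbF.
- exact: down_lk.
Qed.

End FaceNumbers.

(** Compares the face numbers of the boundary of a [2 * l]-simplex with what density [S1 l alpha]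
    asks of a link. The range starts at 2 because for [i = 1] the inequality fails by one. *)
Lemma bin_ineq l i : (0 < l)%N -> (2 <= i <= l.+1)%N ->
  (i.+1 * 'C(l.+1, i) <= 'C(l.*2.+1, i))%N.
Proof.
move=> l0; elim: i => // i IH /andP[]; rewrite ltnS leq_eqVlt => /orP[/eqP <- _|i1 il].
  have e1 : (2 * 'C(l.+1, 2) = l.+1 * l)%N by rewrite -mul_bin_diag bin1 mulnC.
  have e2 : (2 * 'C(l.*2.+1, 2) = l.*2.+1 * l.*2)%N.
    by rewrite -mul_bin_diag bin1 mulnC.
  by nia.
have := IH _; rewrite i1 (ltnW il) => /(_ isT) H.
have e1 := mul_bin_left l.+1 i; have e2 := mul_bin_left l.*2.+1 i.
rewrite -(leq_pmul2l (ltn0Sn i)).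
rewrite mulnCA e1 e2.
apply: (@leq_trans ((l.*2.+1 - i) * (i.+1 * 'C(l.+1, i)))); last by rewrite leq_mul2l H orbT.
rewrite !mulnA leq_mul2r; apply/orP; right; nia.
Qed.

(** * Cup products of functions on vertex sets *)

Section Cup.
Variables (n : nat) (A : pzRingType).
Local Notation T := 'I_n.
Implicit Types (K L : {set {set T}}) (s t : {set T}) (x y g : {set T} -> A).

Definition cochain_of (X : scomplex n) k g : cochain X A k :=
  [ffun s => g (val s)].

Lemma coval_of (X : scomplex n) k g s : s \in X -> #|s| = k.+1 ->
  coval (cochain_of X k g) s = g s.
Proof.
move=> sX sk; have h : (s \in X) && (#|s| == k.+1) by rewrite sX sk eqxx.
by rewrite -[s]/(val (exist _ s h : simplex X k)) coval_simplex ffunE.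
Qed.

Lemma coval_delta_of (X : scomplex n) k g s : s \in X -> #|s| = k.+2 ->
  coval (delta (cochain_of X k g)) s = dlt g s.
Proof.
move=> sX sk; rewrite coval_delta //; apply: eq_bigr => v vs.
have ck : #|s :\ v| = k.+1 by apply/eqP; rewrite -eqSS -sk (cardsD1 v s) vs.
by rewrite coval_of // (faces_sub sX) ?subD1set // -card_gt0 ck.
Qed.

Lemma full_faces_neq0 : set0 \notin [set s : {set T} | s != set0].
Proof. by rewrite inE eqxx. Qed.

Lemma full_faces_sub s t : s \in [set s : {set T} | s != set0] ->
  t \subset s -> t != set0 -> t \in [set s : {set T} | s != set0].
Proof. by rewrite !inE. Qed.

(** No face is missing from the full simplex, so the Leibniz rule [delta_cup] there is an identity
    between functions on vertex sets. *)
Definition full_complex : scomplex n := SComplex full_faces_neq0 full_faces_sub.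

Definition cupf i x y s := x (front s i) * y (back s i).

Lemma dlt_cupf i j x y s : #|s| = (i + j).+2 ->
  dlt (cupf i x y) s = dlt x (front s i.+1) * y (back s i.+1)
     + (-1) ^+ i * (x (front s i) * dlt y (back s i)).
Proof.
move=> sz; pose X := full_complex.
have inX t k : #|t| = k.+1 -> t \in X by rewrite inE -card_gt0 => ->.
have cF a : (a < #|s|)%N -> #|front s a| = a.+1 by apply: card_front.
have s1 : (i.+1 < #|s|)%N by rewrite sz !ltnS leq_addr.
have cB0 : #|back s i| = j.+2 by rewrite card_back sz -addnS -addnS addKn.
have cB1 : #|back s i.+1| = j.+1 by rewrite card_back sz subSS -addnS addKn.
rewrite -(@coval_delta_of X (i + j)) ?(inX _ _ sz) //.
have -> : cochain_of X (i + j) (cupf i x y)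
       = cocup (cochain_of X i x) (cochain_of X j y).
  apply/ffunP => t; rewrite !ffunE; have /andP[tX /eqP tz] := valP t.
  have ti : (i < #|val t|)%N by rewrite tz ltnS leq_addr.
  have c1 := card_front ti.
  have c2 : #|back (val t) i| = j.+1 by rewrite card_back tz -addnS addKn.
  by rewrite !coval_of ?(inX _ _ c1) ?(inX _ _ c2).
rewrite delta_cup !coval_cup ?(inX _ _ sz) ?addnS //.
rewrite !coval_delta_of ?(inX _ _ (cF _ s1)) ?(inX _ _ cB0) ?cF //.
by rewrite !coval_of ?(inX _ _ (cF _ (ltnW s1))) ?(inX _ _ cB1) ?cF // ltnW.
Qed.

Lemma cocyc_cupf K i j x y : down K -> cocyc K i.+1 x -> cocyc K j.+1 y ->
  cocyc K (i + j).+1 (cupf i x y).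
Proof.
move=> dK xK yK s sK sz; rewrite (dlt_cupf _ _ sz) xK ?yK ?(dK _ _ sK) //.
- by rewrite mul0r mulr0 mulr0 addr0.
- exact: back_sub.
- by rewrite card_back sz -addnS -addnS addKn.
- exact: front_sub.
- by rewrite card_front // sz !ltnS leq_addr.
Qed.
End Cup.

(** * Non-trivial products force dense subcomplexes *)

Section Weight.
Variables (R : realType) (alpha : nat -> R).
Hypothesis alpha_gt0 : forall i, (0 < i)%N -> 0 < alpha i.

(** The exponent of rarity: the hyperedges of [K] are all present with probability
    [n ^ (- weight K)]. *)
Definition weight n (K : {set {set 'I_n}}) : R :=
  \sum_(s in K | (1 < #|s|)%N) alpha #|s|.-1.

Lemma S1E k : S1 k alpha = \sum_(i < k.+1) 'C(k.+1, i.+1)%:R * alpha i.+1.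
Proof. by rewrite /S1 big_add1 /= big_mkord. Qed.

Lemma S1_ge0 k : 0 <= S1 k alpha.
Proof.
by rewrite S1E sumr_ge0 // => i _; rewrite mulr_ge0 ?ler0n // ltW ?alpha_gt0.
Qed.

Lemma weightS n (K L : {set {set 'I_n}}) : K \subset L -> weight K <= weight L.
Proof.
move=> KL; rewrite /weight [leRHS](bigID (mem K)) /= -[leLHS]addr0 lerD //.
  rewrite le_eqVlt; apply/orP; left; apply/eqP; apply: eq_bigl => s.
  by case sK: (s \in K); rewrite ?andbF //= (subsetP KL _ sK) andbT.
apply: sumr_ge0 => s /andP[/andP[_ s1] _]; apply/ltW/alpha_gt0.
by rewrite -ltnS prednK // ltnW.
Qed.

Lemma weight_fcount n (K : {set {set 'I_n}}) l :
  \sum_(i < l) (fcount K i.+2)%:R * alpha i.+1 <= weight K.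
Proof.
have e (i : 'I_l) : (fcount K i.+2)%:R * alpha i.+1 =
    \sum_(s in K | #|s| == i.+2) alpha #|s|.-1.
  rewrite /fcount -sum1_card natr_sum mulr_suml; apply: eq_big => s.
    by rewrite inE.
  by rewrite inE => /andP[_ /eqP ->]; rewrite mul1r.
rewrite (eq_bigr _ (fun i _ => e i)) {e}.
rewrite (exchange_big_dep (fun s => (s \in K) && (1 < #|s|)%N)) /=; last first.
  by move=> i s _ /andP[-> /eqP ->].
apply: ler_sum => s /andP[sK s1].
have a0 : 0 <= alpha #|s|.-1 by apply/ltW/alpha_gt0; rewrite -ltnS prednK // ltnW.
have [sl|ls] := ltnP #|s|.-2 l; last first.
  rewrite big1 // => i /andP[_ /eqP si]; move: ls; rewrite si /=.
  by rewrite leqNgt ltn_ord.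
rewrite (big_pred1 (Ordinal sl)) // => i; rewrite sK /=.
rewrite -(inj_eq val_inj) /=; case: #|s| s1 => [|[|k]] //= _.
by rewrite !eqSS eq_sym.
Qed.

(** Joining a new vertex [u] to [s] takes the hyperedges [u |: t] for all non-empty [t] in [s], of
    exponent [alpha #|t|]; so [S1 k alpha] is the price of a coface. *)
Lemma sum_subsets n (s : {set 'I_n}) k : #|s| = k.+1 ->
  \sum_(t : {set 'I_n} | (t \subset s) && (t != set0)) alpha #|t| = S1 k alpha.
Proof.
move=> sk; rewrite S1E.
have e (i : 'I_k.+1) : 'C(k.+1, i.+1)%:R * alpha i.+1 =
    \sum_(t : {set 'I_n} | (t \subset s) && (#|t| == i.+1)) alpha #|t|.
  rewrite -{1}sk -cards_draws -sum1_card natr_sum mulr_suml; apply: eq_big => t.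
    by rewrite inE.
  by rewrite inE => /andP[_ /eqP ->]; rewrite mul1r.
rewrite (eq_bigr _ (fun i _ => e i)).
rewrite (exchange_big_dep (fun t : {set 'I_n} => (t \subset s) && (t != set0))) /=.
  apply: eq_bigr => t /andP[ts t0].
  have lt : (#|t|.-1 < k.+1)%N.
    have := subset_leq_card ts; rewrite sk -card_gt0 in t0 *.
    by move: t0; case: #|t|.
  rewrite (big_pred1 (Ordinal lt)) // => i; rewrite ts /= -(inj_eq val_inj) /=.
  by move: t0; rewrite -card_gt0; case: #|t| => // m _; rewrite eqSS eq_sym.
move=> i t _ /andP[-> /eqP ti]; rewrite -card_gt0 ti //.
Qed.

Lemma verts_mem n (K : {set {set 'I_n}}) (s : {set 'I_n}) v : down K -> s \in K -> v \in s ->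
  v \in verts K.
Proof. by move=> dK sK vs; apply: (subsetP (sub_verts dK sK)). Qed.

Lemma vertsS n (K L : {set {set 'I_n}}) : K \subset L -> verts K \subset verts L.
Proof. by move=> KL; apply/subsetP=> v; rewrite !inE; apply: (subsetP KL). Qed.

Lemma verts_del n (K : {set {set 'I_n}}) v : verts (del K v) = verts K :\ v.
Proof. by apply/setP=> u; rewrite !inE andbC eq_sym. Qed.

(* Stellar subdivision of a maximal face [s], with apex [v]. *)
Definition subdivide n (K : {set {set 'I_n}}) (s : {set 'I_n}) v : {set {set 'I_n}} :=
  (K :\ s) :|: [set v |: t | t in powerset s :\ s].

Lemma down_subdivide n (K : {set {set 'I_n}}) (s : {set 'I_n}) v : down K -> s \in K -> v \notin s ->
  (forall t, t \in K -> s \subset t -> t = s) -> down (subdivide K s v).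
Proof.
move=> dK sK vs smax u t; rewrite !inE => /orP[/andP[us uK] tu|].
  rewrite (dK u) // andbT; apply/orP; left; apply: contra_neq us => ts.
  by apply: smax => //; rewrite -ts.
case/imsetP=> u'; rewrite !inE => /andP[us us'] -> tu.
have [vt|vt] := boolP (v \in t).
  apply/orP; right; apply/imsetP; exists (t :\ v); last by rewrite setD1K.
  have tu' : t :\ v \subset u'.
    by rewrite subDset.
  rewrite !inE (subset_trans tu' us') andbT.
  by apply: contra_neq us => e; apply/eqP; rewrite eqEsubset us' -e tu'.
have tu' : t \subset u'.
  apply/subsetP=> w wt; move: (subsetP tu w wt); rewrite !inE => /orP[/eqP e|//].
  by rewrite -e wt in vt.
rewrite (dK s) ?(subset_trans tu') // andbT; apply/orP; left.
by apply: contra_neq us => e; apply/eqP; rewrite eqEsubset us' -e tu'.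
Qed.

(** Losing [s] costs [alpha d]; the cone from [v] over the boundary of [s] brings all of
    [S1 d alpha] except the term of [s] itself. *)
Lemma weight_subdivide n (K : {set {set 'I_n}}) (s : {set 'I_n}) v d : #|s| = d.+1 -> (1 < #|s|)%N ->
  s \in K -> v \notin verts K -> v \notin s -> down K ->
  weight (subdivide K s v) = weight K - alpha d + (S1 d alpha - alpha d.+1).
Proof.
move=> sd s1 sK vK vs dK; rewrite /weight.
have disj : [disjoint K :\ s & [set v |: t | t in powerset s :\ s]].
  rewrite disjoint_sym; apply/pred0P=> u /=; apply/negP=> /andP[/imsetP[t _ ->]].
  rewrite inE => /andP[_ vtK]; case/negP: vK; apply: (verts_mem dK vtK).
  exact: setU11.
rewrite big_mkcondr /=.
have -> (F : {set 'I_n} -> R) : \sum_(u in subdivide K s v) F u =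
    \sum_(u in K :\ s) F u + \sum_(u in [set v |: t | t in powerset s :\ s]) F u.
  by rewrite -bigU //; apply: eq_bigl => u; rewrite in_setU.
congr (_ + _).
  rewrite -(@big_mkcondr _ _ _ _ _ (mem (K :\ s)) (fun u : {set 'I_n} => 1 < #|u|)%N) /=.
  rewrite [X in _ = X - _](bigD1 s) /=; last by rewrite sK.
  rewrite sd /= addrAC subrr add0r; apply: eq_bigl => u.
  by rewrite !inE; case: (u \in K); case: (u == s); case: (1 < _)%N.
rewrite big_imset /=; last first.
  move=> t t'; rewrite !inE => /andP[_ ts] /andP[_ ts'] e.
  have vt : v \notin t by apply: contra vs; apply: (subsetP ts).
  have vt' : v \notin t' by apply: contra vs; apply: (subsetP ts').
  by rewrite -(setU1K vt) e setU1K.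
rewrite -(sum_subsets sd) [X in _ = X - _](bigD1 s) /=; last first.
  by rewrite subxx -card_gt0 sd.
rewrite sd addrAC subrr add0r.
rewrite -(@big_mkcondr _ _ _ _ _ _ (fun t : {set 'I_n} => 1 < #|v |: t|)%N) /=.
apply: eq_big => t.
  rewrite !inE; case ts: (t \subset s); rewrite ?andbF //= andbT andbC.
  have vt : v \notin t by apply: contra vs; apply: (subsetP ts).
  by rewrite cardsU1 vt ltnS card_gt0.
rewrite !inE => /andP[/andP[_ ts] _].
have vt : v \notin t by apply: contra vs; apply: (subsetP ts).
by rewrite cardsU1 vt.
Qed.

(** The weight gained by a stellar subdivision pays for the vertex it adds. Termwise it says
    ['C(l.+1, i) + (i == d) <= 'C(d.+1, i)] for [1 <= i <= d]. *)
Lemma S1_gain l d : (0 < l)%N -> (l.*2 <= d)%N ->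
  alpha d + S1 l alpha + alpha d.+1 <= S1 d alpha.
Proof.
move=> l0 ld; have d0 : (0 < d)%N by apply: leq_trans ld; rewrite double_gt0.
rewrite (S1E d) big_ord_recr /= binn mul1r lerD2r.
have ld1 : (l.+1 <= d)%N by apply: leq_trans ld; rewrite -addnn -add1n leq_add2r.
have -> : S1 l alpha = \sum_(i < d) 'C(l.+1, i.+1)%:R * alpha i.+1.
  rewrite S1E -(big_mkord xpredT (fun i => 'C(l.+1, i.+1)%:R * alpha i.+1)).
  rewrite -(big_mkord xpredT (fun i => 'C(l.+1, i.+1)%:R * alpha i.+1)).
  rewrite [RHS](big_cat_nat (n := l.+1)) //= [X in _ = _ + X]big_nat_cond.
  rewrite [X in _ = _ + X]big1 ?addr0 // => i /andP[/andP[li _] _].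
  by rewrite bin_small ?mul0r.
have -> : alpha d = \sum_(i < d) (i.+1 == d)%:R * alpha i.+1.
  have ltd : (d.-1 < d)%N by rewrite prednK.
  rewrite (bigD1 (Ordinal ltd)) //= prednK // eqxx mul1r big1 ?addr0 // => i.
  rewrite -(inj_eq val_inj) /= => ne; case: eqP => [e|]; rewrite ?mul0r //.
  by case/eqP: ne; lia.
rewrite -big_split /=; apply: ler_sum => i _; rewrite -mulrDl.
apply: ler_wpM2r; first exact/ltW/alpha_gt0.
rewrite -natrD ler_nat; case: eqP => [e|_] /=; last first.
  rewrite add0n; apply: leq_bin2l; exact: leq_trans ld1 _.
rewrite e -[in X in (_ <= X)%N]e binSn add1n ltnS.
rewrite e; case: (ltngtP l.+1 d) ld1 => // [lt|<-] _; first by rewrite bin_small.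
by rewrite binn.
Qed.

End Weight.

Section DenseCup.
Variables (R : realType) (alpha : nat -> R).
Hypothesis alpha_gt0 : forall i, (0 < i)%N -> 0 < alpha i.
Variables (n : nat) (A : pzRingType).
Local Notation T := 'I_n.
Implicit Types (K L : {set {set T}}) (s t : {set T}) (x y : {set T} -> A).

(** On [d.+1] vertices the bound of [not_acyclic_fcount] forces every [d]-subset to be a face, and
    the full set cannot be one, as [K] would be a cone. *)
Lemma link_boundary K d s : down K -> ~ acyclic A K d -> (0 < d)%N ->
  #|verts K| = d.+1 -> s = verts K ->
  s \notin K /\ (forall t, t \proper s -> t \in K).
Proof.
move=> dK na d0 Vd sV; split.
  apply/negP => sK; apply: na.
  have /card_gt0P[w ws] : (0 < #|verts K|)%N by rewrite Vd.
  apply: (@acyclic_cone _ _ _ w) => // t tK; apply: (dK s) => //.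
  by rewrite sV subUset sub1set ws sub_verts.
have /eqP facets : [set t in K | #|t| == d] == [set t : {set T} | t \subset s & #|t| == d].
  rewrite eqEcard; apply/andP; split.
    by apply/subsetP => t; rewrite !inE sV => /andP[tK ->]; rewrite sub_verts.
  rewrite cards_draws sV Vd binSn; apply: leq_trans (not_acyclic_fcount dK na (leqnn d)).
  by rewrite binSn.
move=> t; rewrite properE => /andP[ts /subsetPn[w ws wt]].
have sd : s :\ w \in [set t : {set T} | t \subset s & #|t| == d].
  by rewrite inE subD1set -eqSS -Vd -sV (cardsD1 w s) ws add1n eqxx.
rewrite -facets inE in sd; have /andP[sK _] := sd; apply: dK sK _.
apply/subsetP => u ut; rewrite !inE (subsetP ts _ ut) andbT.
by apply: contraNneq wt => <-.
Qed.

(** Faces are counted through the links of their vertices. Edges need the extra vertex of each link,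
    since [d.+2 >= 2 * l.+1]; larger faces follow from [not_acyclic_fcount] and [bin_ineq]. *)
Lemma weight_links K l d : down K -> (0 < l)%N -> (l.*2 <= d)%N ->
  (forall v, v \in verts K -> ~ acyclic A (lk K v) d /\ (d.+1 < #|verts (lk K v)|)%N) ->
  S1 l alpha * #|verts K|%:R <= weight alpha K.
Proof.
move=> dK l0 ld lkK; apply: le_trans (weight_fcount alpha_gt0 K l.+1).
rewrite S1E mulr_suml; apply: ler_sum => i _.
rewrite mulrAC; apply: ler_wpM2r; first exact/ltW/alpha_gt0.
rewrite -natrM ler_nat -(leq_pmul2l (ltn0Sn i.+1)) -sum_fcount_lk //.
rewrite mulnA mulnC -sum_nat_const; apply: leq_sum => v vK.
have [na gt] := lkK v vK.
have [i0|i0] := posnP i.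
  rewrite i0 bin1 fcount1; apply: leq_trans gt.
  by move: ld; rewrite -addnn; lia.
have il : (i.+1 <= d)%N.
  apply: leq_trans ld; apply: (leq_trans (ltn_ord i)).
  by rewrite -addnn -addn1 leq_add2l.
apply: leq_trans (not_acyclic_fcount (down_lk dK) na il).
apply: (leq_trans (bin_ineq l0 _)); first by rewrite ltnS i0 ltn_ord.
by apply: leq_bin2l; rewrite ltnS.
Qed.

(** Induction on the number of vertices. If the link of [v] is the boundary of a simplex [s], the
    induction hypothesis is applied to [Q], where [v] is removed and [s] filled. A dense [L] in [Q]
    that does not lie in [K] contains [s], and subdividing [s] by [v] brings it back into [K]. *)
Lemma nontrivial_cup_dense l i j : (0 < l)%N -> (0 < i)%N -> (0 < j)%N ->
  (l.*2 <= i + j)%N -> forall K x y, down K ->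
  cocyc K i.+1 x -> cocyc K j.+1 y -> ~ cobdy K (i + j).+1 (cupf i x y) ->
  exists L, [/\ down L, L \subset K, (0 < #|verts L|)%N &
                S1 l alpha * #|verts L|%:R <= weight alpha L].
Proof.
move=> l0 i0 j0 ld K; move: {2}#|verts K|.+1 (ltnSn #|verts K|) => N.
elim: N K => // N IH K; rewrite ltnS => KN x y dK xK yK nK.
set d := (i + j)%N in ld nK *.
have d0 : (0 < d)%N by rewrite addn_gt0 i0.
have dK' v : down (del K v) := down_del dK.
have Klt v : v \in verts K -> (#|verts (del K v)| < N)%N.
  by move=> vK; rewrite verts_del; move: KN; rewrite (cardsD1 v) vK.
have [[v [vK nd]]|ad] :=
  pselect (exists v, v \in verts K /\ ~ cobdy (del K v) d.+1 (cupf i x y)).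
  have sD := sub_del K v.
  have [L [dL LK L0 Lw]] := IH _ (Klt v vK) x y (dK' v)
    (cocycS sD xK) (cocycS sD yK) nd.
  by exists L; split=> //; apply: subset_trans sD.
have lkK v : v \in verts K -> ~ acyclic A (lk K v) d.
  move=> vK al; apply: nK; apply: (cobdy_del dK al); first exact: cocyc_cupf.
  by apply: contrapT => nd; apply: ad; exists v.
have V0 : (0 < #|verts K|)%N.
  rewrite lt0n; apply/eqP => V0; apply: nK; exists (fun=> 0) => s sK sd.
  have := subset_leq_card (sub_verts dK sK).
  by rewrite V0 sd.
have lkV v : v \in verts K -> (d < #|verts (lk K v)|)%N.
  move=> vK; rewrite -fcount1 -[d.+1]bin1.
  by apply: not_acyclic_fcount d0; [apply: down_lk|apply: lkK].
have [[v [vK dv]]|big] :=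
  pselect (exists v, v \in verts K /\ #|verts (lk K v)| = d.+1); last first.
  exists K; split=> //; apply: (weight_links dK l0 ld) => v vK; split; first exact: lkK.
  rewrite ltn_neqAle lkV // andbT; apply/eqP => e.
  by apply: big; exists v; rewrite e.
pose s := verts (lk K v).
have [slk bd] := link_boundary (down_lk dK) (lkK v vK) d0 dv (erefl s).
have vs : v \notin s by rewrite !inE eqxx andbF.
have ds : #|s| = d.+1 by [].
have s1 : (1 < #|s|)%N by rewrite ds ltnS.
have bdK t : t \proper s -> v |: t \in K.
  by move/bd; rewrite lkE // => /andP[].
have sE : s = verts (lk K v) by [].
clearbody s.
(* Filling the simplices [s] and [v |: s] changes neither the cocycle conditions
   nor the product, and afterwards the link of [v] is a full simplex. *)
pose P := K :|: [set s; v |: s].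
have PE t : (t \in P) = (t \in K) || (t \subset v |: s) && ((t == s) || (t == v |: s)).
  rewrite !inE; case: (t \in K) => //=.
  by case: eqVneq => [->|_]; rewrite ?subsetUr //=; case: eqVneq => [->|_]; rewrite ?subxx ?andbF.
have inP t : t \subset v |: s -> t \in P.
  move=> tvs; rewrite PE tvs /=; have [vt|vt] := boolP (v \in t).
    have [ts|ts] := boolP (t :\ v \proper s).
      by rewrite -(setD1K vt) bdK.
    have : t :\ v \subset s by rewrite subDset.
    rewrite subEproper (negPf ts) orbF => /eqP e.
    by rewrite -e setD1K // eqxx !orbT.
  have : t \subset s.
    apply/subsetP => w wt; move: (subsetP tvs w wt); rewrite !inE => /orP[/eqP e|//].
    by rewrite -e wt in vt.
  rewrite subEproper => /orP[/eqP ->|ts]; first by rewrite eqxx orbT.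
  by rewrite (dK (v |: t)) ?bdK ?subsetUr.
have dP : down P.
  move=> t u tP ut; move: tP; rewrite PE => /orP[tK|/andP[tvs _]].
    by rewrite PE (dK t).
  by apply: inP; apply: subset_trans tvs.
have KP : K \subset P by apply: subsetUl.
(* On [s] the condition follows from [dlt (dlt z) = 0] on [v |: s], whose other facets are in [K].
   The face [v |: s] has [d.+2] vertices, too many to be tested when [k < d]. *)
have dltS z k : (0 < k)%N -> (k < d)%N -> cocyc K k.+1 z -> cocyc P k.+1 z.
  move=> k0 kd zK t; rewrite PE => /orP[/zK//|/andP[_ /orP[]/eqP -> tk]].
    have := slice_dlt (dlt z) vs; rewrite {1}/slice dlt_dlt mulr0.
    rewrite [X in _ - X]dlt_eq0 ?subr0 // => u us; apply/eqP.
    rewrite slice_eq0 zK ?bdK ?properD1 //.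
    have vu : v \notin s :\ u by rewrite !inE (negPf vs) andbF.
    by rewrite cardsU1 vu -tk (cardsD1 u s) us.
  move: tk; rewrite cardsU1 vs ds !add1n => -[dk].
  by rewrite dk ltnn in kd.
have xP : cocyc P i.+1 x by apply: dltS => //; rewrite /d -[X in (X < _)%N]addn0 ltn_add2l.
have yP : cocyc P j.+1 y by apply: dltS => //; rewrite /d -[X in (X < _)%N]add0n ltn_add2r.
have nP : ~ cobdy P d.+1 (cupf i x y) by move/(cobdyS KP).
pose Q := del P v.
have dQ : down Q := down_del dP.
have nQ : ~ cobdy Q d.+1 (cupf i x y).
  move=> cQ; apply: nP; apply: cobdy_del cQ => //; last exact: cocyc_cupf.
  have /card_gt0P[w ws] : (0 < #|s|)%N by rewrite ds.
  apply: (@acyclic_cone _ _ _ w); first exact: down_lk.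
  move=> t; rewrite !lkE // => /andP[vt vtP].
  have ts : t \subset s.
    move: vtP; rewrite PE => /orP[vtK|/andP[vts _]].
      by rewrite sE; apply: sub_verts; [apply: down_lk|rewrite lkE // vt].
    apply/subsetP => u ut; have := subsetP vts u (setU1r _ ut); rewrite !inE.
    by case/orP => // /eqP uv; rewrite -uv ut in vt.
  have wv : v != w by apply: contraNneq vs => ->.
  rewrite in_setU1 negb_or wv vt /=; apply: inP.
  by apply: setUS; rewrite subUset sub1set ws.
have QV : verts Q \subset verts K :\ v.
  rewrite verts_del; apply/subsetP => u; rewrite !in_setD1 => /andP[->].
  rewrite !inE => /orP[//|/orP[]/eqP e].
    by move: s1; rewrite -e cards1.
  by have := cardsU1 v s; rewrite -e cards1 vs ds.
have QN : (#|verts Q| < N)%N.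
  apply: leq_trans (Klt v vK); rewrite ltnS verts_del; exact: subset_leq_card.
have QP := sub_del P v.
have [L [dL LQ L0 Lw]] := IH _ QN x y dQ (cocycS QP xP) (cocycS QP yP) nQ.
have LK t : t \in L -> t != s -> t \in K.
  move=> tL ts; move: (subsetP LQ t tL); rewrite inE PE (negPf ts) /= => /andP[].
  by case/orP=> // /andP[_ /eqP ->]; rewrite setU11.
have [sL|sL] := boolP (s \in L); last first.
  exists L; split=> //; apply/subsetP => t tL; apply: LK => //.
  by apply: contraNneq sL => <-.
have [sK|sK] := boolP (s \in K).
  exists L; split=> //; apply/subsetP => t tL.
  by have [->//|ts] := eqVneq t s; apply: LK.
have vL : v \notin verts L.
  by apply/negP => /(subsetP (vertsS LQ)); rewrite verts_del !inE eqxx.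
have smax t : t \in L -> s \subset t -> t = s.
  move=> tL st; apply: contraNeq sK => ts; apply: dK st; exact: LK.
exists (subdivide L s v); split.
- exact: down_subdivide.
- apply/subsetP => t; rewrite !inE => /orP[/andP[ts tL]|]; first exact: LK.
  case/imsetP => u; rewrite !inE => /andP[us us'] ->; apply: bdK.
  by rewrite properEneq us.
- rewrite card_gt0; apply/set0Pn; case/card_gt0P: L0 => u uL; exists u.
  move: uL; rewrite !inE => ->; rewrite andbT.
  by apply/orP; left; apply/eqP => e; move: s1; rewrite -e cards1.
have le : (#|verts (subdivide L s v)| <= #|verts L|.+1)%N.
  have -> : #|verts L|.+1 = #|v |: verts L| by rewrite cardsU1 vL.
  apply: subset_leq_card; apply/subsetP => u; rewrite !inE.
  case/orP=> [/andP[_ ->]|/imsetP[t _ e]]; first by rewrite orbT.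
  have : v \in [set u] by rewrite e setU11.
  by rewrite inE eq_sym => ->.
rewrite (@weight_subdivide _ _ _ _ _ _ d) //.
apply: (@le_trans _ _ (S1 l alpha * #|verts L|.+1%:R)).
  by rewrite ler_wpM2l ?ler_nat // S1_ge0.
have gain := S1_gain alpha_gt0 l0 ld; rewrite -addn1 natrD mulrDr mulr1.
by lra.
Qed.

End DenseCup.

(** * Components of the faces of dimension at least [l], and their growth *)

Section Components.
Variables (n : nat) (K : {set {set 'I_n}}) (l : nat).
Hypothesis dK : down K.
Local Notation T := 'I_n.
Implicit Types (s t r : {set T}).

Definition incident : rel {set T} := [rel s t |
  [&& s \in K, t \in K, (l < #|s|)%N, (l < #|t|)%N & (s \subset t) || (t \subset s)]].

Lemma incident_sym : symmetric incident.
Proof.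
move=> s t; rewrite /incident /= orbC; case: (s \in K); case: (t \in K) => //=.
by rewrite andbCA.
Qed.

Lemma connect_incident_sym : connect_sym incident.
Proof. exact: sym_connect_sym incident_sym. Qed.

Lemma connect_incident r t : r \in K -> (l < #|r|)%N -> connect incident r t ->
  t \in K /\ (l < #|t|)%N.
Proof.
move=> rK lr /connectP[p]; elim: p r rK lr => [|u p IH] r rK lr /=.
  by move=> _ ->.
by case/andP=> /and5P[_ uK _ lu _] pp e; apply: (IH u).
Qed.

Definition component r : {set {set T}} :=
  [set s : {set T} | [exists t : {set T}, connect incident r t && (s \subset t)]].

Lemma down_component r : down (component r).
Proof.
move=> s t; rewrite !inE => /existsP[u /andP[cu su]] ts.
by apply/existsP; exists u; rewrite cu (subset_trans ts).
Qed.

Lemma sub_component r : r \in K -> (l < #|r|)%N -> component r \subset K.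
Proof.
move=> rK lr; apply/subsetP => s; rewrite inE => /existsP[u /andP[cu su]].
by have [uK _] := connect_incident rK lr cu; apply: dK su.
Qed.

(** The facets of a face with [m.+1] vertices have more than [l] vertices, hence stay in its
    component. So primitives chosen separately on the components glue: each facet is evaluated with
    the primitive of its own component. *)
Lemma cobdy_components (A : pzRingType) m (c : {set T} -> A) : (l < m)%N ->
  (forall r, r \in K -> (l < #|r|)%N -> cobdy (component r) m.+1 c) ->
  cobdy K m.+1 c.
Proof.
move=> lm cr; have /choice[h hE] : forall r, exists h : {set T} -> A,
    r \in K -> (l < #|r|)%N -> forall s, s \in component r -> #|s| = m.+1 ->
    c s = dlt h s.
  move=> r; case: (pselect (r \in K /\ (l < #|r|)%N)) => [[rK lr]|no].
    by have [h hE] := cr r rK lr; exists h => _ _; apply: hE.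
  by exists (fun=> 0) => rK lr; case: no.
exists (fun t => h (fingraph.root incident t) t) => s sK sm.
have ls : (l < #|s|)%N by rewrite sm ltnW.
have sr := connect_root incident s.
have [rK lr] := connect_incident sK ls sr.
rewrite (hE _ rK lr) // ?inE.
  apply: eq_dlt => v vs; congr (h _ _).
  apply/eqP; rewrite root_connect; last exact: connect_incident_sym.
  have cv : #|s :\ v| = m by apply/eqP; rewrite -eqSS -sm (cardsD1 v s) vs.
  apply: connect1; rewrite /incident /= sK ls cv lm subD1set orbT !andbT.
  by rewrite (dK sK) ?subD1set.
apply/existsP; exists s; rewrite subxx andbT.
by rewrite connect_incident_sym.
Qed.

End Components.

Section Growth.
Variables (R : realType) (alpha : nat -> R).
Hypothesis alpha_gt0 : forall i, (0 < i)%N -> 0 < alpha i.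
Variables (n : nat) (K : {set {set 'I_n}}) (l : nat).
Hypothesis dK : down K.
Local Notation T := 'I_n.
Implicit Types (s t r W : {set T}).

Definition induced W : {set {set T}} := [set s in K | s \subset W].

Lemma weight_induced_setU1 W (u : T) s : s \subset W -> u \notin W ->
  u |: s \in K -> #|s| = l.+1 ->
  weight alpha (induced W) + S1 l alpha <= weight alpha (induced (u |: W)).
Proof.
move=> sW uW usK sl; rewrite /weight [leRHS](bigID (fun t => u \notin t)) /=.
apply: lerD.
  rewrite le_eqVlt; apply/orP; left; apply/eqP; apply: eq_bigl => t.
  rewrite !inE; case: (t \in K) => //=; apply/idP/idP.
    move=> /andP[tW ->]; rewrite (subset_trans tW) ?subsetUr //=.
    by apply: contra uW; apply: (subsetP tW).
  move=> /andP[/andP[tuW ->] ut]; rewrite andbT.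
  apply/subsetP => w wt; move: (subsetP tuW w wt); rewrite !inE => /orP[/eqP e|//].
  by rewrite -e wt in ut.
rewrite -(sum_subsets alpha sl).
have us : u \notin s by apply: contra uW; apply: (subsetP sW).
pose P (t : {set T}) := (t \subset s) && (t != set0).
have nu t : P t -> u \notin t.
  by case/andP=> ts _; apply: contra us; apply: (subsetP ts).
have inj : {in P &, injective (fun t => u |: t)}.
  by move=> t t' Pt Pt' e; rewrite -(setU1K (nu _ Pt)) e setU1K // nu.
have -> : \sum_(t : {set T} | (t \subset s) && (t != set0)) alpha #|t|
    = \sum_(t in [set u |: t | t in P]) alpha #|t|.-1.
  by rewrite big_imset //; apply: eq_bigr => t Pt; rewrite cardsU1 nu.
rewrite big_mkcond [leRHS]big_mkcond; apply: ler_sum => t _.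
case: imsetP => [[t' /andP[t's t'0] ->]|_]; last first.
  case: ifP => // /andP[/andP[_ t1] _]; apply/ltW/alpha_gt0.
  by rewrite -ltnS prednK // ltnW.
have -> : u |: t' \in induced (u |: W).
  by rewrite inE (dK usK) ?setUS // (subset_trans t's).
by rewrite cardsU1 nu /P ?t's // ltnS card_gt0 t'0 negbK setU11.
Qed.

(** [W] starts as [l.+1] vertices of [r]. While the component sticks out of [W], connectivity gives
    incident faces [x], inside [W], and [y], not inside; then [x] lies in [y], and a vertex of [y]
    outside [W], joined to [l.+1] vertices of [x], adds [S1 l alpha]. The auxiliary claim keeps a
    face of the component inside [W] so that this applies again. *)
Lemma component_grow r m : r \in K -> (l < #|r|)%N ->
  (l < m <= #|verts (component K l r)|)%N ->
  exists W, #|W| = m /\ (m - l.+1)%:R * S1 l alpha <= weight alpha (induced W).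
Proof.
move=> rK lr; set C := component K l r.
suff H : (l < m <= #|verts C|)%N -> exists W, [/\ #|W| = m,
    (m - l.+1)%:R * S1 l alpha <= weight alpha (induced W) &
    exists2 t, connect (incident K l) r t & t \subset W].
  by case/H => W [Wm Ww _]; exists W.
elim: m => // m IH /andP[]; rewrite ltnS leq_eqVlt => /orP[/eqP <-|lm] mV.
  have [W] : exists W : {set T}, W \in [set W : {set T} | W \subset r & #|W| == l.+1].
    by apply/card_gt0P; rewrite cards_draws bin_gt0.
  rewrite inE => /andP[Wr /eqP Wl]; exists W; split=> //.
    rewrite subnn mul0r sumr_ge0 // => s /andP[_ s1]; apply/ltW/alpha_gt0.
    by rewrite -ltnS prednK // ltnW.
  exists W => //; apply: connect1; rewrite /incident /= rK lr Wl ltnSn Wr orbT.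
  by rewrite (dK rK).
have [|W [Wm Ww [t rt tW]]] := IH; first by rewrite lm ltnW.
have [x [y [xy xW yW]]] : exists x y : {set T},
    [/\ incident K l x y, x \subset W & ~~ (y \subset W)].
  apply: contrapT => no.
  have cl : fingraph.closed (incident K l) [pred x : {set T} | x \subset W].
    apply: intro_closed => [|x y xy xW]; first exact: connect_incident_sym.
    by apply: contrapT => /negP yW; apply: no; exists x, y.
  have : ~~ (verts C \subset W).
    by apply/negP => /subset_leq_card; rewrite Wm leqNgt mV.
  case/subsetPn => v; rewrite inE inE => /existsP[u /andP[ru vu]] /negP; apply.
  have := closed_connect cl ru; rewrite (closed_connect cl rt) !inE tW => /esym uW.
  by rewrite -sub1set (subset_trans vu).
case/and5P: xy => xK yK lx ly /orP[] xy; last by rewrite (subset_trans xy xW) in yW.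
case/subsetPn: yW => u uy uW.
have [s] : exists s : {set T}, s \in [set s : {set T} | s \subset x & #|s| == l.+1].
  by apply/card_gt0P; rewrite cards_draws bin_gt0.
rewrite inE => /andP[sx /eqP sl]; exists (u |: W); split.
- by rewrite cardsU1 uW Wm.
- have usK : u |: s \in K.
    by apply: (dK yK); rewrite subUset sub1set uy (subset_trans sx).
  apply: le_trans (weight_induced_setU1 (subset_trans sx xW) uW usK sl).
  by rewrite subSn // -addn1 natrD mulrDl mul1r lerD2r.
- by exists t => //; rewrite (subset_trans tW) // subsetUr.
Qed.

End Growth.

Section SparseCup.
Variables (R : realType) (alpha : nat -> R).
Hypothesis alpha_gt0 : forall i, (0 < i)%N -> 0 < alpha i.
Variables (n : nat) (K : {set {set 'I_n}}) (l N : nat) (S' : R).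
Hypothesis dK : down K.
Hypotheses (S'S : S' <= S1 l alpha) (l0 : (0 < l)%N).
Hypothesis lN : (l < N)%N.
Hypothesis N_large : S' * N%:R <= (N - l.+1)%:R * S1 l alpha.

Definition sparse := forall W : {set 'I_n}, (0 < #|W| <= N)%N ->
  weight alpha (induced K W) < S' * #|W|%:R.

(** A component with [N] or more vertices contains a set of exactly [N] vertices which [N_large]
    makes too dense; in a smaller one, the dense subcomplex of [nontrivial_cup_dense] violates
    sparsity. *)
Lemma sparse_cup (A : pzRingType) i j (x y : {set 'I_n} -> A) : sparse ->
  (0 < i)%N -> (0 < j)%N -> (l.*2 <= i + j)%N ->
  cocyc K i.+1 x -> cocyc K j.+1 y -> cobdy K (i + j).+1 (cupf i x y).
Proof.
move=> sp i0 j0 ld xK yK; apply: (@cobdy_components _ _ l) => //.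
  by apply: leq_trans ld; rewrite -addnn -add1n leq_add2r.
move=> r rK lr; apply: contrapT => nc.
have sC := sub_component dK rK lr.
have [L [dL LC L0 Lw]] := nontrivial_cup_dense alpha_gt0 l0 i0 j0 ld
  (@down_component _ K l r) (cocycS sC xK) (cocycS sC yK) nc.
have VN : (#|verts (component K l r)| < N)%N.
  rewrite ltnNge; apply/negP => NV.
  have [|W [WN Ww]] := component_grow alpha_gt0 dK rK lr (m := N); first by rewrite lN.
  have : weight alpha (induced K W) < S' * #|W|%:R.
    by apply: sp; rewrite WN leqnn andbT (leq_ltn_trans _ lN).
  by rewrite WN ltNge (le_trans N_large).
have : weight alpha (induced K (verts L)) < S' * #|verts L|%:R.
  apply: sp; rewrite L0 /= ltnW // (leq_ltn_trans _ VN) //.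
  exact/subset_leq_card/vertsS.
rewrite ltNge => /negP; apply.
apply: (@le_trans _ _ (S1 l alpha * #|verts L|%:R)); first by rewrite ler_wpM2r.
apply: (le_trans Lw); apply: weightS => //; apply/subsetP => s sL.
by rewrite inE (subsetP sC) ?(subsetP LC) // sub_verts.
Qed.

End SparseCup.

(** * Independent hyperedges *)

Section Bernoulli.
Variables (R : realType) (I : finType) (P : I -> R).
Hypothesis P01 : forall i, 0 <= P i <= 1.
Implicit Types (H G D : {set I}) (F : {set I} -> R).

Definition bern H : R := \prod_i (if i \in H then P i else 1 - P i).

Definition Ex F : R := \sum_(H : {set I}) bern H * F H.

Lemma bern_ge0 H : 0 <= bern H.
Proof.
by apply: prodr_ge0 => i _; have /andP[] := P01 i; case: ifP => // _; rewrite subr_ge0.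
Qed.

Lemma sum_bern : \sum_(H : {set I}) bern H = 1.
Proof.
rewrite -(bigA_distr _ _ P (fun i => 1 - P i)) big1 // => i _.
by rewrite /= addrC subrK.
Qed.

Lemma ExD F1 F2 : Ex (fun H => F1 H + F2 H) = Ex F1 + Ex F2.
Proof. by rewrite /Ex -big_split; apply: eq_bigr => H _; rewrite mulrDr. Qed.

Lemma ExZ a F : Ex (fun H => a * F H) = a * Ex F.
Proof. by rewrite /Ex mulr_sumr; apply: eq_bigr => H _; rewrite mulrCA. Qed.

Lemma Ex_cst a : Ex (fun=> a) = a.
Proof. by rewrite /Ex -mulr_suml sum_bern mul1r. Qed.

Lemma eq_Ex F1 F2 : (forall H, F1 H = F2 H) -> Ex F1 = Ex F2.
Proof. by move=> e; apply: eq_bigr => H _; rewrite e. Qed.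

Lemma Ex_sum (J : Type) (r : seq J) (Q : pred J) (F : J -> {set I} -> R) :
  Ex (fun H => \sum_(j <- r | Q j) F j H) = \sum_(j <- r | Q j) Ex (F j).
Proof. by rewrite /Ex exchange_big; apply: eq_bigr => H _; rewrite mulr_sumr. Qed.

Lemma le_Ex F1 F2 : (forall H, F1 H <= F2 H) -> Ex F1 <= Ex F2.
Proof. by move=> le; apply: ler_sum => H _; rewrite ler_wpM2l ?bern_ge0. Qed.

Lemma Ex_ge0 F : (forall H, 0 <= F H) -> 0 <= Ex F.
Proof. by move=> F0; apply: sumr_ge0 => H _; rewrite mulr_ge0 ?bern_ge0. Qed.

Definition dep F G := forall H, F H = F (H :&: G).

Lemma depS F G G' : G \subset G' -> dep F G -> dep F G'.
Proof.
move=> GG' dF H; rewrite dF [RHS]dF; congr F.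
by rewrite -setIA; congr (_ :&: _); apply/esym/setIidPr.
Qed.

(* Exchanging the parts of two independent copies outside [G] preserves their
   joint law. *)
Lemma Ex_indep F1 F2 G1 G2 : dep F1 G1 -> dep F2 G2 -> [disjoint G1 & G2] ->
  Ex (fun H => F1 H * F2 H) = Ex F1 * Ex F2.
Proof.
move=> d1 d2 dis.
pose sw (u : {set I} * {set I}) := ((u.1 :&: G1) :|: (u.2 :\: G1), (u.2 :&: G1) :|: (u.1 :\: G1)).
have swK : involutive sw.
  move=> [J K]; congr pair; apply/setP => i; rewrite !inE /=;
  by case: (i \in G1); rewrite ?andbF ?andbT ?orbF.
have -> : Ex F1 * Ex F2 = \sum_u bern u.1 * bern u.2 * (F1 u.1 * F2 u.2).
  rewrite -(pair_bigA _ (fun J K => bern J * bern K * (F1 J * F2 K))) /=.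
  rewrite /Ex mulr_suml; apply: eq_bigr => J _; rewrite mulr_sumr.
  by apply: eq_bigr => K _; rewrite mulrACA.
rewrite (reindex_inj (inv_inj swK)) /=.
transitivity (\sum_(u : {set I} * {set I}) bern u.1 * bern u.2 * (F1 u.1 * F2 u.1)).
  rewrite -(pair_bigA _ (fun J K => bern J * bern K * (F1 J * F2 J))) /=.
  apply: eq_bigr => J _; rewrite -mulr_suml -mulr_sumr sum_bern mulr1 //.
apply: eq_bigr => [[J K] _] /=; congr (_ * (_ * _)).
- rewrite /bern -!big_split; apply: eq_bigr => i _ /=; rewrite !inE.
  by case: (i \in G1); rewrite ?andbF ?andbT ?orbF //= mulrC.
- rewrite d1 [RHS]d1; congr F1; apply/setP => i; rewrite !inE.
  by case: (i \in G1); rewrite ?andbF ?andbT ?orbF.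
rewrite d2 [RHS]d2; congr F2; apply/setP => i; rewrite !inE.
case i1: (i \in G1); rewrite ?andbF ?andbT ?orbF //=.
by rewrite (disjointFr dis i1) !andbF.
Qed.

Lemma dep_prod (J : eqType) (s : seq J) (F : J -> {set I} -> R) G :
  (forall j, j \in s -> dep (F j) G) -> dep (fun H => \prod_(j <- s) F j H) G.
Proof. by move=> dF H; apply: eq_big_seq => j js; apply: dF. Qed.

Lemma Ex_prod (J : eqType) (s : seq J) (F : J -> {set I} -> R) (G : J -> {set I}) :
  uniq s -> (forall j, j \in s -> dep (F j) (G j)) ->
  (forall j k, j \in s -> k \in s -> j != k -> [disjoint G j & G k]) ->
  Ex (fun H => \prod_(j <- s) F j H) = \prod_(j <- s) Ex (F j).
Proof.
elim: s => [|j s IH] /=.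
  by rewrite big_nil -[RHS]Ex_cst => *; apply: eq_Ex => H; rewrite big_nil.
case/andP=> js us dF dis; rewrite big_cons.
rewrite -IH //; last 2 first.
- by move=> k ks; apply: dF; rewrite inE ks orbT.
- by move=> k k' ks ks'; apply: dis; rewrite inE ?ks ?ks' orbT.
rewrite -(@Ex_indep _ _ (G j) (~: G j)).
- by apply: eq_Ex => H; rewrite big_cons.
- by apply: dF; rewrite inE eqxx.
- apply: dep_prod => k ks; apply: depS (dF _ _); last by rewrite inE ks orbT.
  rewrite -disjoints_subset disjoint_sym; apply: dis; rewrite ?inE ?eqxx ?ks ?orbT //.
  by apply: contraNneq js => ->.
- by rewrite disjoints_subset setCK.
Qed.

Lemma dep_mem i : dep (fun H => (i \in H)%:R) [set i].
Proof. by move=> H; rewrite !inE eqxx andbT. Qed.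

Lemma Ex_mem i : Ex (fun H => (i \in H)%:R) = P i.
Proof.
pose g (j : I) (b : bool) := if j == i then (b : nat)%:R else 1 : R.
transitivity (\sum_(H : {set I}) \prod_j
    (if j \in H then P j * g j true else (1 - P j) * g j false)).
  apply: eq_bigr => H _; rewrite /bern.
  have -> : (i \in H)%:R = \prod_j g j (j \in H).
    by rewrite (bigD1 i) //= big1 /g ?eqxx ?mulr1 // => j /negPf ->.
  by rewrite -big_split; apply: eq_bigr => j _; case: (j \in H).
rewrite -(bigA_distr _ _ (fun j => P j * g j true) (fun j => (1 - P j) * g j false)).
rewrite (bigD1 i) //= big1 /g ?eqxx ?mulr1 ?mulr0 ?addr0 // => j /negPf ->.
by rewrite !mulr1 addrC subrK.
Qed.

Lemma subset_prod D H : (D \subset H)%:R = \prod_(i <- enum D) (i \in H)%:R :> R.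
Proof.
have [DH|DH] := boolP (D \subset H).
  rewrite big_seq big1 // => i; rewrite mem_enum => iD.
  by rewrite (subsetP DH).
case/subsetPn: DH => i iD iH; rewrite (big_rem i) ?mem_enum //=.
by rewrite (negPf iH) mul0r.
Qed.

Lemma Ex_subset D : Ex (fun H => (D \subset H)%:R) = \prod_(i in D) P i.
Proof.
rewrite (eq_Ex (subset_prod D)) (@Ex_prod _ _ _ (fun i => [set i])) ?enum_uniq //.
- by rewrite -big_enum; apply: eq_bigr => i _; rewrite Ex_mem.
- by move=> i _; apply: dep_mem.
- by move=> i j _ _ ij; rewrite disjoints1 inE.
Qed.

Lemma dep_subset D : dep (fun H => (D \subset H)%:R) D.
Proof. by move=> H; rewrite subsetI subxx andbT. Qed.

Definition prob (E : {set I} -> Prop) : R := Ex (fun H => `[< E H >]%:R).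

Lemma prob_ge0 E : 0 <= prob E.
Proof. by apply: Ex_ge0 => H; rewrite ler0n. Qed.

Lemma probC E : prob (fun H => ~ E H) = 1 - prob E.
Proof.
apply/eqP; rewrite eq_sym subr_eq -[X in X == _]Ex_cst -ExD; apply/eqP/eq_Ex => H.
by rewrite asbool_neg; case: asboolP => _; rewrite ?addr0 ?add0r.
Qed.

Lemma le_prob E1 E2 : (forall H, E1 H -> E2 H) -> prob E1 <= prob E2.
Proof.
move=> sub; apply: le_Ex => H; rewrite ler_nat.
by case: asboolP => // /sub e; case: asboolP.
Qed.

Lemma prob_markov E F : (forall H, 0 <= F H) -> (forall H, E H -> 1 <= F H) ->
  prob E <= Ex F.
Proof. by move=> F0 EF; apply: le_Ex => H; case: asboolP => [/EF|_]; rewrite ?F0. Qed.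

Lemma prob_bigcup (J : finType) (Q : pred J) (E : J -> {set I} -> Prop)
    (E' : {set I} -> Prop) :
  (forall H, E' H -> exists2 j, Q j & E j H) ->
  prob E' <= \sum_(j | Q j) prob (E j).
Proof.
move=> sub; rewrite -Ex_sum; apply: prob_markov => [H|H /sub[j Qj Ej]].
  by apply: sumr_ge0 => j _; rewrite ler0n.
by rewrite (bigD1 j) //= (asboolT Ej) lerDl sumr_ge0 // => ? _; exact: ler0n.
Qed.

Lemma probU E1 E2 : prob (fun H => E1 H \/ E2 H) <= prob E1 + prob E2.
Proof.
rewrite -ExD; apply: prob_markov => [H|H []/asboolT ->]; last 2 first.
- by rewrite lerDl ler0n.
- by rewrite lerDr ler0n.
by rewrite addr_ge0 ?ler0n.
Qed.

End Bernoulli.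

(** * Negligible events of the random hypergraph *)

Section Asymptotics.
Local Open Scope classical_set_scope.
Variables (R : realType) (alpha : nat -> R).
Hypothesis alpha_gt0 : forall i, (0 < i)%N -> 0 < alpha i.

(** Sets with fewer than two vertices get probability 0, so that hypergraphs containing them carry
    no mass, in agreement with the restricted sum in [lower_prob]. *)
Definition edge_prob n (t : {set 'I_n}) : R :=
  if (1 < #|t|)%N then n%:R `^ (- alpha #|t|.-1) else 0.

Lemma nat_powR_le1 n (a : R) : 0 < a -> n%:R `^ (- a) <= 1.
Proof.
move=> a0; case: n => [|n]; first by rewrite powR0 ?ler01 // oppr_eq0 gt_eqF.
rewrite -[leRHS](powRr0 n.+1%:R) ler_powR ?ler1n //.
by rewrite oppr_le0 ltW.
Qed.

Lemma edge_prob01 n (t : {set 'I_n}) : 0 <= edge_prob t <= 1.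
Proof.
rewrite /edge_prob; case: ifP => t1; last by rewrite lexx ler01.
rewrite powR_ge0 nat_powR_le1 // alpha_gt0 //.
by rewrite -ltnS prednK // ltnW.
Qed.

Local Notation prb n E := (prob (@edge_prob n) E).

Lemma lower_probE n (Q : scomplex n -> Prop) :
  lower_prob (fun i => n%:R `^ (- alpha i)) Q = prb n (fun H => Q (lower_complex H)).
Proof.
rewrite /lower_prob /prob /Ex [RHS](bigID (fun H : {set {set 'I_n}} => [forall t in H, 1 < #|t|]%N)) /=.
rewrite [X in _ = _ + X]big1 ?addr0; last first.
  move=> H /forallPn[t]; rewrite negb_imply -leqNgt => /andP[tH t1].
  by rewrite /bern (bigD1 t) //= tH /edge_prob ltnNge t1 /= !mul0r.
rewrite [LHS]big_mkcondr /=; apply: eq_bigr => H /forallP H1.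
case: asboolP => _; rewrite ?mulr0 // mulr1 /hypergraph_prob /bern big_mkcond.
apply: eq_bigr => t _; rewrite /edge_prob; case: ifP => // t1.
by case: ifP => [tH|]; [have := implyP (H1 t) tH; rewrite t1|rewrite subr0].
Qed.

Definition negl (E : forall n, {set {set 'I_n}} -> Prop) :=
  (fun n => prb n (E n)) @ \oo --> (0 : R).

Lemma negl_bound (E : forall n, {set {set 'I_n}} -> Prop) (u : nat -> R) :
  u @ \oo --> (0 : R) -> (\forall n \near \oo, prb n (E n) <= u n) -> negl E.
Proof.
move=> u0 le; apply: (@squeeze_cvgr _ _ _ _ (fun=> 0) u) => //; last exact: cvg_cst.
by near=> n; rewrite prob_ge0 /=; [near: n|exact: edge_prob01].
Unshelve. all: by end_near.
Qed.

Lemma negl_sub (E1 E2 : forall n, {set {set 'I_n}} -> Prop) :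
  (\forall n \near \oo, forall H, E1 n H -> E2 n H) -> negl E2 -> negl E1.
Proof.
move=> sub n2; apply: (negl_bound n2); near=> n.
by apply: le_prob; [exact: edge_prob01|near: n].
Unshelve. all: by end_near.
Qed.

Lemma neglU (E1 E2 : forall n, {set {set 'I_n}} -> Prop) :
  negl E1 -> negl E2 -> negl (fun n H => E1 n H \/ E2 n H).
Proof.
move=> n1 n2; apply: (@negl_bound _ (fun n => prb n (E1 n) + prb n (E2 n))).
  by rewrite -[0]addr0; apply: cvgD.
by apply: nearW => n; apply: probU; apply: edge_prob01.
Qed.

Lemma negl_bigcup m (E : nat -> forall n, {set {set 'I_n}} -> Prop) :
  (forall i, (i < m)%N -> negl (E i)) ->
  negl (fun n H => exists2 i, (i < m)%N & E i n H).
Proof.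
elim: m => [|m IH] nE.
  apply: (@negl_bound _ (fun=> 0)); first exact: cvg_cst.
  apply: nearW => n; rewrite -[leRHS](Ex_cst (@edge_prob n) 0); apply: le_Ex => [|H].
    exact: edge_prob01.
  by case: asboolP => // -[].
have := neglU (IH (fun i im => nE i (ltnW im))) (nE m (ltnSn m)).
apply: negl_sub; apply: nearW => n H [i]; rewrite ltnS leq_eqVlt => /orP[/eqP ->|lt]; first by right.
by left; exists i.
Qed.

Lemma aas_of_negl (Q : forall n, scomplex n -> Prop) :
  negl (fun n H => ~ Q n (lower_complex H)) -> aas_lower alpha Q.
Proof.
move=> nQ; rewrite /aas_lower; under eq_fun do rewrite lower_probE.
have -> : (fun n => prb n (fun H => Q n (lower_complex H))) =
          (fun n => 1 - prb n (fun H => ~ Q n (lower_complex H))).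
  by apply/funext => n; rewrite probC subKr.
suff : (fun n => 1 - prb n (fun H => ~ Q n (lower_complex H))) @ \oo --> (1 - 0 : R).
  by rewrite subr0.
by apply: cvgB => //; exact: cvg_cst.
Qed.

End Asymptotics.

Section PowerDecay.
Local Open Scope classical_set_scope.

Lemma cvg_nat_powR (R : realType) (C e : R) : 0 < e ->
  (fun n : nat => C * n%:R `^ (- e)) @ \oo --> (0 : R).
Proof.
move=> e0; rewrite -(mulr0 C); apply: cvgM; first exact: cvg_cst.
apply/cvgrPdist_le => d d0.
near=> n.
have n0 : (0 < n)%N by near: n; exact: nbhs_infty_gt.
rewrite sub0r normrN ger0_norm ?powR_ge0 // powRN.
rewrite -[leRHS]invrK lef_pV2 ?posrE ?powR_gt0 ?invr_gt0 ?ltr0n //.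
have -> : d^-1 = (d^-1 `^ e^-1) `^ e.
  by rewrite -powRrM mulVf ?gt_eqF // powRr1 // ltW // invr_gt0.
apply: ge0_ler_powR; rewrite ?nnegrE ?powR_ge0 ?ler0n // ?ltW //.
by near: n; exact: nbhs_infty_gtr.
Unshelve. all: by end_near.
Qed.
End PowerDecay.

(** * Sparsity of the random complex *)

Section Translate.
Variables (n : nat) (X : scomplex n) (A : pzRingType).

(** Adding the empty face passes to reduced cohomology; positive degrees are unaffected, and links
    can be taken down to the lowest degree. *)
Definition with_empty : {set {set 'I_n}} := set0 |: faces X.

Lemma down_with_empty : down with_empty.
Proof.
move=> s t; rewrite !inE => /orP[/eqP ->|sX] ts; first by rewrite -subset0 ts.
by have [//|t0] := eqVneq t set0; apply: faces_sub sX ts t0.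
Qed.

Lemma with_emptyE (s : {set 'I_n}) k : #|s| = k.+1 -> (s \in with_empty) = (s \in X).
Proof. by move=> sk; rewrite !inE -cards_eq0 sk. Qed.

Lemma cohom_class_eq0 k (f : cocycle X A k) :
  cohom_class f = 0 <-> f \in @coboundary n X A k.
Proof.
have e0 : cohom_class (0 : cocycle X A k) = 0 by exact: raddf0.
have -> : (f \in @coboundary n X A k) = (cohom_class f == cohom_class 0).
  by rewrite -Quotient.idealrBE subr0.
by rewrite e0; split=> /eqP.
Qed.

Lemma coboundary_cobdy k (f : cocycle X A k.+1) :
  f \in @coboundary n X A k.+1 <-> cobdy with_empty k.+2 (coval f).
Proof.
rewrite coboundaryP; split.
  case=> [->|[j [h [[kj] fh]]]]; last subst j.
    by exists (fun=> 0) => s _ _; rewrite coval0 dlt_eq0.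
  exists (coval h) => s; rewrite !inE => /orP[/eqP ->|sX] sk; first by rewrite cards0 in sk.
  by rewrite fh coval_delta.
case=> h hE; right; exists k, (cochain_of X k h); split=> // s.
have [/andP[sX /eqP sk]|no] := boolP ((s \in X) && (#|s| == k.+2)).
  by rewrite coval_delta_of // hE // (with_emptyE sk).
by rewrite !coval_out.
Qed.

Lemma cocyc_coval k (f : cocycle X A k) : cocyc with_empty k.+1 (coval f).
Proof.
move=> s sK sk; have sX : s \in X by rewrite -(with_emptyE sk).
by rewrite /dlt -(coval_delta f sX sk) delta_cocycle coval0.
Qed.

Lemma cup_eq0 i j (x : cohomology X A i) (y : cohomology X A j) : (0 < i)%N ->
  (forall f g : {set 'I_n} -> A, cocyc with_empty i.+1 f -> cocyc with_empty j.+1 g ->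
     cobdy with_empty (i + j).+1 (cupf i f g)) -> cup x y = 0.
Proof.
case: i x => // i x _ H; apply/cohom_class_eq0; apply/coboundary_cobdy.
have [h hE] := H _ _ (@cocyc_coval _ (repr x)) (@cocyc_coval _ (repr y)).
exists h => s sK sk; rewrite -hE //; apply: (@coval_cup _ _ _ i.+1 j) => //.
by rewrite -(with_emptyE sk).
Qed.

End Translate.

Section SparseProbability.
Variables (R : realType) (alpha : nat -> R).
Hypothesis alpha_gt0 : forall i, (0 < i)%N -> 0 < alpha i.
Local Notation prb n E := (prob (@edge_prob R alpha n) E).

Definition facesH n (H : {set {set 'I_n}}) := with_empty (lower_complex H).

Lemma facesHP n (H : {set {set 'I_n}}) (s : {set 'I_n}) :
  reflect (forall t : {set 'I_n}, t \subset s -> (1 < #|t|)%N -> t \in H) (s \in facesH H).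
Proof.
rewrite !inE; apply: (iffP orP) => [[/eqP ->|/andP[_ /forallP sH]] t ts t1|sH].
- by move: t1; rewrite subset0 in ts; rewrite (eqP ts) cards0.
- by have := sH t; rewrite ts t1.
have [|s0] := eqVneq s set0; [by left|right]; apply/forallP => t; apply/implyP => /andP[].
exact: sH.
Qed.

Definition big n (L : {set {set 'I_n}}) : {set {set 'I_n}} := [set t in L | (1 < #|t|)%N].

Lemma prod_powR (J : Type) (r : seq J) (Q : pred J) (x : R) (f : J -> R) : 0 < x ->
  \prod_(j <- r | Q j) x `^ f j = x `^ (\sum_(j <- r | Q j) f j).
Proof.
move=> x0; rewrite (big_morph (powR x) (id1 := 1) (op1 := *%R)) ?powRr0 // => a b.
by rewrite powRD // (gt_eqF x0) implybT.
Qed.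

Lemma prob_weight n (L : {set {set 'I_n}}) : (0 < n)%N ->
  prb n (fun H => big L \subset H) = n%:R `^ (- weight alpha L).
Proof.
move=> n0; rewrite /prob; under eq_Ex do rewrite asboolb.
rewrite Ex_subset /weight -sumrN -prod_powR ?ltr0n //.
rewrite big_mkcond [RHS]big_mkcond; apply: eq_bigr => t _.
by rewrite inE /edge_prob; case: ifP => // /andP[_ ->].
Qed.

Lemma bin_le_exp n k : ('C(n, k) <= n ^ k)%N.
Proof.
apply: (@leq_trans (n ^_ k)); first by rewrite -bin_ffact leq_pmulr // fact_gt0.
elim: k n => [|k IH] n; first by rewrite ffactn0.
rewrite ffactnS expnS leq_mul2l (leq_trans (IH _)) ?orbT //.
by case: k {IH} => // k; rewrite leq_exp2r // leq_pred.
Qed.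

(** Union bound over at most [n ^ N] sets [W] and at most [2 ^ 2 ^ N] families of subsets of [W];
    each family that is heavy enough is present with probability at most [n ^ (- (S' * N))]. *)
Lemma prob_dense n N (S' : R) : (0 < n)%N ->
  prb n (fun H => exists W : {set 'I_n},
     #|W| = N /\ S' * N%:R <= weight alpha (induced (facesH H) W))
  <= (2 ^ 2 ^ N)%:R * n%:R `^ (- ((S' - 1) * N%:R)).
Proof.
move=> n0; have e01 := @edge_prob01 _ _ alpha_gt0 n.
pose D (u : {set 'I_n} * {set {set 'I_n}}) :=
  [&& #|u.1| == N, u.2 \subset powerset u.1 & S' * N%:R <= weight alpha u.2].
apply: (@le_trans _ _ (\sum_(u | D u) prb n (fun H => big u.2 \subset H))).
  apply: prob_bigcup => // H [W [WN Ww]]; exists (W, induced (facesH H) W).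
    rewrite /D /= WN eqxx Ww andbT /=; apply/subsetP => s.
    by rewrite inE powersetE => /andP[].
  apply/subsetP => t; rewrite inE => /andP[]; rewrite inE => /andP[/facesHP tH _] t1.
  exact: tH.
apply: (@le_trans _ _ (\sum_(u | D u) n%:R `^ (- (S' * N%:R)))).
  apply: ler_sum => u /and3P[_ _ uw]; rewrite prob_weight //.
  by apply: ler_powR; rewrite ?ler1n // lerN2.
rewrite sumr_const -[leLHS]mulr_natl.
have -> : - ((S' - 1) * N%:R) = N%:R - S' * N%:R by ring.
rewrite powRD; last by rewrite pnatr_eq0 -lt0n n0 implybT.
rewrite mulrA ler_wpM2r ?powR_ge0 // powR_mulrn ?ler0n // -natrX -natrM ler_nat.
apply: (@leq_trans (\sum_(W : {set 'I_n} | #|W| == N) 2 ^ 2 ^ N)).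
  rewrite -sum1_card (eq_bigl D) // -(pair_big_dep (fun W : {set 'I_n} => #|W| == N)
    (fun W (L : {set {set 'I_n}}) => (L \subset powerset W) && (S' * N%:R <= weight alpha L))
    (fun _ _ => 1%N)) /=.
  apply: leq_sum => W /eqP WN; rewrite sum1_card -WN -card_powerset -card_powerset.
  by apply: subset_leq_card; apply/subsetP => L; rewrite unfold_in powersetE => /andP[].
rewrite sum_nat_const mulnC leq_mul2l.
have -> : #|[pred W : {set 'I_n} | #|W| == N]| = 'C(n, N).
  by rewrite -[in RHS](card_ord n) -card_draws; apply: eq_card => W; rewrite !inE.
by rewrite bin_le_exp orbT.
Qed.

Lemma negl_not_sparse N (S' : R) : 1 < S' ->
  negl alpha (fun n H => ~ sparse alpha (facesH H) N S').
Proof.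
move=> S1; have nb := @negl_bigcup _ _ alpha_gt0 N (fun i n H => exists W : {set 'I_n},
     #|W| = i.+1 /\ S' * i.+1%:R <= weight alpha (induced (facesH H) W)).
apply: negl_sub (nb _) => //.
  apply: nearW => n H ns; apply: contrapT => no; apply: ns => W /andP[W0 WN].
  rewrite ltNge; apply/negP => le; apply: no; exists #|W|.-1; first by rewrite prednK.
  by exists W; rewrite prednK.
move=> i iN; apply: (negl_bound alpha_gt0 (@cvg_nat_powR _ (2 ^ 2 ^ i.+1)%:R ((S' - 1) * i.+1%:R) _)).
  by rewrite mulr_gt0 ?subr_gt0 ?ltr0n.
near=> n; apply: prob_dense; near: n; exact: nbhs_infty_gt.
Unshelve. all: by end_near.
Qed.

End SparseProbability.

(** * The trace method *)

Section WalkSums.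
Variables (R : realType) (I : finType).
Implicit Types (B : I -> I -> R) (F G : seq I -> R) (s : seq I).

Fixpoint sum_seqs k F : R :=
  if k is k'.+1 then \sum_x sum_seqs k' (fun s => F (x :: s)) else F [::].

Lemma le_sum_seqs k F G : (forall s, size s = k -> F s <= G s) ->
  sum_seqs k F <= sum_seqs k G.
Proof.
elim: k F G => [|k IH] F G FG /=; first exact: FG.
by apply: ler_sum => x _; apply: IH => s sk; apply: FG; rewrite /= sk.
Qed.

Lemma eq_sum_seqs k F G : F =1 G -> sum_seqs k F = sum_seqs k G.
Proof. by move=> FG; elim: k F G FG => [|k IH] F G FG //=; apply: eq_bigr => x _; apply: IH. Qed.

Lemma sum_seqsZ k a F : sum_seqs k (fun s => a * F s) = a * sum_seqs k F.
Proof.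
elim: k F => [|k IH] F //=; rewrite mulr_sumr; apply: eq_bigr => x _; exact: IH.
Qed.

Lemma sum_seqs_sum k (J : finType) (F : J -> seq I -> R) :
  sum_seqs k (fun s => \sum_j F j s) = \sum_j sum_seqs k (F j).
Proof.
elim: k F => [|k IH] F //=; rewrite exchange_big; apply: eq_bigr => x _; exact: IH.
Qed.

(** The entries of the [k]-th power of the matrix [B], to be expanded over walks by [pw_walks]. *)
Fixpoint pw B k (u w : I) : R :=
  if k is k'.+1 then \sum_z B u z * pw B k' z w else (u == w)%:R.

Fixpoint wt B (u : I) s : R := if s is x :: s' then B u x * wt B x s' else 1.

Lemma pw_walks B k u w :
  pw B k u w = sum_seqs k (fun s => wt B u s * (last u s == w)%:R).
Proof.
elim: k u => [|k IH] u /=; first by rewrite mul1r.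
apply: eq_bigr => z _; rewrite IH -sum_seqsZ; apply: eq_sum_seqs => s.
by rewrite mulrA.
Qed.

Lemma pwD B k m u w : pw B (k + m) u w = \sum_z pw B k u z * pw B m z w.
Proof.
elim: k u => [|k IH] u /=.
  rewrite (bigD1 u) //= eqxx mul1r big1 ?addr0 // => z /negPf zu.
  by rewrite eq_sym zu mul0r.
under eq_bigr do rewrite IH mulr_sumr.
rewrite exchange_big; apply: eq_bigr => z _; rewrite mulr_suml.
by apply: eq_bigr => y _; rewrite mulrA.
Qed.

Lemma pw1 B z w : pw B 1 z w = B z w.
Proof.
rewrite /= (bigD1 w) //= eqxx mulr1 big1 ?addr0 // => y /negPf yw.
by rewrite yw mulr0.
Qed.

Lemma pw_sym B k : (forall u w, B u w = B w u) -> forall u w, pw B k u w = pw B k w u.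
Proof.
move=> Bs; elim: k => [|k IH] u w; first by rewrite /= eq_sym.
transitivity (\sum_z pw B k u z * B z w).
  rewrite -addn1 pwD; apply: eq_bigr => z _; rewrite pw1 //.
by apply: eq_bigr => z _; rewrite mulrC Bs IH.
Qed.

Lemma cauchy_schwarz (J : finType) (a b : J -> R) :
  (\sum_j a j * b j) ^+ 2 <= (\sum_j a j ^+ 2) * (\sum_j b j ^+ 2).
Proof.
rewrite -subr_ge0.
suff : 0 <= \sum_i \sum_j (a i * b j - a j * b i) ^+ 2.
  have -> : \sum_i \sum_j (a i * b j - a j * b i) ^+ 2 =
      2 * ((\sum_j a j ^+ 2) * (\sum_j b j ^+ 2) - (\sum_j a j * b j) ^+ 2).
    transitivity (\sum_i \sum_j (a i ^+ 2 * b j ^+ 2 + a j ^+ 2 * b i ^+ 2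
                     - 2 * ((a i * b i) * (a j * b j)))).
      by apply: eq_bigr => i _; apply: eq_bigr => j _; ring.
    have e1 : \sum_i \sum_j (a i ^+ 2 * b j ^+ 2) = (\sum_j a j ^+ 2) * (\sum_j b j ^+ 2).
      by rewrite mulr_suml; apply: eq_bigr => i _; rewrite mulr_sumr.
    have e2 : \sum_i \sum_j (a j ^+ 2 * b i ^+ 2) = (\sum_j a j ^+ 2) * (\sum_j b j ^+ 2).
      by rewrite exchange_big.
    have e3 : \sum_i \sum_j (2 * ((a i * b i) * (a j * b j))) = 2 * (\sum_j a j * b j) ^+ 2.
      rewrite expr2 mulr_suml mulr_sumr; apply: eq_bigr => i _.
      by rewrite mulr_sumr mulr_sumr; apply: eq_bigr => j _.
    under eq_bigr do rewrite sumrB big_split /=.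
    by rewrite sumrB big_split /= e1 e2 e3; ring.
  by rewrite pmulr_rge0.
by apply: sumr_ge0 => i _; apply: sumr_ge0 => j _; exact: sqr_ge0.
Qed.

Definition quad B k (x : I -> R) : R := \sum_u \sum_w x u * pw B k u w * x w.

Definition trace_pw B k : R := \sum_u pw B k u u.

Section Symmetric.
Variables (B : I -> I -> R) (x : I -> R).
Hypothesis Bs : forall u w, B u w = B w u.
Let X := \sum_u x u ^+ 2.
Let y k z := \sum_u x u * pw B k u z.

Lemma quadE k : quad B k x = \sum_z y k z * x z.
Proof. by rewrite /quad exchange_big; apply: eq_bigr => z _; rewrite mulr_suml. Qed.

Lemma quad_double k : quad B (k + k) x = \sum_z y k z ^+ 2.
Proof.
transitivity (\sum_u \sum_w \sum_z (x u * pw B k u z) * (x w * pw B k w z)).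
  apply: eq_bigr => u _; apply: eq_bigr => w _.
  rewrite pwD mulr_sumr mulr_suml; apply: eq_bigr => z _.
  by rewrite (pw_sym k Bs z w); ring.
transitivity (\sum_u \sum_z (x u * pw B k u z) * y k z).
  apply: eq_bigr => u _; rewrite exchange_big; apply: eq_bigr => z _.
  by rewrite mulr_sumr.
by rewrite exchange_big; apply: eq_bigr => z _; rewrite -mulr_suml expr2.
Qed.

Lemma quad_sqr k : quad B k x ^+ 2 <= X * quad B (k + k) x.
Proof. by rewrite quadE quad_double mulrC; exact: cauchy_schwarz. Qed.

Lemma quad_double_trace k : quad B (k + k) x <= X * trace_pw B (k + k).
Proof.
rewrite quad_double /trace_pw mulr_sumr; apply: ler_sum => z _.
apply: le_trans (cauchy_schwarz _ _) _; rewrite pwD ler_wpM2l //.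
  by apply: sumr_ge0 => u _; exact: sqr_ge0.
apply: ler_sum => u _; by rewrite expr2 (pw_sym k Bs u z).
Qed.

(** Repeated Cauchy-Schwarz in place of a diagonalisation: each step squares the quadratic form and
    doubles the power of [B], and the last one compares with the trace. *)
Lemma quad_trace k r : quad B k x ^+ (2 ^ r.+1) <= X ^+ (2 ^ r.+1) * trace_pw B (k * 2 ^ r.+1).
Proof.
have X0 : 0 <= X by apply: sumr_ge0 => u _; exact: sqr_ge0.
elim: r k => [|r IH] k.
  apply: le_trans (quad_sqr k) _; rewrite expn1 muln2 -addnn expr2 -mulrA.
  by rewrite ler_wpM2l // quad_double_trace.
rewrite expnS [in X in X <= _]exprM.
have q0 : 0 <= quad B (k + k) x.
  by rewrite quad_double; apply: sumr_ge0 => z _; exact: sqr_ge0.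
apply: (@le_trans _ _ ((X * quad B (k + k) x) ^+ (2 ^ r.+1))).
  by rewrite lerXn2r ?nnegrE ?sqr_ge0 ?mulr_ge0 // quad_sqr.
rewrite exprMn mul2n -addnn exprD -mulrA ler_wpM2l ?exprn_ge0 //.
by have := IH (k + k)%N; rewrite addnn -muln2 -mulnA mul2n addnn.
Qed.

Lemma quad_le r (lam : R) : 0 <= lam -> trace_pw B (2 ^ r.+1) <= lam ^+ (2 ^ r.+1) ->
  quad B 1 x <= lam * X.
Proof.
move=> lam0 tr; have X0 : 0 <= X by apply: sumr_ge0 => u _; exact: sqr_ge0.
have [q0|q0] := ltP (quad B 1 x) 0; first by rewrite (le_trans (ltW q0)) // mulr_ge0.
rewrite -(@ler_pXn2r _ (2 ^ r.+1)) ?nnegrE ?mulr_ge0 ?expn_gt0 //.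
apply: le_trans (quad_trace 1 r) _; rewrite mul1n exprMn mulrC.
by rewrite ler_wpM2r // exprn_ge0.
Qed.

End Symmetric.

Definition distinct s : nat := size (undup s).

(** A new head is either one of at most [k] old elements, or one of [#|I|] others, each paid for by
    a factor [#|I|^-1]; so every step costs a factor at most [k.+1]. *)
Lemma sum_seqs_distinct k : (0 < #|I|)%N ->
  sum_seqs k (fun s => #|I|%:R^-1 ^+ distinct s) <= (k`!)%:R.
Proof.
move=> I0; elim: k => [|k IH] /=; first by rewrite /distinct /= expr0.
rewrite -sum_seqs_sum.
apply: (@le_trans _ _ (sum_seqs k (fun s => k.+1%:R * #|I|%:R^-1 ^+ distinct s))).
  apply: le_sum_seqs => s sk; have y0 : 0 <= (#|I|%:R^-1 : R) by rewrite invr_ge0.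
  rewrite (bigID (mem s)) /= -[k.+1]addn1 natrD mulrDl mul1r lerD //.
    apply: (@le_trans _ _ (\sum_(x in s) #|I|%:R^-1 ^+ distinct s)).
      by apply: ler_sum => x xs; rewrite /distinct /= xs.
    rewrite sumr_const -[leLHS]mulr_natl ler_wpM2r ?exprn_ge0 // ler_nat -sk.
    exact: card_size.
  apply: (@le_trans _ _ (\sum_(x : I) #|I|%:R^-1 ^+ (distinct s).+1)).
    rewrite [leRHS](bigID (mem s)) /= ler_wpDl //.
      by apply: sumr_ge0 => x _; rewrite exprn_ge0.
    by apply: ler_sum => x /negPf xs; rewrite /distinct /= xs.
  rewrite sumr_const -[leLHS]mulr_natl exprS mulrA mulfV ?mul1r //.
  by rewrite pnatr_eq0 -lt0n.
by rewrite sum_seqsZ factS natrM ler_wpM2l.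
Qed.

Fixpoint walk_edges (u : I) s : seq {set I} :=
  if s is x :: s' then [set u; x] :: walk_edges x s' else [::].

Lemma size_walk_edges u s : size (walk_edges u s) = size s.
Proof. by elim: s u => //= x s IH u; rewrite IH. Qed.

Lemma walk_edges_sub u s e v : e \in walk_edges u s -> v \in e -> v \in u :: s.
Proof.
elim: s u => //= x s IH u; rewrite inE => /orP[/eqP ->|es ve].
  by rewrite !inE => /orP[]/eqP ->; rewrite eqxx ?orbT.
by rewrite inE IH ?orbT.
Qed.

Lemma distinct_walk u s : (distinct (u :: s) <= (size (undup (walk_edges u s))).+1)%N.
Proof.
elim: s u => // x s IH u; rewrite /distinct /=; case: ifP => us.
  by apply: leq_trans (IH x) _; rewrite ltnS; case: ifP.
have -> : [set u; x] \in walk_edges x s = false.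
  apply/negP => /walk_edges_sub /(_ (set21 u x)); by rewrite us.
by rewrite /= ltnS; apply: IH.
Qed.

End WalkSums.

(** * The expected trace of the centred matrix of a link *)

Section WalkExpectation.
Variables (R : realType) (alpha : nat -> R).
Hypothesis alpha_gt0 : forall i, (0 < i)%N -> 0 < alpha i.
Variables (n : nat) (tau : {set 'I_n}).
Hypothesis n0 : (0 < n)%N.
Local Notation T := 'I_n.
Local Notation Pe := (@edge_prob R alpha n).
Local Notation E := (Ex Pe).
Implicit Types (A : {set T}) (H : {set {set T}}) (u v w : T).

(** For [A] disjoint from [tau], the hyperedges that meet the complement of [tau] exactly in [A].
    Different [A] give disjoint families, hence independent [zeta]. If [tau] is a face, the
    singletons decide the vertices of its link and the pairs the adjacency between them. *)
Definition cof A : {set {set T}} :=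
  [set s : {set T} | [&& A \subset s, s \subset A :|: tau & (1 < #|s|)%N]].

Definition zeta A H : R := (cof A \subset H)%:R.

Lemma zeta01 A H : 0 <= zeta A H <= 1.
Proof. by rewrite ler0n lern1 leq_b1. Qed.

Lemma zeta_idem A H : zeta A H * zeta A H = zeta A H.
Proof. by rewrite /zeta; case: (_ \subset _); rewrite ?mulr0 ?mulr1. Qed.

Lemma dep_zeta A : dep (zeta A) (cof A).
Proof. exact: dep_subset. Qed.

Lemma cof_disjoint A A' : [disjoint A & tau] -> [disjoint A' & tau] -> A != A' ->
  [disjoint cof A & cof A'].
Proof.
move=> dA dA' AA'; apply/pred0P => s /=; apply: contraNF AA'.
have key (B : {set T}) : [disjoint B & tau] -> s \in cof B -> B = s :\: tau.
  move=> dB; rewrite inE => /and3P[Bs sB _]; apply/setP => v; rewrite inE.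
  have [vB|vB] := boolP (v \in B).
    by rewrite (subsetP Bs) // (disjointFr dB).
  have [vs|] := boolP (v \in s); rewrite ?andbF // andbT.
  by have := subsetP sB v vs; rewrite inE (negPf vB) /= => ->.
by move=> /andP[/(key _ dA) e /(key _ dA') e']; rewrite e -e'.
Qed.

Definition exponent A : R := \sum_(s in cof A) alpha #|s|.-1.

Lemma E_zeta A : E (zeta A) = n%:R `^ (- exponent A).
Proof.
rewrite Ex_subset /exponent -sumrN -prod_powR ?ltr0n //; apply: eq_bigr => s.
by rewrite inE /edge_prob => /and3P[_ _ ->].
Qed.

Lemma exponentE A : [disjoint A & tau] ->
  exponent A = \sum_(r : {set T} | (r \subset tau) && (1 < #|A| + #|r|)%N) alpha (#|A| + #|r|).-1.
Proof.
move=> dA; pose Q (r : {set T}) := (r \subset tau) && (1 < #|A| + #|r|)%N.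
have dr (r : {set T}) : r \subset tau -> [disjoint A & r].
  by move=> rt; apply: disjointWr dA.
have cU (r : {set T}) : r \subset tau -> #|A :|: r| = (#|A| + #|r|)%N.
  by move=> /dr; rewrite -leq_card_setU => /eqP.
have inj : {in Q &, injective (fun r => A :|: r)}.
  move=> r r' /andP[rt _] /andP[rt' _] e; apply/setP => v.
  have := dr _ rt; have := dr _ rt'; rewrite !disjoints_subset => d1 d2.
  move/setP/(_ v): e; rewrite !inE; case vA: (v \in A) => //= _.
  by have := subsetP d1 v vA; have := subsetP d2 v vA; rewrite !inE => /negPf -> /negPf ->.
transitivity (\sum_(s in [set A :|: r | r in Q]) alpha #|s|.-1).
  apply: eq_bigl => s; rewrite inE; apply/and3P/imsetP => [[As sA s1]|[r /andP[rt r1] ->]].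
    exists (s :\: A); last by rewrite setDE setUIr setUCr setIT; apply/esym/setUidPr.
    have st : s :\: A \subset tau by rewrite subDset.
    by rewrite unfold_in /Q st -cU // setDE setUIr setUCr setIT (setUidPr As).
  by rewrite subsetUl setUS // cU.
rewrite big_imset //=; apply: eq_big => // r /andP[rt _]; by rewrite cU.
Qed.

Lemma exponent1 j v : #|tau| = j.+1 -> v \notin tau -> exponent [set v] = S1 j alpha.
Proof.
move=> tj vt; rewrite exponentE ?disjoints1 // cards1 -(sum_subsets alpha tj).
by apply: eq_bigl => r; rewrite add1n ltnS card_gt0.
Qed.

Definition exponent2 : R := \sum_(r : {set T} | r \subset tau) alpha #|r|.+1.

Lemma exponent_pair u w : u != w -> u \notin tau -> w \notin tau ->
  exponent [set u; w] = exponent2.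
Proof.
move=> uw ut wt; rewrite exponentE; last first.
  by rewrite disjoints_subset subUset !sub1set !inE ut.
by rewrite cards2 uw; apply: eq_bigl => r; rewrite andbT.
Qed.

(** The subsets of [v |: tau] are split according to whether they contain [v]. In the notation
    below, [n * q * p = n ^ (1 - S1 j.+1 alpha)], the order of the degrees in the link. *)
Lemma S1_exponent2 j v : #|tau| = j.+1 -> v \notin tau ->
  S1 j.+1 alpha = S1 j alpha + exponent2.
Proof.
move=> tj vt; have cvt : #|v |: tau| = j.+2 by rewrite cardsU1 vt tj.
rewrite -(sum_subsets alpha cvt) -(sum_subsets alpha tj).
rewrite (bigID (fun t : {set T} => v \notin t)) /=; congr (_ + _).
  apply: eq_bigl => t; rewrite andbAC; congr (_ && _).
  apply/andP/idP => [[tv vt']|tt].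
    apply/subsetP => x xt; have := subsetP tv x xt; rewrite !inE => /orP[/eqP e|//].
    by rewrite -e xt in vt'.
  by split; [apply: subset_trans tt (subsetUr _ _)|apply: contra vt; apply: (subsetP tt)].
have nv (r : {set T}) : r \subset tau -> v \notin r by move=> rt; apply: contra vt; apply: (subsetP rt).
transitivity (\sum_(t in [set v |: r | r in [pred r : {set T} | r \subset tau]]) alpha #|t|).
  apply: eq_bigl => t; rewrite negbK; apply/idP/imsetP.
    case/andP=> /andP[tv _] vt'; exists (t :\ v); last by rewrite setD1K.
    by rewrite inE subDset.
  case=> r; rewrite inE => rt ->; rewrite setUS // setU11 andbT /=.
  by apply/set0Pn; exists v; rewrite setU11.
rewrite big_imset /=; last first.
  by move=> r r'; rewrite !inE => /nv vr /nv vr' e; rewrite -(setU1K vr) e setU1K.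
by apply: eq_bigr => r; rewrite inE => rt; rewrite cardsU1 nv.
Qed.

Lemma exponent2_ge0 : 0 <= exponent2.
Proof. by apply: sumr_ge0 => r _; apply/ltW/alpha_gt0. Qed.

Variable (j : nat).
Hypothesis tj : #|tau| = j.+1.
Let q : R := n%:R `^ (- S1 j alpha).
Let p : R := n%:R `^ (- exponent2).

(* The centred adjacency matrix of the link of [tau], when [tau] is a face. *)
Definition centred H u w : R :=
  if [&& u != w, u \notin tau & w \notin tau]
  then zeta [set u] H * zeta [set w] H * (zeta [set u; w] H - p) else 0.

Lemma centred_sym H u w : centred H u w = centred H w u.
Proof.
rewrite /centred eq_sym (andbC (u \notin tau)) (setUC [set u]).
by case: ifP => // _; congr (_ * _); rewrite mulrC.
Qed.

Fixpoint proper_walk u s :=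
  if s is x :: s' then [&& u != x, u \notin tau, x \notin tau & proper_walk x s'] else true.

Lemma wt_improper H u s : ~~ proper_walk u s -> wt (centred H) u s = 0.
Proof.
elim: s u => //= x s IH u; rewrite !negb_and /centred.
case: (u != x); case: (u \notin tau); case: (x \notin tau) => /= hs; rewrite ?mul0r //.
by rewrite IH ?mulr0.
Qed.

(** Since [zeta] is idempotent, a vertex visited several times counts once, while each passage
    through an edge keeps its centred factor. *)
Lemma wt_proper H u s : proper_walk u s ->
  zeta [set u] H * wt (centred H) u s =
  (\prod_(v <- undup (u :: s)) zeta [set v] H) *
  (\prod_(e <- walk_edges u s) (zeta e H - p)).
Proof.
elim: s u => [|x s IH] u; first by rewrite /= big_seq1 big_nil.
move=> /and4P[ux ut xt px]; have e := IH x px.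
have cE : centred H u x = zeta [set u] H * zeta [set x] H * (zeta [set u; x] H - p).
  by rewrite /centred ux ut xt.
rewrite [wt _ _ _]/= cE [walk_edges _ _]/= big_cons.
set b := zeta [set u; x] H - p.
transitivity ((zeta [set u] H * \prod_(v <- undup (x :: s)) zeta [set v] H) *
    (b * \prod_(e <- walk_edges x s) (zeta e H - p))).
  transitivity ((zeta [set u] H * zeta [set u] H) * b * (zeta [set x] H * wt (centred H) x s)).
    by ring.
  by rewrite zeta_idem e; ring.
congr (_ * _).
rewrite -[undup (u :: x :: s)]/(if u \in x :: s then undup (x :: s) else u :: undup (x :: s)).
case: ifP => us; last by rewrite big_cons.
have uu : u \in undup (x :: s) by rewrite mem_undup.
by rewrite (big_rem u uu) /= mulrA zeta_idem.
Qed.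

Lemma wt_zeta H u s : s != [::] -> zeta [set u] H * wt (centred H) u s = wt (centred H) u s.
Proof.
case: s => //= x s _; rewrite /centred; case: ifP => _; last by rewrite !mul0r mulr0.
by rewrite !mulrA zeta_idem.
Qed.

Lemma proper_walk_notin u s v : s != [::] -> proper_walk u s -> v \in u :: s -> v \notin tau.
Proof.
elim: s u => //= x s IH u _ /and4P[_ ut xt px]; rewrite inE => /orP[/eqP -> //|].
by case: s IH px => [|y s] IH px; [rewrite inE => /eqP ->|exact: IH].
Qed.

Lemma proper_walk_edge u s e : proper_walk u s -> e \in walk_edges u s ->
  exists x y, [/\ e = [set x; y], x != y, x \notin tau & y \notin tau].
Proof.
elim: s u => //= x s IH u /and4P[ux ut xt px]; rewrite inE => /orP[/eqP ->|]; last exact: IH.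
by exists u, x.
Qed.

Lemma q_ge0 : 0 <= q. Proof. exact: powR_ge0. Qed.

Lemma p_gt0 : 0 < p. Proof. by rewrite powR_gt0 ?ltr0n. Qed.

Lemma p_le1 : p <= 1.
Proof.
rewrite -[leRHS](powRr0 n%:R) ler_powR ?ler1n // oppr_le0; exact: exponent2_ge0.
Qed.

(** As [zeta e H - p] lies between -1 and 1, a power with [c >= 2] is at most the square in absolute
    value, and the square has mean [p * (1 - p)]. *)
Lemma E_power_le e c : E (zeta e) = p -> (2 <= c)%N ->
  `|E (fun H => (zeta e H - p) ^+ c)| <= p.
Proof.
move=> Ee c2; have e01 := @edge_prob01 _ _ alpha_gt0 n.
have le H : `|(zeta e H - p) ^+ c| <= (1 - p *+ 2) * zeta e H + p ^+ 2.
  have -> : (1 - p *+ 2) * zeta e H + p ^+ 2 = `|zeta e H - p| ^+ 2.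
    rewrite real_normK ?num_real //.
    have -> : (zeta e H - p) ^+ 2 = zeta e H * zeta e H - p *+ 2 * zeta e H + p ^+ 2 by ring.
    by rewrite zeta_idem; ring.
  rewrite normrX -(subnK c2) exprD ler_piMl ?exprn_ge0 // exprn_ile1 //.
  have := p_gt0; have := p_le1; have /andP[] := zeta01 e H.
  by rewrite ler_norml; lra.
rewrite ler_norml; apply/andP; split.
  rewrite lerNl -mulN1r -ExZ; apply: (@le_trans _ _ (E (fun H => (1 - p *+ 2) * zeta e H + p ^+ 2))).
    by apply: le_Ex => // H; apply: le_trans (le H); rewrite mulN1r ler_normr lexx orbT.
  by rewrite ExD ExZ Ex_cst Ee; have := p_gt0; nra.
apply: (@le_trans _ _ (E (fun H => (1 - p *+ 2) * zeta e H + p ^+ 2))).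
  by apply: le_Ex => // H; apply: le_trans (le H); exact: ler_norm.
by rewrite ExD ExZ Ex_cst Ee; have := p_gt0; nra.
Qed.

Lemma prod_undup_count (J : eqType) (s : seq J) (F : J -> R) :
  \prod_(e <- s) F e = \prod_(e <- undup s) F e ^+ count_mem e s.
Proof.
by rewrite -big_undup_iterop_count; apply: eq_bigr.
Qed.

Lemma sum_undup_count (J : eqType) (s : seq J) :
  (\sum_(e <- undup s) count_mem e s = size s)%N.
Proof.
have := big_undup_iterop_count addn s xpredT (fun=> 1%N) (idx := 0%N).
rewrite sum1_size => <-; apply: eq_bigr => e _.
by rewrite Monoid.iteropE iter_addn_0 mul1n.
Qed.

(** The mean factors over distinct vertices and distinct edges, and an edge passed only once
    contributes 0. Otherwise there are at most [m.+1] edges, so [t <= m.+2] distinct vertices, and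
    the mean is at most [q ^+ t * p ^+ t.-1]; the assumption [1 <= n%:R * q * p] allows raising the
    exponent [t] to [m.+2]. *)
Lemma E_wt_le u s m : size s = m.+1.*2 -> 1 <= n%:R * q * p ->
  E (fun H => wt (centred H) u s) <=
    (n%:R * q * p) ^+ m.+2 / p * n%:R^-1 ^+ distinct (u :: s).
Proof.
move=> sm D1; have s0 : s != [::] by case: s sm.
have e01 := @edge_prob01 _ _ alpha_gt0 n.
have rhs0 : 0 <= (n%:R * q * p) ^+ m.+2 / p * n%:R^-1 ^+ distinct (u :: s).
  have p0 := p_gt0; have q0 := q_ge0.
  apply: mulr_ge0; last by rewrite exprn_ge0 // invr_ge0 ler0n.
  by rewrite mulr_ge0 ?invr_ge0 ?(ltW p0) // exprn_ge0 // !mulr_ge0 ?ler0n ?(ltW p0).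
have [pw|npw] := boolP (proper_walk u s); last first.
  by rewrite (eq_Ex _ (fun H => wt_improper H npw)) Ex_cst.
have nt v : v \in u :: s -> v \notin tau by apply: proper_walk_notin.
set es := walk_edges u s.
pose F (A : {set T}) H := if #|A| == 1%N then zeta A H
  else (zeta A H - p) ^+ count_mem A es.
pose J := [seq [set v] | v <- undup (u :: s)] ++ undup es.
have JD A : A \in J -> [disjoint A & tau].
  rewrite mem_cat => /orP[/mapP[v]|]; rewrite mem_undup.
    by move/nt => vt ->; rewrite disjoints1.
  move=> Ae; have [x [y [-> xy xt yt]]] := proper_walk_edge pw Ae.
  by rewrite disjoints_subset subUset !sub1set !inE xt.
have card_es e : e \in es -> #|e| = 2%N.
  by move=> ee; have [x [y [-> xy _ _]]] := proper_walk_edge pw ee; rewrite cards2 xy.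
have uJ : uniq J.
  rewrite cat_uniq map_inj_uniq ?undup_uniq ?andbT //; last exact: set1_inj.
  apply/hasPn => A; rewrite mem_undup => /card_es A2; apply/negP => /mapP[v _ e].
  by rewrite e cards1 in A2.
have -> : E (fun H => wt (centred H) u s) = \prod_(A <- J) E (F A).
  rewrite -(@Ex_prod _ _ _ _ J F cof uJ).
  - apply: eq_Ex => H; rewrite -(wt_zeta H u s0) wt_proper // big_cat big_map /=.
    congr (_ * _); first by apply: eq_bigr => v _; rewrite /F cards1.
    rewrite prod_undup_count big_seq [RHS]big_seq; apply: eq_bigr => e.
    by rewrite mem_undup => /card_es e2; rewrite /F e2.
  - move=> A _ H; rewrite /F; case: ifP => _; first exact: dep_zeta.
    by rewrite -dep_zeta.
  by move=> A A' /JD dA /JD dA' AA'; exact: cof_disjoint.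
have E1 v : v \in u :: s -> E (F [set v]) = q.
  move=> /nt vt; rewrite /q -(exponent1 tj vt) -E_zeta; apply: eq_Ex => H.
  by rewrite /F cards1.
have E2 e : e \in es -> E (zeta e) = p.
  move=> ee; have [x [y [-> xy xt yt]]] := proper_walk_edge pw ee.
  by rewrite E_zeta exponent_pair.
have prodq : \prod_(v <- undup (u :: s)) E (F [set v]) = q ^+ distinct (u :: s).
  rewrite big_seq (eq_bigr (fun=> q)); last by move=> v; rewrite mem_undup => /E1.
  by rewrite -big_seq big_const_seq count_predT iter_mulr_1.
rewrite [\prod_(A <- J) _]big_cat big_map prodq.
set t := distinct (u :: s).
have [one|two] := boolP (has (fun e => count_mem e es == 1%N) (undup es)).
  case/hasP: one => e; rewrite mem_undup => ee /eqP c1.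
  rewrite (big_rem e) ?mem_undup //= [X in _ * (X * _)](_ : _ = 0) ?mul0r ?mulr0 //.
  rewrite /F (card_es e ee) c1 /=; under eq_Ex do rewrite expr1.
  by rewrite ExD Ex_cst E2 // subrr.
have cnt2 e : e \in undup es -> (2 <= count_mem e es)%N.
  move=> ee; have := hasPn two e ee; rewrite mem_undup -has_pred1 has_count in ee.
  by case: (count_mem e es) ee => [|[|]].
set r := size (undup es).
have rm : (r <= m.+1)%N.
  rewrite -(leq_pmul2r (ltn0Sn 1)) [(m.+1 * 2)%N]muln2 -sm -(size_walk_edges u s) -/es.
  rewrite -(sum_undup_count es) /r -sum1_size big_distrl /= big_seq [leqRHS]big_seq.
  by apply: leq_sum => e /cnt2; rewrite mul1n.
have tr : (t <= r.+1)%N by apply: distinct_walk.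
have t0 : (0 < t)%N.
  have : u \in undup (u :: s) by rewrite mem_undup mem_head.
  by rewrite /t /distinct; case: (undup _).
have p0 := p_gt0; have p1 := p_le1; have q0 := q_ge0.
have le1 : \prod_(e <- undup es) E (F e) <= p ^+ r.
  apply: le_trans (ler_norm _) _; rewrite normr_prod.
  apply: (@le_trans _ _ (\prod_(e <- undup es) p)); last first.
    by rewrite big_const_seq count_predT iter_mulr_1.
  rewrite big_seq [leRHS]big_seq; apply: ler_prod => e ee; rewrite normr_ge0 /=.
  have ee' : e \in es by rewrite mem_undup in ee.
  apply: le_trans (E_power_le (E2 e ee') (cnt2 e ee)).
  rewrite le_eqVlt; apply/orP; left; apply/eqP; congr (`|_|); apply: eq_Ex => H.
  by rewrite /F (card_es e ee').
apply: (@le_trans _ _ (q ^+ t * p ^+ r)); first by rewrite ler_wpM2l ?exprn_ge0.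
apply: (@le_trans _ _ (q ^+ t * p ^+ t.-1)).
  rewrite ler_wpM2l ?exprn_ge0 //; apply: ler_wiXn2l => //; first exact: ltW.
  by rewrite -ltnS prednK.
have -> : q ^+ t * p ^+ t.-1 = (n%:R * q * p) ^+ t / p * n%:R^-1 ^+ t.
  have nn : (n%:R : R) != 0 by rewrite pnatr_eq0 -lt0n.
  have pn : p != 0 by rewrite gt_eqF.
  case: (t) t0 => // k _; rewrite !exprMn exprVn /= !exprS.
  have nk : (n%:R ^+ k : R) != 0 by rewrite expf_neq0.
  by field; rewrite pn nn nk.
rewrite ler_wpM2r ?exprn_ge0 ?invr_ge0 // ler_wpM2r ?invr_ge0 ?(ltW p0) //.
by apply: ler_weXn2l => //; apply: leq_trans tr _; rewrite ltnS.
Qed.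

Lemma Ex_sum_seqs k (F : seq T -> {set {set T}} -> R) :
  E (fun H => sum_seqs k (F^~ H)) = sum_seqs k (fun s => E (F s)).
Proof.
elim: k F => [|k IH] F //=; rewrite Ex_sum; apply: eq_bigr => x _.
exact: (IH (fun s H => F (x :: s) H)).
Qed.

Lemma E_trace_le m : 1 <= n%:R * q * p ->
  E (fun H => trace_pw (centred H) m.+1.*2) <=
    (n%:R * q * p) ^+ m.+2 / p * (m.+1.*2.+1`!)%:R.
Proof.
move=> D1; have e01 := @edge_prob01 _ _ alpha_gt0 n.
have [k km] : exists k, k = m.+1.*2 by exists m.+1.*2.
rewrite -km; set C := _ / p.
have C0 : 0 <= C.
  by rewrite mulr_ge0 ?invr_ge0 ?(ltW p_gt0) // exprn_ge0 // (le_trans ler01).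
have -> : E (fun H => trace_pw (centred H) k) = \sum_u sum_seqs k (fun s =>
    E (fun H => wt (centred H) u s * (last u s == u)%:R)).
  rewrite /trace_pw Ex_sum; apply: eq_bigr => u _; rewrite -Ex_sum_seqs.
  by apply: eq_Ex => H; rewrite pw_walks.
apply: (@le_trans _ _ (C * sum_seqs k.+1 (fun s : seq T => #|T|%:R^-1 ^+ distinct s))).
  rewrite -sum_seqsZ [leRHS]/=; apply: ler_sum => u _; apply: le_sum_seqs => s sk.
  rewrite card_ord; under eq_Ex do rewrite mulrC.
  rewrite ExZ; case: eqP => _; last first.
    by rewrite mul0r mulr_ge0 // exprn_ge0 // invr_ge0.
  by rewrite mul1r; apply: E_wt_le; rewrite ?sk.
by rewrite ler_wpM2l // sum_seqs_distinct // card_ord.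
Qed.

End WalkExpectation.

(** * Garland's method *)

Section Garland.
Variables (R : realType) (n : nat).
Local Notation T := 'I_n.
Implicit Types (s t tau : {set T}) (u v w : T).

Lemma sum_flags (V : nmodType) m (phi : T -> {set T} -> V) :
  \sum_(s : {set T} | #|s| == m.+1) \sum_(v in s) phi v s =
  \sum_(t : {set T} | #|t| == m) \sum_(v | v \notin t) phi v (v |: t).
Proof.
rewrite (exchange_big_dep xpredT) //= [RHS](exchange_big_dep xpredT) //=.
apply: eq_bigr => v _.
rewrite (reindex_onto (fun t => v |: t) (fun s => s :\ v)) /=; last first.
  by move=> s /andP[_ vs]; rewrite setD1K.
apply: eq_bigl => t; rewrite setU11 andbT; have [vt|vt] := boolP (v \in t).
  rewrite andbF; apply/negP => /andP[_ /eqP e].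
  by move: vt; rewrite -e !inE eqxx.
by rewrite cardsU1 vt eqSS setU1K // eqxx andbT.
Qed.

Variables (K : {set {set T}}) (d : nat) (lam : R) (f : {set T} -> R).
Hypothesis dK : down K.
Hypothesis f_supp : forall s, f s != 0 -> s \in K /\ #|s| = d.+1.
Hypothesis f_cocyc : cocyc K d.+1 f.

Definition local tau u : R := if u \in tau then 0 else slice u f tau.

Definition adjacent tau u w := [&& u != w, u \notin tau, w \notin tau & u |: (w |: tau) \in K].

Definition codegree t : nat := #|[set u | (u \notin t) && (u |: t \in K)]|.

Lemma cross_term t v w : v \notin t -> w \notin t -> v != w ->
  (-1) ^+ vrank (w |: (v |: t)) v * f (w |: t) * ((-1) ^+ vrank (w |: (v |: t)) w * f (v |: t))
  = - (slice v f t * slice w f t).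
Proof.
move=> vt wt vw; rewrite vrank_setU1_id; rewrite vrank_setU1; last 2 first.
- by rewrite inE negb_or inE eq_sym vw.
- by [].
rewrite vrank_setU1_id vrank_setU1 1?eq_sym // /slice.
case: (ltngtP v w) => [_|_|/val_inj e]; last by rewrite e eqxx in vw.
  by rewrite addn0 addn1 exprS; ring.
by rewrite addn0 addn1 exprS; ring.
Qed.

(** The sum of [dlt f s ^+ 2] over the faces with [d.+2] vertices is 0. Its squares collect into
    codegrees, and its mixed terms, grouped by the face [tau] left after removing both vertices,
    into the adjacency forms of the links with a minus sign. *)
Lemma garland_identity :
  \sum_(t : {set T} | #|t| == d.+1) (codegree t)%:R * f t ^+ 2 =
  \sum_(tau : {set T} | #|tau| == d) \sum_u \sum_(w | adjacent tau u w) local tau u * local tau w.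
Proof.
have z : \sum_(s : {set T} | #|s| == d.+2) (if s \in K then dlt f s ^+ 2 else 0) = 0.
  apply: big1 => s /eqP sd; case: ifP => // sK.
  by rewrite f_cocyc // expr0n.
apply/eqP; rewrite -subr_eq0 -[X in _ == X]z; apply/eqP.
pose a s v := (-1) ^+ vrank s v * f (s :\ v).
have -> : \sum_(s : {set T} | #|s| == d.+2) (if s \in K then dlt f s ^+ 2 else 0) =
   \sum_(s : {set T} | #|s| == d.+2) \sum_(v in s) (if s \in K then f (s :\ v) ^+ 2 else 0)
 + \sum_(s : {set T} | #|s| == d.+2) \sum_(v in s)
      (if s \in K then a s v * \sum_(w in s :\ v) a s w else 0).
  rewrite -big_split; apply: eq_bigr => s _; rewrite -big_split /=; case: ifP => _; last first.
    by rewrite big1 // => v _; rewrite addr0.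
  rewrite expr2 {1}/dlt mulr_suml; apply: eq_bigr => v vs.
  rewrite -/(a s v) /dlt (bigD1 v) //= -/(a s v) mulrDr; congr (_ + _).
    by rewrite /a mulrACA -expr2 sqrr_sign mul1r expr2.
  by congr (_ * _); apply: eq_bigl => w; rewrite !inE andbC.
congr (_ + _).
  rewrite sum_flags; apply: eq_bigr => t _.
  rewrite /codegree -sum1_card natr_sum mulr_suml big_mkcond [RHS]big_mkcond.
  apply: eq_bigr => v _; rewrite inE; case: (boolP (v \in t)) => //= vt.
  by rewrite setU1K //; case: ifP => //; rewrite mul1r.
rewrite sum_flags.
transitivity (\sum_(t : {set T} | #|t| == d.+1) \sum_(w in t)
   \sum_(v | v \notin t) (if v |: t \in K then a (v |: t) v * a (v |: t) w else 0)); last first.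
  apply: eq_bigr => t _; rewrite exchange_big; apply: eq_bigr => v vt.
  case: ifP => _; last by rewrite big1.
  by rewrite setU1K // mulr_sumr.
rewrite sum_flags -sumrN; apply: eq_bigr => tau _; rewrite -sumrN [RHS]big_mkcond.
apply: eq_bigr => u _; rewrite /local /adjacent; have [ut|ut] /= := boolP (u \in tau).
  by rewrite big1 ?oppr0 // => w; rewrite andbF.
rewrite -sumrN [LHS]big_mkcond [RHS]big_mkcond; apply: eq_bigr => w _ /=.
rewrite in_setU1 negb_or (eq_sym w) setUCA; case: (boolP (u == w)) => //= uw.
case: (boolP (w \in tau)) => //= wt; case: ifP => // _.
rewrite /a setU1K; last by rewrite inE negb_or inE eq_sym uw wt.
rewrite setUCA setU1K; last by rewrite inE negb_or inE uw ut.
by rewrite cross_term 1?eq_sym // mulrC.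
Qed.

Hypothesis f_harmonic : forall tau, tau \in K -> #|tau| = d ->
  \sum_(u | u \notin tau) slice u f tau = 0.
Hypothesis link_gap : forall tau, tau \in K -> #|tau| = d -> forall x : T -> R,
  \sum_u x u = 0 -> (forall u, x u != 0 -> u \notin tau /\ u |: tau \in K) ->
  \sum_u \sum_(w | adjacent tau u w) x u * x w <= lam * \sum_u x u ^+ 2.
Hypothesis large_codegree : forall t, t \in K -> #|t| = d.+1 ->
  lam * d.+1%:R < (codegree t)%:R.
Hypothesis lam0 : 0 <= lam.

Lemma local_sqr : \sum_(tau : {set T} | #|tau| == d) \sum_u local tau u ^+ 2 =
  d.+1%:R * \sum_(t : {set T} | #|t| == d.+1) f t ^+ 2.
Proof.
transitivity (\sum_(tau : {set T} | #|tau| == d) \sum_(u | u \notin tau) f (u |: tau) ^+ 2).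
  apply: eq_bigr => tau _; rewrite [RHS]big_mkcond; apply: eq_bigr => u _.
  rewrite /local; case: ifP => /= _; first by rewrite expr0n.
  by rewrite /slice exprMn sqrr_sign mul1r.
rewrite -(sum_flags d (fun=> fun s => f s ^+ 2)) mulr_sumr; apply: eq_bigr => t /eqP td.
by rewrite sumr_const td mulr_natl.
Qed.

(** Summing the spectral bounds of all links counts each [f t ^+ 2] exactly [d.+1] times, so a
    non-zero value of [f] would contradict the codegree bound. *)
Lemma garland : forall s, f s = 0.
Proof.
have local_le tau : #|tau| == d -> \sum_u \sum_(w | adjacent tau u w) local tau u * local tau w
    <= lam * \sum_u local tau u ^+ 2.
  move=> /eqP td; have [tK|tK] := boolP (tau \in K); last first.
    rewrite [leLHS]big1 ?mulr_ge0 ?sumr_ge0 // => [u _|u _]; first exact: sqr_ge0.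
    apply: big1 => w /and4P[_ _ _ uwK]; case/negP: tK; apply: dK uwK _.
    by apply: subset_trans (subsetUr _ _) (subsetUr _ _).
  apply: link_gap => //.
    transitivity (\sum_(u | u \notin tau) slice u f tau); last exact: f_harmonic.
    rewrite [RHS]big_mkcond; apply: eq_bigr => u _.
    by rewrite /local; case: ifP.
  move=> u; rewrite /local; case: ifP => [_|/negbT ut]; first by rewrite eqxx.
  by rewrite slice_eq0 => /f_supp[].
have le : \sum_(t : {set T} | #|t| == d.+1) (codegree t)%:R * f t ^+ 2 <=
    \sum_(t : {set T} | #|t| == d.+1) lam * d.+1%:R * f t ^+ 2.
  rewrite garland_identity -mulr_sumr -mulrA -local_sqr mulr_sumr.
  exact: ler_sum.
move=> s; apply/eqP; apply: contrapT => /negP fs.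
have [sK sd] := f_supp fs.
move: le; apply/negP; rewrite -ltNge.
rewrite (bigD1 s) /= ?sd // [ltRHS](bigD1 s) /= ?sd // ltr_leD //.
  by rewrite ltr_pM2r ?large_codegree // lt0r sqrf_eq0 fs sqr_ge0.
apply: ler_sum => t /andP[/eqP td _]; have [->|ft] := eqVneq (f t) 0.
  by rewrite expr0n !mulr0.
have [tK _] := f_supp ft.
by rewrite ler_wpM2r ?sqr_ge0 // ltW // large_codegree.
Qed.

End Garland.

(** * Tail bounds for codegrees and traces *)

Section DegreeTail.
Variables (R : realType) (alpha : nat -> R).
Hypothesis alpha_gt0 : forall i, (0 < i)%N -> 0 < alpha i.
Variables (n : nat) (t : {set 'I_n}) (k : nat).
Hypotheses (n0 : (0 < n)%N) (tk : #|t| = k.+1).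
Local Notation E := (Ex (@edge_prob R alpha n)).
Local Notation prb P := (prob (@edge_prob R alpha n) P).

(** Defined whether or not [t] is a face, which makes it a sum of independent indicators. *)
Definition potential_codegree (H : {set {set 'I_n}}) : nat :=
  #|[set u | (u \notin t) && (cof t [set u] \subset H)]|.

Lemma potential_codegreeE H : t \in facesH H ->
  potential_codegree H = codegree (facesH H) t.
Proof.
move=> tH; congr #|pred_of_set _|; apply/setP => u; rewrite [LHS]in_set [RHS]in_set.
case: (boolP (u \in t)) => //= ut.
apply/idP/idP => [/subsetP cH|uH].
  apply/facesHP => s su s1; have [us|us] := boolP (u \in s).
    by apply: cH; rewrite inE sub1set us su.
  move/facesHP: tH => tH; apply: tH => //; apply/subsetP => v vs.
  have := subsetP su v vs; rewrite !inE => /orP[/eqP e|//].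
  by rewrite -e vs in us.
apply/subsetP => s; rewrite inE => /and3P[_ su s1].
by move/facesHP: uH => uH; apply: uH.
Qed.

Lemma expR1_ge2 : 2 <= expR 1 :> R.
Proof. by have := expR_ge1Dx (1 : R). Qed.

(** A Chernoff bound: [expR (- Y) <= 2^-1 ^+ Y] is a product over the [n - k.+1] vertices outside
    [t] of independent factors with mean [1 - r / 2 <= expR (- (r / 2))]. *)
Lemma prob_codegree_le (a : R) :
  prb (fun H => (potential_codegree H)%:R <= a) <=
  expR (a - (n - k.+1)%:R * (n%:R `^ (- S1 k alpha) / 2)).
Proof.
have e01 := @edge_prob01 _ _ alpha_gt0 n.
set r := n%:R `^ _; have r0 : 0 <= r by apply: powR_ge0.
have r1 : r <= 1.
  rewrite -[leRHS](powRr0 n%:R) ler_powR ?ler1n // oppr_le0; exact: S1_ge0.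
pose F u H : R := 1 - zeta R t [set u] H / 2.
have F0 u H : 0 <= F u H.
  by rewrite /F; have /andP[] := zeta01 R t [set u] H; lra.
have us : uniq (enum [set u | u \notin t]) by apply: enum_uniq.
have Fprod H : expR (- (potential_codegree H)%:R) <= \prod_(u <- enum [set u | u \notin t]) F u H.
  have -> : \prod_(u <- enum [set u | u \notin t]) F u H = 2^-1 ^+ potential_codegree H.
    rewrite big_enum_cond /=.
    rewrite (bigID (fun u => cof t [set u] \subset H)) /=.
    rewrite [X in _ * X]big1 ?mulr1; last first.
      by move=> u /andP[_ /negPf uH]; rewrite /F /zeta uH mul0r subr0.
    rewrite (eq_bigr (fun=> 2^-1)); last first.
      by move=> u /andP[_ uH]; rewrite /F /zeta uH mulr1n; lra.
    rewrite (eq_bigl (mem [set u | (u \notin t) && (cof t [set u] \subset H)])).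
      by rewrite prodr_const.
    by move=> u; rewrite !inE andbT.
  rewrite expRN -[X in expR X]mulr1 expRM_natl exprVn lef_pV2 ?posrE ?exprn_gt0 ?expR_gt0 //.
  by rewrite lerXn2r ?nnegrE ?expR_ge0 // expR1_ge2.
apply: (@le_trans _ _ (E (fun H => expR a * \prod_(u <- enum [set u | u \notin t]) F u H))).
  apply: prob_markov => // H.
    by rewrite mulr_ge0 ?expR_ge0 // prodr_ge0.
  move=> Ya; apply: (@le_trans _ _ (expR a * expR (- (potential_codegree H)%:R))).
    by rewrite -expRD -[leLHS]expR0 ler_expR subr_ge0.
  by rewrite ler_wpM2l ?expR_ge0.
rewrite ExZ expRD ler_wpM2l ?expR_ge0 //.
rewrite (@Ex_prod _ _ _ _ _ F (fun u => cof t [set u]) us).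
- rewrite (eq_big_seq (fun=> 1 - r / 2)); last first.
    move=> u; rewrite mem_enum inE => ut; rewrite /F.
    transitivity (E (fun H => 1 + - 2^-1 * zeta R t [set u] H)).
      by apply: eq_Ex => H; rewrite mulNr mulrC.
    by rewrite ExD Ex_cst ExZ E_zeta // (exponent1 alpha tk ut) -/r; lra.
  rewrite big_const_seq count_predT iter_mulr_1 -cardE.
  have -> : #|[set u | u \notin t]| = (n - k.+1)%N.
    have -> : [set u | u \notin t] = ~: t by apply/setP => u; rewrite !inE.
    by have := cardsC t; rewrite card_ord tk; lia.
  rewrite -[X in expR X]mulrN expRM_natl lerXn2r ?nnegrE ?expR_ge0 //; first by lra.
  exact: expR_ge1Dx.
- move=> u _ H; rewrite /F; congr (1 - _ / 2); exact: dep_zeta.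
- move=> u v; rewrite !mem_enum !inE => ut vt uv; apply: cof_disjoint.
  + by rewrite disjoints1.
  + by rewrite disjoints1.
  + by apply: contra_neq uv => /set1_inj.
Qed.

End DegreeTail.

Section CodegreeAas.
Variables (R : realType) (alpha : nat -> R).
Hypothesis alpha_gt0 : forall i, (0 < i)%N -> 0 < alpha i.
Local Notation prb n E := (prob (@edge_prob R alpha n) E).

Lemma expR_ge_pow (x : R) k : 0 <= x -> x ^+ k.+1 / (k.+1`!)%:R <= expR x.
Proof. by move=> x0; apply: le_trans (expR_ge1Dxn k x0); rewrite lerDr ler01. Qed.

(* Below [n ^ (1 - S1 k) / 8] there are too few cofaces; the value [1/8] leaves room
   for both the Chernoff bound and the spectral comparison. *)
Definition few_cofaces k n (H : {set {set 'I_n}}) : Prop :=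
  exists t : {set 'I_n}, [/\ #|t| = k.+1, t \in facesH H &
    (codegree (facesH H) t)%:R <= (n%:R `^ (1 - S1 k alpha) / 8 : R)].

Lemma negl_few_cofaces k : S1 k alpha < 1 -> negl alpha (@few_cofaces k).
Proof.
move=> Sk; set e := 1 - S1 k alpha; have e0 : 0 < e by rewrite subr_gt0.
(* With this [M], [D ^+ M.+1] exceeds [n ^ (k + 2)]: it pays for the union over at most [n ^ k.+1]
   sets and leaves a factor [1 / n]. *)
pose M := (Num.truncn (k.+2%:R / e)).
have eM : k.+1%:R - e * M.+1%:R < -1.
  have : k.+2%:R / e < M.+1%:R by apply: truncnS_gt.
  by rewrite ltr_pdivrMr // -[k.+2]addn1 natrD; lra.
set C := (M.+1`!)%:R * 8 ^+ M.+1 : R.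
apply: (negl_bound alpha_gt0 (@cvg_nat_powR _ C 1 ltr01)).
near=> n.
have n0 : (0 < n)%N by near: n; exact: nbhs_infty_gt.
have nk : (k.+1.*2 <= n)%N by near: n; exact: nbhs_infty_ge.
set D : R := n%:R `^ e.
have D0 : 0 < D by rewrite powR_gt0 // ltr0n.
have e01 := @edge_prob01 _ _ alpha_gt0 n.
apply: (@le_trans _ _ (\sum_(t : {set 'I_n} | #|t| == k.+1)
    prb n (fun H => (potential_codegree t H)%:R <= D / 8))).
  apply: prob_bigcup => // H [t [tk tH le]]; exists t; first by rewrite tk.
  by rewrite potential_codegreeE.
have tail (t : {set 'I_n}) : #|t| == k.+1 ->
    prb n (fun H => (potential_codegree t H)%:R <= D / 8) <= C / D ^+ M.+1.
  move=> /eqP tk; apply: le_trans (prob_codegree_le alpha_gt0 n0 tk _) _.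
  (* At least [n / 2] vertices lie outside [t], so the exponent is at most [D / 8 - D / 4]. *)
  apply: (@le_trans _ _ (expR (- (D / 8)))).
    rewrite ler_expR.
    have nE : n%:R / 2 <= ((n - k.+1)%:R : R).
      rewrite ler_pdivrMr // -natrM ler_nat; move: nk; rewrite -addnn; lia.
    have -> : D = n%:R * n%:R `^ (- S1 k alpha).
      by rewrite /D /e powRD ?powRr1 // pnatr_eq0 -lt0n n0 implybT.
    set r := _ `^ _; have r0 : 0 <= r by apply: powR_ge0.
    nra.
  have C0 : 0 < C by rewrite mulr_gt0 ?exprn_gt0 // ltr0n fact_gt0.
  rewrite expRN -[leRHS]invf_div lef_pV2 ?posrE ?expR_gt0 ?divr_gt0 ?exprn_gt0 //.
  have D8 : 0 <= D / 8 by rewrite divr_ge0 // ltW.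
  apply: le_trans (expR_ge_pow M D8).
  rewrite /C expr_div_n le_eqVlt; apply/orP; left; apply/eqP.
  have f0 : (M.+1`!)%:R != 0 :> R by rewrite pnatr_eq0 -lt0n fact_gt0.
  have g0 : (8 ^+ M.+1 : R) != 0 by rewrite expf_neq0 // pnatr_eq0.
  by field; rewrite f0 g0.
apply: (@le_trans _ _ (\sum_(t : {set 'I_n} | #|t| == k.+1) C / D ^+ M.+1)).
  by apply: ler_sum => t; apply: tail.
rewrite sumr_const -[leLHS]mulr_natl.
have -> : #|[pred t : {set 'I_n} | #|t| == k.+1]| = 'C(n, k.+1).
  by rewrite -[in RHS](card_ord n) -card_draws; apply: eq_card => W; rewrite !inE.
have C0 : 0 <= C by rewrite mulr_ge0 ?exprn_ge0.
apply: (@le_trans _ _ (n%:R `^ k.+1%:R * (C / D ^+ M.+1))).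
  rewrite ler_wpM2r ?divr_ge0 ?exprn_ge0 ?(ltW D0) //.
  by rewrite powR_mulrn ?ler0n // -natrX ler_nat bin_le_exp.
rewrite mulrCA ler_wpM2l // /D -[in X in _ / X]powR_mulrn ?powR_ge0 // -powRrM -powRN.
rewrite -powRD; last by rewrite pnatr_eq0 -lt0n n0 implybT.
by apply: ler_powR; rewrite ?ler1n // ltW.
Unshelve. all: by end_near.
Qed.

(** The base of the threshold is the [lam] used in Garland's method; [lam * j.+2%:R] is exactly the
    bound in [few_cofaces]. *)
Definition large_trace j r n (H : {set {set 'I_n}}) : Prop :=
  exists tau : {set 'I_n}, #|tau| = j.+1 /\
    (n%:R `^ (1 - S1 j.+1 alpha) / (8 * j.+2%:R)) ^+ (2 ^ r.+1) <
    trace_pw (centred alpha tau H) (2 ^ r.+1).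

Lemma negl_large_trace j : S1 j.+1 alpha < 1 -> exists r, negl alpha (@large_trace j r).
Proof.
move=> Sj; set e := 1 - S1 j.+1 alpha; have e0 : 0 < e by rewrite subr_gt0.
(* Markov's inequality costs a constant times [n / D ^+ m] for each [tau], with [m = 2 ^ r - 1], and
   there are at most [n ^ j.+1] of them; hence [e * m] has to exceed [j + 3] to leave a factor
   [1 / n]. *)
pose r := Num.truncn (j.+3%:R / e + 1); exists r.
have er : j.+3%:R < e * ((2 ^ r)%:R - 1).
  have : j.+3%:R / e + 1 < r.+1%:R by apply: truncnS_gt.
  have : (r.+1 <= 2 ^ r)%N by apply: ltn_expl.
  rewrite -(ler_nat R) => h1 h2; have : j.+3%:R / e < (2 ^ r)%:R - 1 by lra.
  by rewrite ltr_pdivrMr // mulrC.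
pose m := (2 ^ r).-1; have mr : m.+1 = (2 ^ r)%N by rewrite prednK // expn_gt0.
have m2r : m.+1.*2 = (2 ^ r.+1)%N by rewrite mr expnS mul2n.
set b : R := 8 * j.+2%:R; have b0 : 0 < b by rewrite mulr_gt0.
set C := (m.+1.*2.+1`!)%:R * b ^+ m.+1.*2 : R.
apply: (negl_bound alpha_gt0 (@cvg_nat_powR _ C 1 ltr01)).
near=> n.
have n0 : (0 < n)%N by near: n; exact: nbhs_infty_gt.
have nj : (j.+1 < n)%N by near: n; exact: nbhs_infty_gt.
have e01 := @edge_prob01 _ _ alpha_gt0 n.
have nn0 : (0 : R) < n%:R by rewrite ltr0n.
set D : R := n%:R `^ e.
have D0 : 0 < D by rewrite powR_gt0.
have D1 : 1 <= D by rewrite -(powRr0 n%:R) ler_powR ?ler1n // ltW.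
have L0 : 0 < (D / b) ^+ m.+1.*2 by rewrite exprn_gt0 // divr_gt0.
apply: (@le_trans _ _ (\sum_(tau : {set 'I_n} | #|tau| == j.+1)
    prb n (fun H => (D / b) ^+ m.+1.*2 < trace_pw (centred alpha tau H) m.+1.*2))).
  by apply: prob_bigcup => // H [tau [tk le]]; exists tau; rewrite ?tk // m2r.
have tail (tau : {set 'I_n}) : #|tau| == j.+1 ->
    prb n (fun H => (D / b) ^+ m.+1.*2 < trace_pw (centred alpha tau H) m.+1.*2)
      <= C * n%:R / D ^+ m.
  move=> /eqP tk; have [v vt] : exists v, v \notin tau.
    apply/existsP; rewrite -negb_forall; apply/negP => /forallP all.
    have : (n <= #|tau|)%N.
      by rewrite -[leqLHS](card_ord n); apply: subset_leq_card; apply/subsetP => v _.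
    by rewrite leqNgt tk nj.
  have SE := S1_exponent2 alpha tk vt.
  set q : R := n%:R `^ (- S1 j alpha); set p : R := n%:R `^ (- exponent2 alpha tau).
  have p0 : 0 < p by rewrite powR_gt0.
  have DE : n%:R * q * p = D.
    rewrite -{1}[n%:R](powRr1 (ler0n _ _)) /q /p -!powRD ?(gt_eqF nn0) ?implybT //.
    by congr (_ `^ _); rewrite /e SE; ring.
  (* The exponent of [p] is part of [S1 j.+1 alpha], which is less than 1. *)
  have pn : p^-1 <= n%:R.
    rewrite /p -powRN opprK -[leRHS](powRr1 (ler0n _ _)) ler_powR ?ler1n //.
    by have := S1_ge0 alpha_gt0 j; move: Sj; rewrite SE; lra.
  apply: (@le_trans _ _ (Ex (@edge_prob R alpha n) (fun H => ((D / b) ^+ m.+1.*2)^-1 *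
      trace_pw (centred alpha tau H) m.+1.*2))).
    apply: prob_markov => // H; last first.
      by move=> lt; rewrite mulrC ler_pdivlMr // mul1r ltW.
    rewrite mulr_ge0 ?invr_ge0 ?(ltW L0) // -addnn /trace_pw.
    apply: sumr_ge0 => u _; rewrite pwD; apply: sumr_ge0 => w _.
    by rewrite (pw_sym _ (@centred_sym _ _ _ _ H) w u) -expr2 sqr_ge0.
  rewrite ExZ.
  have := E_trace_le alpha_gt0 n0 tk m; rewrite -/q -/p DE => /(_ D1) tr.
  apply: (@le_trans _ _ (((D / b) ^+ m.+1.*2)^-1 * (D ^+ m.+2 / p * (m.+1.*2.+1)`!%:R))).
    by rewrite ler_wpM2l // invr_ge0 ltW.
  have -> : ((D / b) ^+ m.+1.*2)^-1 * (D ^+ m.+2 / p * (m.+1.*2.+1)`!%:R) =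
      C * p^-1 / D ^+ m.
    have -> : m.+1.*2 = (m + m.+2)%N by rewrite -addnn addSnnS.
    rewrite /C (_ : m.+1.*2 = (m + m.+2)%N); last by rewrite -addnn addSnnS.
    rewrite expr_div_n !exprD; have d1 : D ^+ m != 0 by rewrite expf_neq0 // gt_eqF.
    have d2 : D ^+ m.+2 != 0 by rewrite expf_neq0 // gt_eqF.
    have d3 : b ^+ m != 0 by rewrite expf_neq0 // gt_eqF.
    have d4 : b ^+ m.+2 != 0 by rewrite expf_neq0 // gt_eqF.
    have d5 : p != 0 by rewrite gt_eqF.
    by field; rewrite d1 d2 d3 d4 d5.
  rewrite ler_wpM2r ?invr_ge0 ?exprn_ge0 ?(ltW D0) // ler_wpM2l //.
  by rewrite mulr_ge0 // exprn_ge0 // ltW.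
apply: (@le_trans _ _ (\sum_(tau : {set 'I_n} | #|tau| == j.+1) C * n%:R / D ^+ m)).
  by apply: ler_sum => tau; apply: tail.
rewrite sumr_const -[leLHS]mulr_natl.
have -> : #|[pred t : {set 'I_n} | #|t| == j.+1]| = 'C(n, j.+1).
  by rewrite -[in RHS](card_ord n) -card_draws; apply: eq_card => W; rewrite !inE.
have C0 : 0 <= C by rewrite mulr_ge0 ?exprn_ge0 // ltW.
apply: (@le_trans _ _ (n%:R `^ j.+1%:R * (C * n%:R / D ^+ m))).
  have CD0 : 0 <= C * n%:R / D ^+ m.
    by rewrite divr_ge0 ?exprn_ge0 ?(ltW D0) // (mulr_ge0 C0).
  rewrite ler_wpM2r //.
  by rewrite powR_mulrn ?ler0n // -natrX ler_nat bin_le_exp.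
rewrite -mulrA mulrCA ler_wpM2l // /D -[in X in _ / X]powR_mulrn ?powR_ge0 // -powRrM -powRN.
rewrite -[X in _ * (X * _)](powRr1 (ler0n _ _)).
rewrite -!powRD ?(gt_eqF nn0) ?implybT //.
apply: ler_powR; rewrite ?ler1n //.
have : m%:R = (2 ^ r)%:R - 1 :> R by rewrite -mr -addn1 natrD addrK.
by move=> ->; move: er; rewrite -[j.+3]addn2 -[j.+1]addn1 !natrD; lra.
Unshelve. all: by end_near.
Qed.

End CodegreeAas.

(** * Vanishing of the rational cohomology below the critical degree *)

Section LeastSquares.
Variables (F : realFieldType).

Lemma row_sqr_eq0 m (v : 'rV[F]_m) : v *m v^T = 0 -> v = 0.
Proof.
move=> /matrixP/(_ 0 0); rewrite !mxE => /eqP.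
rewrite psumr_eq0 => [/allP v0|j _]; last by rewrite mxE -expr2 sqr_ge0.
apply/rowP => j; rewrite mxE; have := v0 j (mem_index_enum j).
by rewrite mxE mulf_eq0 orbb => /eqP.
Qed.

(** Positivity of sums of squares gives [A *m A^T] the same left kernel as [A], so its row space is
    all of that of [A^T]. No square root is taken, so any ordered field will do. *)
Lemma normal_equations m k (A : 'M[F]_(m, k)) (c : 'rV[F]_k) :
  exists x : 'rV[F]_m, (c - x *m A) *m A^T = 0.
Proof.
suff /submxP[x xE] : (c *m A^T <= A *m A^T)%MS.
  by exists x; rewrite mulmxBl xE mulmxA subrr.
apply: submx_trans (submxMl _ _) _.
have sub : (A *m A^T <= A^T)%MS by apply: submxMl.
rewrite -(geq_leqif (mxrank_leqif_sup sub)) mxrank_tr.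
have kk : (kermx (A *m A^T) <= kermx A)%MS.
  apply/row_subP => i; apply/sub_kermxP; apply: row_sqr_eq0.
  have : row i (kermx (A *m A^T)) *m (A *m A^T) = 0.
    by rewrite -row_mul mulmx_ker row0.
  by rewrite mulmxA => e; rewrite trmx_mul mulmxA e mul0mx.
have := mxrankS kk; rewrite !mxrank_ker leq_subLR => le.
by have := rank_leq_row (A *m A^T); have := rank_leq_row A; lia.
Qed.

Lemma harmonic_projection (I J : finType) (M : I -> J -> F) (c : J -> F) :
  exists h : I -> F, forall i, \sum_j M i j * (c j - \sum_k h k * M k j) = 0.
Proof.
pose A := \matrix_(i < #|I|, j < #|J|) M (enum_val i) (enum_val j).
pose cr := \row_(j < #|J|) c (enum_val j).
have [x xE] := normal_equations A cr.
exists (fun i => x 0 (enum_rank i)) => i.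
move/rowP/(_ (enum_rank i)): xE; rewrite !mxE => xE; rewrite -[RHS]xE.
rewrite (reindex (@enum_val J predT)) /=; last by apply: onW_bij; apply: enum_val_bij.
apply: eq_bigr => j _; rewrite !mxE enum_rankK mulrC; congr (_ * _).
congr (_ - _).
rewrite (reindex (@enum_val I predT)) /=; last by apply: onW_bij; apply: enum_val_bij.
by apply: eq_bigr => k _; rewrite !mxE enum_valK.
Qed.

End LeastSquares.

Section RationalVanishing.
Variables (R : realType) (n : nat).
Local Notation T := 'I_n.
Implicit Types (s t tau : {set T}).

(** Subtracting the orthogonal projection to the coboundaries leaves a cochain orthogonal to all of
    them; tested on the coboundary of a single [tau], this is the vanishing mean on its link. *)
Lemma harmonic_representative (K : {set {set T}}) d (c : {set T} -> rat) :
  exists h : {set T} -> rat, let f s := if (s \in K) && (#|s| == d.+1) then c s - dlt h s else 0 in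
  forall tau, #|tau| = d -> \sum_(u | u \notin tau) slice u f tau = 0.
Proof.
pose M (k t : {set T}) : rat := if (t \in K) && (#|t| == d.+1)
  then \sum_(v in t | t :\ v == k) (-1) ^+ vrank t v else 0.
have [h hE] := harmonic_projection M c; exists h => f tau td.
rewrite -[RHS](hE tau).
have dltE t : (t \in K) && (#|t| == d.+1) -> \sum_k h k * M k t = dlt h t.
  move=> tK; rewrite /M tK /dlt.
  under eq_bigr do rewrite mulr_sumr.
  rewrite (exchange_big_dep (mem t)) /=; last by move=> k v _ /andP[].
  apply: eq_bigr => v vt; rewrite (big_pred1 (t :\ v)) => [|k]; first by rewrite mulrC.
  by rewrite vt /= eq_sym.
transitivity (\sum_(t : {set T} | #|t| == d.+1) \sum_(v in t)
   (if t :\ v == tau then (-1) ^+ vrank t v * f t else 0)); last first.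
  rewrite [LHS]big_mkcond; apply: eq_bigr => t _.
  case: (boolP ((t \in K) && (#|t| == d.+1))) => tK; last first.
    have -> : M tau t = 0 by rewrite /M (negPf tK).
    rewrite mul0r /f (negPf tK); case: ifP => // _.
    by rewrite big1 // => v _; rewrite mulr0 if_same.
  have -> : M tau t = \sum_(v in t | t :\ v == tau) (-1) ^+ vrank t v by rewrite /M tK.
  rewrite (dltE t tK) /f tK; case/andP: tK => _ ->.
  rewrite mulr_suml big_mkcondr /=; apply: eq_bigr => v _.
  by case: ifP => //; rewrite mul0r.
rewrite sum_flags (bigD1 tau) /= ?td // [X in _ + X]big1 ?addr0; last first.
  move=> t /andP[_ tt]; apply: big1 => v vt.
  by rewrite setU1K // (negPf tt).
apply: eq_bigr => v vt; rewrite setU1K // eqxx vrank_setU1_id.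
by rewrite /slice /f.
Qed.

Lemma dlt_ratr (f : {set T} -> rat) s :
  dlt (fun t => ratr (f t) : R) s = ratr (dlt f s).
Proof.
rewrite /dlt rmorph_sum; apply: eq_bigr => v _ /=.
by rewrite rmorphM rmorph_sign.
Qed.

Lemma rational_acyclic (K : {set {set T}}) d (lam : R) : down K -> 0 <= lam ->
  (forall tau, tau \in K -> #|tau| = d -> forall x : T -> R,
    \sum_u x u = 0 -> (forall u, x u != 0 -> u \notin tau /\ u |: tau \in K) ->
    \sum_u \sum_(w | adjacent K tau u w) x u * x w <= lam * \sum_u x u ^+ 2) ->
  (forall t, t \in K -> #|t| = d.+1 -> lam * d.+1%:R < (codegree K t)%:R) ->
  acyclic rat K d.+1.
Proof.
move=> dK lam0 gap deg c cK.
have [h hE] := harmonic_representative K d c.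
set f := (fun s : {set T} => if (s \in K) && (#|s| == d.+1) then c s - dlt h s else 0) in hE.
have f0 : forall s, (ratr (f s) : R) = 0.
  apply: (@garland R n K d lam (fun s => ratr (f s)) dK) => //.
  - move=> s; rewrite fmorph_eq0 /f; case: ifP => [/andP[-> /eqP]|]; rewrite ?eqxx //.
  - move=> s sK sd; rewrite dlt_ratr.
    have -> : dlt f s = dlt (fun t => c t - dlt h t) s.
      apply: eq_dlt => v vs; rewrite /f (dK s) ?subD1set //=.
      by rewrite -eqSS -sd (cardsD1 v s) vs eqxx.
    by rewrite dltB cK // dlt_dlt subrr rmorph0.
  move=> tau tK td.
  transitivity (ratr (\sum_(u | u \notin tau) slice u f tau) : R); last by rewrite hE // rmorph0.
  rewrite rmorph_sum; apply: eq_bigr => u _ /=.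
  by rewrite /slice rmorphM rmorph_sign.
exists h => s sK sd; apply/eqP; rewrite -subr_eq0.
by move/eqP: (f0 s); rewrite fmorph_eq0 /f sK sd eqxx.
Qed.

End RationalVanishing.

Section RationalVanishingAas.
Variables (R : realType) (alpha : nat -> R).
Hypothesis alpha_gt0 : forall i, (0 < i)%N -> 0 < alpha i.

Lemma zeta_face n (H : {set {set 'I_n}}) (tau A : {set 'I_n}) :
  A :|: tau \in facesH H -> zeta R tau A H = 1.
Proof.
move=> /facesHP AtH; rewrite /zeta (_ : _ \subset _) //; apply/subsetP => s.
by rewrite inE => /and3P[_ sA s1]; apply: AtH.
Qed.

Lemma zeta_pair_face n (H : {set {set 'I_n}}) (tau : {set 'I_n}) u w :
  u |: tau \in facesH H -> w |: tau \in facesH H ->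
  zeta R tau [set u; w] H = (u |: (w |: tau) \in facesH H)%:R.
Proof.
move=> uH wH; have [uwH|uwH] := boolP (u |: (w |: tau) \in facesH H).
  by rewrite zeta_face // -setUA.
rewrite /zeta; congr (_%:R); apply/eqP; rewrite eqb0; apply: contra uwH => cH.
apply/facesHP => s; rewrite setUA => su s1.
have [us|us] := boolP (u \in s); last first.
  move/facesHP: wH; apply => //; apply/subsetP => v vs.
  have := subsetP su v vs; rewrite !inE -orbA => /orP[/eqP e|//].
  by rewrite -e vs in us.
have [ws|ws] := boolP (w \in s); last first.
  move/facesHP: uH; apply => //; apply/subsetP => v vs.
  have := subsetP su v vs; rewrite !inE => /orP[/orP[->//|/eqP e]|->]; last by rewrite orbT.
  by rewrite -e vs in ws.
by apply: (subsetP cH); rewrite inE subUset !sub1set us ws su s1.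
Qed.

(** On the vertices of the link, adjacency is the centred matrix plus [p] times the all-ones matrix
    minus the identity. The all-ones matrix kills vectors of mean zero, and [- p] times the identity
    only lowers the form. *)
Lemma link_gap_of_trace n (H : {set {set 'I_n}}) (tau : {set 'I_n}) r (lam : R) x :
  (0 < n)%N -> 0 <= lam ->
  trace_pw (centred alpha tau H) (2 ^ r.+1) <= lam ^+ (2 ^ r.+1) ->
  \sum_u x u = 0 -> (forall u, x u != 0 -> u \notin tau /\ u |: tau \in facesH H) ->
  \sum_u \sum_(w | adjacent (facesH H) tau u w) x u * x w <= lam * \sum_u x u ^+ 2.
Proof.
move=> n0 lam0 tr x0 xs; apply: (@le_trans _ _ (quad (centred alpha tau H) 1 x)); last first.
  by apply: quad_le tr => //; exact: centred_sym.
set p : R := n%:R `^ (- exponent2 alpha tau).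
have p0 : 0 <= p by apply: powR_ge0.
have e u : \sum_(w | adjacent (facesH H) tau u w) x u * x w =
    \sum_w (x u * centred alpha tau H u w * x w + p * (x u * x w)) - p * (x u * x u).
  rewrite [X in _ = X - _](bigD1 u) //= {1}/centred eqxx /= mulr0 mul0r add0r addrAC subrr add0r.
  rewrite big_mkcond [RHS]big_mkcond; apply: eq_bigr => w _.
  rewrite /adjacent eq_sym; case: (eqVneq w u) => //= wu.
  have [->|xu] := eqVneq (x u) 0; first by rewrite !mul0r mulr0 addr0 if_same.
  have [->|xw] := eqVneq (x w) 0; first by rewrite !mulr0 addr0 if_same.
  have [ut uH] := xs u xu; have [wt wH] := xs w xw.
  rewrite /centred eq_sym wu ut wt /= (zeta_face uH) (zeta_face wH).
  rewrite zeta_pair_face // !mul1r -/p.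
  by case: ifP => _ /=; ring.
rewrite (eq_bigr _ (fun u _ => e u)) sumrB.
under eq_bigr do rewrite big_split /=.
have -> : quad (centred alpha tau H) 1 x = \sum_u \sum_w x u * centred alpha tau H u w * x w.
  by apply: eq_bigr => u _; apply: eq_bigr => w _; rewrite pw1.
rewrite big_split /= -addrA gerDl.
have -> : \sum_u \sum_w p * (x u * x w) = 0.
  under eq_bigr do rewrite -mulr_sumr -mulr_sumr x0 mulr0 mulr0.
  by rewrite big1.
rewrite sub0r oppr_le0; apply: sumr_ge0 => u _.
by rewrite mulr_ge0 // -expr2 sqr_ge0.
Qed.

Lemma negl_rational_cohomology d : (0 < d)%N -> S1 d alpha < 1 ->
  negl alpha (fun n H => ~ forall x : cohomology (lower_complex H) rat d, x = 0).
Proof.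
case: d => // j _ Sj.
have [r nr] := negl_large_trace alpha_gt0 Sj.
apply: (negl_sub alpha_gt0 _ (neglU alpha_gt0 (negl_few_cofaces alpha_gt0 Sj) nr)).
near=> n; move=> H nx; apply: contrapT => /not_orP[nf nt]; apply: nx => x.
have n0 : (0 < n)%N by near: n; exact: nbhs_infty_gt.
have dK := @down_with_empty _ (lower_complex H).
set D : R := n%:R `^ (1 - S1 j.+1 alpha).
have D0 : 0 <= D by apply: powR_ge0.
have lam0 : 0 <= D / (8 * j.+2%:R) by rewrite divr_ge0.
have ac : acyclic rat (facesH H) j.+2.
  apply: (rational_acyclic dK lam0).
    move=> tau tK td y y0 ys; apply: (link_gap_of_trace (r := r)) => //.
    by rewrite leNgt; apply/negP => lt; apply: nt; exists tau.
  move=> t tK td; rewrite ltNge; apply/negP => le; apply: nf; exists t; split=> //.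
  apply: (le_trans le); rewrite -/D le_eqVlt; apply/orP; left; apply/eqP.
  have j0 : (j.+2%:R : R) != 0 by rewrite pnatr_eq0.
  by field.
rewrite -[x]reprK; apply/cohom_class_eq0; apply/coboundary_cobdy.
exact/ac/cocyc_coval.
Unshelve. all: by end_near.
Qed.

End RationalVanishingAas.

(** * From sparsity and vanishing to the cup length *)

Section CupTrivialAas.
Variables (R : realType) (alpha : nat -> R).
Hypothesis alpha_gt0 : forall i, (0 < i)%N -> 0 < alpha i.

(** All degrees from [2 * l] on are treated in a single event, as the bound on the cup length
    requires; ring and degrees are quantified inside it. *)
Lemma aas_cup_eq0 l : (0 < l)%N -> 1 < S1 l alpha ->
  negl alpha (fun n H => ~ forall (A : pzRingType) i j
    (x : cohomology (lower_complex H) A i) (y : cohomology (lower_complex H) A j),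
    (0 < i)%N -> (0 < j)%N -> (l.*2 <= i + j)%N -> cup x y = 0).
Proof.
move=> l0; set S := S1 l alpha => S1l.
pose S' := (1 + S) / 2.
have S'1 : 1 < S' by rewrite /S'; lra.
have S'S : S' <= S by rewrite /S'; lra.
(* With [M = N - l.+1], the requirement is [S' * l.+1 <= M * (S - S')], where [S - S' = (S - 1) / 2]
   and [S' <= S]. *)
pose N := ((Num.truncn (2 * S * l.+1%:R / (S - 1))).+1 + l.+1)%N.
have N_large : S' * N%:R <= (N - l.+1)%:R * S.
  set M := (Num.truncn _).+1 in N *.
  have Mlt : 2 * S * l.+1%:R / (S - 1) < M%:R by apply: truncnS_gt.
  rewrite /N addnK natrD.
  rewrite ltr_pdivrMr ?subr_gt0 // in Mlt.
  rewrite /S'; set a := l.+1%:R in Mlt *; have a0 : 0 < a by rewrite ltr0n.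
  have sa : a <= S * a by rewrite ler_peMl // ltW.
  nra.
apply: (negl_sub alpha_gt0 _ (@negl_not_sparse _ _ alpha_gt0 N _ S'1)).
apply: nearW => n H nc sp; apply: nc => A i j x y i0 j0 ld; apply: cup_eq0 => // f g fK gK.
have dK := @down_with_empty _ (lower_complex H).
have lN : (l < N)%N by rewrite /N addnS ltnS leq_addl.
exact: (sparse_cup alpha_gt0 dK S'S l0 lN N_large sp i0 j0 ld fK gK).
Qed.

Lemma aas_cup_trivial l : (0 < l)%N -> 1 < S1 l alpha ->
  aas_lower alpha (fun n X => forall A : pzRingType, cup_trivial X A (2 * l)).
Proof.
move=> l0 S1l; apply: aas_of_negl => //.
apply: (negl_sub alpha_gt0 _ (aas_cup_eq0 l0 S1l)).
apply: nearW => n H nc H0; apply: nc => A i j x y i0 j0 ij.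
by apply: H0 => //; rewrite ij mul2n.
Qed.

End CupTrivialAas.

Section CupLength.
Variables (n : nat) (X : scomplex n) (A : pzRingType).

Lemma cup0l i j (y : cohomology X A j) : cup (0 : cohomology X A i) y = 0.
Proof.
have -> : 0 = cohom_class (0 : cocycle X A i) by apply/esym; exact: raddf0.
rewrite -[y]reprK [X in cup _ X](_ : _ = cohom_class (repr y)) // cup_class.
by apply/cohom_class_eq0/cup_coboundaryl; apply: rpred0.
Qed.

Lemma cup0r i j (x : cohomology X A i) : cup x (0 : cohomology X A j) = 0.
Proof.
have -> : 0 = cohom_class (0 : cocycle X A j) by apply/esym; exact: raddf0.
rewrite -[x]reprK [X in cup X _](_ : _ = cohom_class (repr x)) // cup_class.
by apply/cohom_class_eq0/cup_coboundaryr; apply: rpred0.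
Qed.

Lemma cup_product_gt0 m k (x : cohomology X A k) : cup_product m x -> (0 < m)%N -> (0 < k)%N.
Proof. by case=> // m' i j y z i0 _ _; rewrite addn_gt0 i0. Qed.

Lemma cup_length_le1 : (forall i j (x : cohomology X A i) (y : cohomology X A j),
    (0 < i)%N -> (0 < j)%N -> cup x y = 0) -> cup_length_le X A 1.
Proof.
move=> H m [k [x [px x0]]]; rewrite leqNgt; apply/negP => m1; apply: x0.
move: m1; case: px => // m' i j y z i0 pz m1.
by apply: H => //; apply: cup_product_gt0 pz _.
Qed.

(** A product with one factor ends in the unit class. Its cochain is that of the factor, because
    [front s l.+1] is all of [s] and the unit is 1 on the last vertex. *)
Lemma has_cup_product1 l : ~ acyclic A (with_empty X) l.+2 -> has_cup_product X A 1.
Proof.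
move=> na; have [c [cK nc]] : exists c : {set 'I_n} -> A,
    cocyc (with_empty X) l.+2 c /\ ~ cobdy (with_empty X) l.+2 c.
  apply: contrapT => no; apply: na => c cK; apply: contrapT => nc; apply: no.
  by exists c.
have fP : cochain_of X l.+1 c \in [pred h | delta h == 0].
  rewrite inE; apply/eqP/coval_inj => s; rewrite coval0.
  have [/andP[sX /eqP sk]|no] := boolP ((s \in X) && (#|s| == l.+3)).
    by rewrite coval_delta_of // cK // (with_emptyE _ sk).
  by rewrite coval_out.
pose f := Cocycle fP.
exists (l.+1 + 0)%N, (cup (cohom_class f) (cohomology1 X A)); split.
  by apply: cup_productS => //; apply: cup_product0.
rewrite cup_class => /cohom_class_eq0/coboundary_cobdy.
set g := coval _; move=> cg; apply: nc; move: cg; rewrite -/g => -[h hE].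
exists h => s sK sk; rewrite -hE //; last by rewrite sk -[in LHS](addn0 l).
have sX : s \in X by rewrite -(with_emptyE _ sk).
have ls : (l.+1 < #|s|)%N by rewrite sk.
rewrite /g [RHS](@coval_cup _ _ _ l.+1 0) ?addn0 //.
have -> : front s l.+1 = s.
  by apply/eqP; rewrite eqEcard front_sub /=; rewrite card_front ?sk.
have cb : #|back s l.+1| = 1%N by rewrite card_back sk subSnn.
have bX : back s l.+1 \in X.
  by rewrite (faces_sub sX) ?back_sub // -card_gt0 cb.
rewrite coval_of //.
have hb : (back s l.+1 \in X) && (#|back s l.+1| == 1%N) by rewrite bX cb.
rewrite -[back s l.+1]/(val (exist (fun t : {set 'I_n} => (t \in X) && (#|t| == 1%N)) _ hb
  : simplex X 0)).
by rewrite coval_simplex ffunE mulr1.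
Qed.

End CupLength.

Section CupLengthAas.
Variables (R : realType) (alpha : nat -> R).
Hypothesis alpha_gt0 : forall i, (0 < i)%N -> 0 < alpha i.
Hypothesis S1_neq1 : forall k, (0 < k)%N -> S1 k alpha <> 1.

Lemma S1_ge k : k.+1%:R * alpha 1 <= S1 k alpha.
Proof.
rewrite S1E big_ord_recl bin1 lerDl; apply: sumr_ge0 => i _.
by rewrite mulr_ge0 // ltW // alpha_gt0.
Qed.

(** [S1 k alpha] is at least [k.+1] times [alpha 1], so it is unbounded; [S1_neq1] makes the
    inequalities below the minimum strict. *)
Lemma critical_dimension : exists l, [/\ (0 < l)%N, 1 < S1 l alpha &
  forall j, (0 < j < l)%N -> S1 j alpha < 1].
Proof.
have a0 := alpha_gt0 (ltn0Sn 0).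
have [k kP] : exists k, (0 < k)%N && (1 < S1 k alpha).
  exists (Num.truncn (alpha 1)^-1).+1; rewrite /=.
  apply: lt_le_trans (S1_ge _).
  have : (alpha 1)^-1 < (Num.truncn (alpha 1)^-1).+1%:R by apply: truncnS_gt.
  rewrite -(ltr_pM2r a0) mulVf ?gt_eqF // => /lt_le_trans; apply.
  by rewrite ler_pM2r // ler_nat.
have ex : exists k, (0 < k)%N && (1 < S1 k alpha) by exists k.
case: (ex_minnP ex) => l /andP[l0 Sl] min; exists l; split=> // j /andP[j0 jl].
rewrite ltNge le_eqVlt; apply/negP => /orP[/eqP e|lt].
  exact: (S1_neq1 j0 (esym e)).
by have := min j; rewrite j0 lt /= leqNgt jl => /(_ isT).
Qed.

Lemma negl_cup_length_gt1 : negl alpha (fun n H => ~ cup_length_le (lower_complex H) rat 1).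
Proof.
have [l [l0 Sl Sj]] := critical_dimension.
have nb : negl alpha (fun n H => exists2 i, (i < l.-1)%N &
    ~ forall x : cohomology (lower_complex H) rat i.+1, x = 0).
  apply: negl_bigcup => // i il; apply: negl_rational_cohomology => //.
  by apply: Sj; rewrite /= -ltn_predRL.
apply: (negl_sub alpha_gt0 _ (neglU alpha_gt0 (aas_cup_eq0 alpha_gt0 l0 Sl) nb)).
apply: nearW => n H nl; apply: contrapT => /not_orP[/contrapT cup_eq nz].
apply: nl; apply: cup_length_le1 => i j x y i0 j0.
have van k (z : cohomology (lower_complex H) rat k) : (0 < k < l)%N -> z = 0.
  case: k z => // k z /= kl; apply: contrapT => z0; apply: nz; exists k.
    by rewrite -ltnS prednK.
  by move=> /(_ z).
have [il|il] := ltnP i l; first by rewrite (van i x) ?i0 // cup0l.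
have [jl|jl] := ltnP j l; first by rewrite (van j y) ?j0 // cup0r.
by apply: cup_eq => //; rewrite -addnn leq_add.
Qed.

End CupLengthAas.

(** * Non-vanishing in the critical degree *)

Section EulerBound.
Variables (F : fieldType) (n : nat) (K : {set {set 'I_n}}).
Local Notation T := 'I_n.
Implicit Types (s t : {set T}).

Definition faces_of_size m : {set {set T}} := [set s in K | #|s| == m].

Lemma dlt_sum (I : finType) (x : I -> F) (g : I -> {set T} -> F) s :
  dlt (fun t => \sum_i x i * g i t) s = \sum_i x i * dlt (g i) s.
Proof.
rewrite /dlt; under eq_bigr do rewrite mulr_sumr.
rewrite exchange_big; apply: eq_bigr => i _; rewrite mulr_sumr.
by apply: eq_bigr => v _; rewrite mulrCA.
Qed.

(** By exactness in the middle, the number of faces there is at most the sum of the ranks of the two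
    adjacent coboundary matrices, which the two neighbouring face numbers bound. *)
Lemma acyclic_fcount m : down K -> acyclic F K m.+1 ->
  (fcount K m.+1 <= fcount K m + fcount K m.+2)%N.
Proof.
move=> dK ac.
pose e k (i : 'I_#|faces_of_size k|) : {set T} := enum_val i.
have eP k (i : 'I_#|faces_of_size k|) : e k i \in K /\ #|e k i| = k.
  by have := enum_valP i; rewrite inE => /andP[? /eqP].
have eS k s : s \in K -> #|s| = k -> exists i, e k i = s.
  move=> sK sk; have sF : s \in faces_of_size k by rewrite inE sK sk eqxx.
  by exists (enum_rank_in sF s); rewrite /e enum_rankK_in.
pose ind s t : F := (t == s)%:R.
pose D k := \matrix_(i < #|faces_of_size k|, j < #|faces_of_size k.+1|) dlt (ind (e k i)) (e k.+1 j).
pose cf k (y : 'rV[F]_#|faces_of_size k|) t := \sum_i y 0 i * ind (e k i) t.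
have cfE k y i : cf k y (e k i) = y 0 i.
  rewrite /cf (bigD1 i) //= /ind eqxx mulr1 big1 ?addr0 // => i' ii'.
  by rewrite (inj_eq enum_val_inj) eq_sym (negPf ii') mulr0.
have DE k y j : (y *m D k) 0 j = dlt (cf k y) (e k.+1 j).
  by rewrite !mxE /cf dlt_sum; apply: eq_bigr => i _; rewrite mxE.
have ker : (kermx (D m.+1) <= D m)%MS.
  apply/row_subP => r; set y := row r _.
  have yD : y *m D m.+1 = 0 by rewrite /y -row_mul mulmx_ker row0.
  have [h hE] : cobdy K m.+1 (cf m.+1 y).
    apply: ac => s sK sm; have [j <-] := eS _ _ sK sm.
    by rewrite -DE yD mxE.
  apply/submxP; exists (\row_i h (e m i)); apply/rowP => j; rewrite DE.
  have [jK jm] := eP _ j; rewrite -cfE hE //; apply: eq_dlt => v vj.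
  have [i <-] : exists i, e m i = e m.+1 j :\ v.
    apply: eS; first by rewrite (dK _ _ jK) ?subD1set.
    by move: jm; rewrite (cardsD1 v (e m.+1 j)) vj add1n => -[].
  by rewrite cfE mxE.
have := mxrankS ker; rewrite mxrank_ker leq_subLR => le.
rewrite /fcount -!/(faces_of_size _); apply: (leq_trans le).
by rewrite addnC leq_add ?rank_leq_row ?rank_leq_col.
Qed.

End EulerBound.

Section FaceGrowth.
Variables (R : realType) (alpha : nat -> R).
Hypothesis alpha_gt0 : forall i, (0 < i)%N -> 0 < alpha i.

Lemma sum_codegree n (K : {set {set 'I_n}}) m : down K ->
  (m.+1 * fcount K m.+1 = \sum_(t in [set t in K | #|t| == m]) codegree K t)%N.
Proof.
move=> dK; transitivity (\sum_(s : {set 'I_n} | #|s| == m.+1) \sum_(v in s) (s \in K : nat))%N.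
  rewrite /fcount -sum1_card big_distrr /= big_mkcond [RHS]big_mkcond /=.
  apply: eq_bigr => s _; rewrite inE muln1; case: (s \in K) => /=; last first.
    by case: ifP => // _; rewrite big1.
  by case: ifP => // /eqP sm; rewrite sum1_card sm.
rewrite (sum_flags (V := nat)) big_mkcond [RHS]big_mkcond; apply: eq_bigr => t _.
rewrite inE; case: (boolP (t \in K)) => tK /=; last first.
  case: ifP => // _; apply: big1 => v vt; case: (boolP (_ \in K)) => // vK.
  by case/negP: tK; apply: dK vK (subsetUr _ _).
case: ifP => // _; rewrite /codegree -sum1_card big_mkcond [RHS]big_mkcond /=.
by apply: eq_bigr => v _; rewrite inE; case: (v \notin t) => //=; case: (_ \in K).
Qed.

Lemma fcount_grow n (H : {set {set 'I_n}}) k : ~ few_cofaces alpha k H ->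
  n%:R `^ (1 - S1 k alpha) / 8 * (fcount (facesH H) k.+1)%:R <=
  k.+2%:R * (fcount (facesH H) k.+2)%:R.
Proof.
move=> nf; have dK := @down_with_empty _ (lower_complex H).
rewrite -natrM sum_codegree // natr_sum mulrC mulr_natl -sumr_const.
apply: ler_sum => t; rewrite in_set => /andP[tK /eqP tk].
by rewrite leNgt; apply/negP => lt; apply: nf; exists t; split=> //; apply: ltW.
Qed.

(** The simplex is built one vertex at a time: joining a vertex to a face with [i.+1] vertices costs
    [S1 i alpha]. *)
Lemma powerset_weight n (s : {set 'I_n}) k : #|s| = k.+1 ->
  \sum_(i < k) S1 i alpha <= weight alpha (powerset s).
Proof.
elim: k s => [|k IH] s sk.
  rewrite big_ord0; apply: sumr_ge0 => t /andP[_ t1]; apply/ltW/alpha_gt0.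
  by rewrite -ltnS prednK // ltnW.
have /card_gt0P[v vs] : (0 < #|s|)%N by rewrite sk.
have ck : #|s :\ v| = k.+1 by apply/eqP; rewrite -eqSS -sk (cardsD1 v s) vs.
have vn : v \notin s :\ v by rewrite !inE eqxx.
have dT : down [set: {set 'I_n}] by move=> *; rewrite inE.
have iT (W : {set 'I_n}) : induced [set: {set 'I_n}] W = powerset W.
  by apply/setP => t; rewrite !inE.
have := weight_induced_setU1 alpha_gt0 dT (subxx (s :\ v)) vn (in_setT _) ck.
rewrite !iT setD1K //; apply: le_trans.
by rewrite big_ord_recr /= lerD2r; apply: IH.
Qed.

Lemma prob_face n (s : {set 'I_n}) : (0 < n)%N ->
  prob (@edge_prob R alpha n) (fun H => s \in facesH H) = n%:R `^ (- weight alpha (powerset s)).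
Proof.
move=> n0; rewrite -prob_weight //; apply: eq_Ex => H; congr (nat_of_bool _)%:R.
apply/asboolP/asboolP => [/facesHP sH|/subsetP sH].
  by apply/subsetP => t; rewrite !inE => /andP[ts t1]; apply: sH.
by apply/facesHP => t ts t1; apply: sH; rewrite !inE ts.
Qed.

Lemma E_fcount_le n m : (0 < n)%N ->
  Ex (@edge_prob R alpha n) (fun H => (fcount (facesH H) m.+1)%:R) <=
  n%:R `^ (m.+1%:R - \sum_(i < m) S1 i alpha).
Proof.
move=> n0; have e01 := @edge_prob01 _ _ alpha_gt0 n.
have -> : Ex (@edge_prob R alpha n) (fun H => (fcount (facesH H) m.+1)%:R) =
   \sum_(s : {set 'I_n} | #|s| == m.+1) prob (@edge_prob R alpha n) (fun H => s \in facesH H).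
  rewrite -Ex_sum; apply: eq_Ex => H; rewrite /fcount -sum1_card natr_sum.
  rewrite big_mkcond [RHS]big_mkcond; apply: eq_bigr => s _.
  rewrite in_set asboolb; case: (s \in facesH H); case: (#|s| == _) => //.
apply: (@le_trans _ _ (\sum_(s : {set 'I_n} | #|s| == m.+1) n%:R `^ (- \sum_(i < m) S1 i alpha))).
  apply: ler_sum => s /eqP sm; rewrite prob_face //.
  by apply: ler_powR; rewrite ?ler1n // lerN2 powerset_weight.
rewrite sumr_const -[leLHS]mulr_natl powRD ?pnatr_eq0 -?lt0n ?n0 ?implybT //.
rewrite ler_wpM2r ?powR_ge0 // powR_mulrn ?ler0n // -natrX ler_nat.
apply: leq_trans (bin_le_exp _ _); rewrite -[in X in (_ <= X)%N](card_ord n) -card_draws.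
by apply: subset_leq_card; apply/subsetP => s; rewrite !inE.
Qed.

End FaceGrowth.

Section NonVanishing.
Variables (R : realType) (alpha : nat -> R).
Hypothesis alpha_gt0 : forall i, (0 < i)%N -> 0 < alpha i.

(** The exponent of [n] in the expected number of [k]-dimensional faces. *)
Definition face_exponent k : R := k.+1%:R - \sum_(i < k) S1 i alpha.

Lemma face_exponentS k : face_exponent k.+1 = face_exponent k + (1 - S1 k alpha).
Proof. by rewrite /face_exponent big_ord_recr /= -[k.+2]addn1 natrD; ring. Qed.

Lemma fcount_lower n (H : {set {set 'I_n}}) l : (0 < n)%N ->
  (forall k, (k < l)%N -> ~ few_cofaces alpha k H) ->
  \prod_(i < l) (8 * i.+2%:R)^-1 * n%:R `^ face_exponent l <= (fcount (facesH H) l.+1)%:R.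
Proof.
move=> n0; elim: l => [|l IH] nf.
  rewrite big_ord0 mul1r /face_exponent big_ord0 subr0 powRr1 ?ler0n // ler_nat fcount1.
  rewrite -[leqLHS](card_ord n); apply: subset_leq_card; apply/subsetP => v _.
  by rewrite inE; apply/facesHP => t /subset_leq_card; rewrite cards1 leqNgt => /negPf ->.
have /IH{}IH : forall k, (k < l)%N -> ~ few_cofaces alpha k H by move=> k kl; apply: nf; exact: ltnW.
have := fcount_grow (nf l (ltnSn l)); set D := n%:R `^ _ => grow.
rewrite big_ord_recr /= face_exponentS powRD; last by rewrite pnatr_eq0 -lt0n n0 implybT.
rewrite -/D; have D0 : 0 <= D by apply: powR_ge0.
have l0 : 0 < 8 * l.+2%:R :> R by rewrite mulr_gt0.
move: grow IH; set P := \prod_(i < l) _; set X := _ `^ _.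
set F1 : R := (fcount _ l.+1)%:R; set F2 : R := (fcount _ l.+2)%:R => grow IH.
have l2 : 0 < l.+2%:R :> R by rewrite ltr0n.
have -> : P / (8 * l.+2%:R) * (X * D) = D / 8 * (P * X) / l.+2%:R.
  by field; rewrite lt0r_neq0.
rewrite ler_pdivrMr // mulrC (mulrC F2); apply: le_trans grow.
by rewrite mulrC ler_wpM2l // divr_ge0.
Qed.

Lemma near_nat_powR_le (C e eps : R) : 0 < e -> 0 < eps ->
  (\forall n \near \oo%classic, C * n%:R `^ (- e) <= eps).
Proof.
move=> e0 eps0; near=> n; apply: ltW; near: n.
exact: (cvgr_lt _ (cvg_nat_powR C e0) _ eps0).
Unshelve. all: by end_near.
Qed.

Lemma negl_acyclic l : (0 < l)%N -> 1 < S1 l alpha -> (forall k, (k < l)%N -> S1 k alpha < 1) ->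
  negl alpha (fun n H => acyclic rat (facesH H) l.+1).
Proof.
(* From degree [l] to [l.+1] the face exponent drops by [2 * d]; half of the drop separates the
   counts, the other half is spent on Markov's inequality. *)
move=> l0 Sl Sk; set d := (S1 l alpha - 1) / 2.
have d0 : 0 < d by rewrite divr_gt0 // subr_gt0.
pose x := face_exponent l.
pose many n (H : {set {set 'I_n}}) := n%:R `^ (x - d) <= (fcount (facesH H) l.+2)%:R.
have nmany : negl alpha (fun n H => many n H).
  apply: (negl_bound alpha_gt0 (@cvg_nat_powR _ 1 d d0)); near=> n.
  have n0 : (0 < n)%N by near: n; exact: nbhs_infty_gt.
  have nn0 : (0 : R) < n%:R by rewrite ltr0n.
  have e01 := @edge_prob01 _ _ alpha_gt0 n.
  apply: (@le_trans _ _ (Ex (@edge_prob R alpha n) (fun H => (n%:R `^ (x - d))^-1 *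
      (fcount (facesH H) l.+2)%:R))).
    apply: prob_markov => // H.
    by rewrite /many => le; rewrite mulrC ler_pdivlMr ?mul1r // powR_gt0.
  rewrite ExZ -powRN; apply: (@le_trans _ _ (n%:R `^ (- (x - d)) * n%:R `^ face_exponent l.+1)).
    by rewrite ler_wpM2l ?powR_ge0 // E_fcount_le.
  rewrite -powRD ?(gt_eqF nn0) ?implybT // mul1r; apply: ler_powR; first by rewrite ler1n.
  by rewrite face_exponentS /x /d; lra.
have nfew : negl alpha (fun n H => exists2 k, (k < l)%N & few_cofaces alpha k H).
  by apply: negl_bigcup => // k kl; apply: negl_few_cofaces => //; apply: Sk.
set c : R := \prod_(i < l) (8 * i.+2%:R)^-1.
have c0 : 0 < c by apply: prodr_gt0 => i _; rewrite invr_gt0 mulr_gt0.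
apply: (negl_sub alpha_gt0 _ (neglU alpha_gt0 nmany nfew)).
near=> n; move=> H ac; apply: contrapT => /not_orP[nm nf].
have n0 : (0 < n)%N by near: n; exact: nbhs_infty_gt.
have nn0 : (0 : R) < n%:R by rewrite ltr0n.
have dK := @down_with_empty _ (lower_complex H).
have nf' k : (k < l)%N -> ~ few_cofaces alpha k H by move=> kl fk; apply: nf; exists k.
have := fcount_lower n0 nf'; rewrite -/c -/x => lower.
have ll : (l.-1 < l)%N by rewrite prednK.
have := fcount_grow (nf' _ ll); rewrite prednK //.
have := acyclic_fcount dK ac; rewrite -(ler_nat R) natrD.
have : ~~ (n%:R `^ (x - d) <= (fcount (facesH H) l.+2)%:R) by apply/negP.
rewrite -ltNge; move: lower.
set F1 : R := (fcount _ l.+1)%:R; set F0 : R := (fcount _ l)%:R; set F2 : R := (fcount _ l.+2)%:R.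
have F00 : 0 <= F0 by rewrite ler0n.
have -> : n%:R `^ (x - d) = n%:R `^ x * n%:R `^ (- d).
  by rewrite -powRD // (gt_eqF nn0) implybT.
have X0 : 0 < n%:R `^ x by rewrite powR_gt0.
(* Both neighbouring face numbers are brought below a quarter of [F1]; the 32 below is 4 times the 8
   of [few_cofaces]. *)
have Dd : 1 * n%:R `^ (- d) <= c / 4.
  by near: n; apply: near_nat_powR_le => //; rewrite divr_gt0.
rewrite mul1r in Dd.
set D := n%:R `^ (1 - S1 l.-1 alpha).
have D0 : 0 < D by rewrite powR_gt0.
have DD : 1 * n%:R `^ (- (1 - S1 l.-1 alpha)) <= (32 * l.+1%:R)^-1.
  near: n; apply: near_nat_powR_le; last by rewrite invr_gt0 mulr_gt0.
  by rewrite subr_gt0 Sk // prednK.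
rewrite mul1r powRN lef_pV2 ?posrE ?mulr_gt0 // in DD.
set b : R := l.+1%:R in DD *; have b0 : 0 < b by rewrite ltr0n.
move=> lower F2lt acl grow.
have F2le : F2 <= F1 / 4.
  apply: (le_trans (ltW F2lt)); apply: (@le_trans _ _ (n%:R `^ x * (c / 4))).
    by rewrite ler_wpM2l // ltW.
  by rewrite mulrA ler_wpM2r ?invr_ge0 // mulrC.
have F0le : F0 <= F1 / 4.
  have : b * (4 * F0) <= b * F1.
    apply: le_trans grow; rewrite -/D.
    have -> : D / 8 * F0 = D * F0 / 8 by ring.
    rewrite ler_pdivlMr //; have -> : b * (4 * F0) * 8 = 32 * b * F0 by ring.
    by rewrite ler_wpM2r.
  by rewrite ler_pM2l // => h; lra.
have F1p : 0 < F1 by apply: lt_le_trans lower; rewrite mulr_gt0.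
by lra.
Unshelve. all: by end_near.
Qed.

End NonVanishing.

(** * Cycles in the critical random graph *)

Section Cycles.
Variable (T : finType).
Implicit Types (w : seq T) (x y : T) (V : {set T}) (E : {set {set T}}).

Definition cycle_edge w x : {set T} := [set x; next w x].

Definition cycle_edges w : {set {set T}} := [set cycle_edge w x | x in w].

Definition support w : {set T} := [set x in w].

Lemma next_distinct w x : uniq w -> (2 < size w)%N -> x \in w ->
  next w x != x /\ next w (next w x) != x.
Proof.
move=> uw sw xw; case: (rot_to xw) => i s e.
have us : uniq (x :: s) by rewrite -e rot_uniq.
have ss : (2 < size (x :: s))%N by rewrite -e size_rot.
rewrite -!(next_rot i uw) e.
case: s us ss {e} => [|y [|z s]] //= /andP[xyz /andP[yz _]] _.
rewrite eqxx; move: xyz; rewrite !inE !negb_or => /and3P[xy xz _].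
by rewrite (eq_sym y) (negPf xy) eqxx (eq_sym z) xz.
Qed.

Lemma cycle_edge_inj w : uniq w -> (2 < size w)%N -> {in w &, injective (cycle_edge w)}.
Proof.
move=> uw sw x y xw yw e; have [_ ny] := next_distinct uw sw yw.
have : x \in cycle_edge w y by rewrite -e set21.
rewrite !inE => /orP[/eqP //|/eqP xy].
have : y \in cycle_edge w x by rewrite e set21.
by rewrite !inE => /orP[/eqP //|/eqP yx]; rewrite -xy -yx eqxx in ny.
Qed.

Lemma card_cycle_edges w : uniq w -> (2 < size w)%N -> #|cycle_edges w| = size w.
Proof.
by move=> uw sw; rewrite card_in_imset ?(card_uniqP uw) //; exact: cycle_edge_inj.
Qed.

Lemma card_support w : uniq w -> #|support w| = size w.
Proof. by move=> uw; rewrite cardsE; apply/card_uniqP. Qed.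

Lemma cycle_edges_sub w e : e \in cycle_edges w -> e \subset support w.
Proof.
case/imsetP => x xw ->; rewrite subUset !sub1set !inE.
by rewrite mem_next xw.
Qed.

Lemma card_cycle_edge w e : uniq w -> (2 < size w)%N -> e \in cycle_edges w -> #|e| = 2%N.
Proof.
move=> uw sw /imsetP[x xw ->]; have [nx _] := next_distinct uw sw xw.
by rewrite cards2 eq_sym nx.
Qed.

Lemma iter_next w x y : uniq w -> x \in w -> y \in w -> exists m, y = iter m (next w) x.
Proof.
move=> uw xw yw; have := fconnect_cycle (cycle_next uw) xw y.
by rewrite yw => c; exists (findex (next w) x y); rewrite iter_findex.
Qed.

(** Each vertex of the cycle outside [V] starts an edge not in [E], and so does one vertex inside
    [V]: where the cycle leaves [V], or, if it never does, at an edge missing from [E]. Edges are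
    determined by their starting points. *)
Lemma new_cycle_edges w V E x0 : uniq w -> (2 < size w)%N -> x0 \in w -> x0 \in V ->
  (forall e, e \in E -> e \subset V) -> ~~ (cycle_edges w \subset E) ->
  (#|support w :\: V| < #|cycle_edges w :\: E|)%N.
Proof.
move=> uw sw x0w x0V EV wE.
have [x [xw xV xE]] : exists x, [/\ x \in w, x \in V & cycle_edge w x \notin E].
  have [wV|wV] := boolP (support w \subset V).
    case/subsetPn: wE => e /imsetP[x xw ->] xE; exists x; split=> //.
    by apply: (subsetP wV); rewrite inE.
  apply: contrapT => no; case/subsetPn: wV => y; rewrite inE => yw /negP; apply.
  have [m ->] := iter_next uw x0w yw.
  suff : iter m (next w) x0 \in V /\ iter m (next w) x0 \in w by case.
  elim: m => [//|m [mV mw]] /=; split; last by rewrite mem_next.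
  apply: contrapT => /negP nV; apply: no; exists (iter m (next w) x0); split=> //.
  apply: contra nV => /EV /subsetP; apply; exact: set22.
pose B := x |: (support w :\: V).
have Bw : {subset B <= w} by move=> y; rewrite !inE => /orP[/eqP ->|/andP[]].
have cB : #|B| = #|support w :\: V|.+1 by rewrite cardsU1 !inE xV.
rewrite -cB -(card_in_imset (f := cycle_edge w)); last first.
  by move=> y z /Bw yw /Bw zw; apply: cycle_edge_inj.
apply: subset_leq_card; apply/subsetP => _ /imsetP[y yB ->].
rewrite inE imset_f ?Bw // andbT; move: yB; rewrite !inE => /orP[/eqP -> //|/andP[yV _]].
by apply: contra yV => /EV /subsetP; apply; exact: set21.
Qed.

(** Two different cycles sharing an edge span more edges than vertices; such pairs are rarer by a
    factor [1 / n] than their number of vertices suggests. *)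
Lemma card_union_edges w w' : uniq w -> (2 < size w)%N -> uniq w' -> (2 < size w')%N ->
  cycle_edges w :&: cycle_edges w' != set0 -> cycle_edges w != cycle_edges w' ->
  (#|support w :|: support w'| < #|cycle_edges w :|: cycle_edges w'|)%N.
Proof.
wlog nE : w w' / ~~ (cycle_edges w' \subset cycle_edges w).
  move=> H uw sw uw' sw' ne0 ne.
  have [s|s] := boolP (cycle_edges w' \subset cycle_edges w); last exact: H.
  rewrite setUC [X in (_ < #|pred_of_set X|)%N]setUC; apply: H => //.
  - by apply: contra ne => s'; rewrite eqEsubset s' s.
  - by rewrite setIC.
  - by rewrite eq_sym.
move=> uw sw uw' sw' /set0Pn[e]; rewrite inE => /andP[ew ew'] _.
have [x0 xe] : exists x, x \in e.
  by case/imsetP: ew => x _ ->; exists x; rewrite set21.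
have x0w : x0 \in support w by apply: (subsetP (cycle_edges_sub ew)).
have x0w' : x0 \in w'.
  by have := subsetP (cycle_edges_sub ew') _ xe; rewrite inE.
have := new_cycle_edges uw' sw' x0w' x0w (@cycle_edges_sub w) nE.
have cU (S : finType) (A B : {set S}) : #|A :|: B| = (#|A| + #|B :\: A|)%N.
  by rewrite -(cardsID A (A :|: B)) (setIidPr (subsetUl A B)) setDUl setDv set0U.
by rewrite !cU card_support // card_cycle_edges // ltn_add2l.
Qed.

Lemma next_neighbour w w' x : uniq w -> uniq w' -> cycle_edges w = cycle_edges w' ->
  x \in w' -> next w' x = next w x \/ next w' x = prev w x.
Proof.
move=> uw uw' e xw'; have : cycle_edge w' x \in cycle_edges w by rewrite e imset_f.
case/imsetP => y yw ey.
have := set21 x (next w' x); rewrite -/(cycle_edge w' x) ey !inE => /orP[/eqP xy|/eqP xy].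
  subst y; have := set22 x (next w' x); rewrite -/(cycle_edge w' x) ey !inE.
  case/orP => /eqP; last by left.
  move=> nx; left; have := set22 x (next w x); rewrite -/(cycle_edge w x) -ey !inE nx.
  by rewrite orbb => /eqP.
right; have py : prev w x = y by rewrite xy prev_next.
rewrite py; have := set22 x (next w' x); rewrite -/(cycle_edge w' x) ey !inE -xy.
case/orP => /eqP // nx; have : y \in cycle_edge w' x by rewrite ey set21.
by rewrite !inE nx orbb => /eqP.
Qed.

Lemma behead_traject a (s : seq T) : uniq (a :: s) ->
  s = traject (next (a :: s)) (next (a :: s) a) (size s).
Proof.
move=> us; have /= := cycle_next us; rewrite rcons_path => /andP[/fpathP[m e] _].
by rewrite {1}e -[X in traject _ _ X](size_traject (next (a :: s)) (next (a :: s) a)) -e.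
Qed.

(** The next vertex is one of the two neighbours on the common cycle, and from the second step on it
    cannot be the vertex just left. *)
Lemma cycle_determined a (s s' : seq T) : uniq (a :: s) -> uniq (a :: s') ->
  (1 < size s)%N -> size s = size s' -> cycle_edges (a :: s) = cycle_edges (a :: s') ->
  next (a :: s) a = next (a :: s') a -> s = s'.
Proof.
move=> us us' s1 ss e ea; rewrite (behead_traject us) (behead_traject us') -ss.
set f := next _ in ea *; set g := next (a :: s') in ea *.
have it m : iter m f a = iter m g a /\ f (iter m f a) = g (iter m g a).
  elim: m => [//|m [xE IH]]; split=> //=; rewrite -IH; set x := iter m f a in IH xE *.
  have xs : x \in a :: s by rewrite /x; elim: (m) => [|k h] /=; rewrite ?mem_head ?mem_next.
  have fxs : f x \in a :: s' by rewrite IH mem_next; elim: (m) => [|k h] /=; rewrite ?mem_head ?mem_next.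
  have s1' : (2 < size (a :: s'))%N by rewrite /= -ss.
  have [h|h] := next_neighbour us us' e fxs; first exact/esym.
  have gx : g (f x) = x by rewrite /g h prev_next.
  have ys : iter m g a \in a :: s' by move: fxs; rewrite IH mem_next.
  by have [_] := next_distinct us' s1' ys; rewrite -/g -IH gx xE eqxx.
apply: (@eq_from_nth _ (f a)); rewrite ?size_traject // => i ilt.
by rewrite ea !nth_traject // -{1}ea -!iterSr; have [] := it i.+1.
Qed.

Lemma support_cover w : uniq w -> support w = cover (cycle_edges w).
Proof.
move=> uw; apply/eqP; rewrite eqEsubset; apply/andP; split.
  apply/subsetP => x; rewrite inE => xw; apply/bigcupP.
  by exists (cycle_edge w x); rewrite ?imset_f // set21.
by apply/bigcupsP => e; apply: cycle_edges_sub.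
Qed.

(** The first vertex, with [k] choices, and agreement with the orientation of [w] there determine
    the sequence. *)
Lemma cycle_fibre w k : uniq w -> size w = k -> (2 < k)%N ->
  (#|[set t : k.-tuple T | uniq t & cycle_edges t == cycle_edges w]| <= k * 2)%N.
Proof.
move=> uw sw k2; have [x0 x0w] : exists x, x \in w.
  by case: (w) sw k2 => [<- //|x r _ _]; exists x; rewrite mem_head.
pose f (t : k.-tuple T) := (head x0 t, next t (head x0 t) == next w (head x0 t)).
have <- : #|setX (support w) [set: bool]| = (k * 2)%N.
  by rewrite cardsX cardsT card_bool card_support // sw.
have key (t : k.-tuple T) : t \in [set t : k.-tuple T | uniq t & cycle_edges t == cycle_edges w] ->
    exists a s, [/\ tval t = a :: s, size (a :: s) = k, uniq (a :: s), a \in w &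
                 cycle_edges (a :: s) = cycle_edges w].
  rewrite inE => /andP[ut /eqP et]; have st := size_tuple t.
  case: (tval t) ut et st => [|a s] ut et st; first by rewrite -st in k2.
  exists a, s; split=> //.
  have : a \in support w by rewrite (support_cover uw) -et -support_cover // inE mem_head.
  by rewrite inE.
have fE (t : k.-tuple T) a s : tval t = a :: s -> f t = (a, next (a :: s) a == next w a).
  by move=> e; rewrite /f e.
rewrite -(card_in_imset (f := f)); last first.
  move=> t1 t2 /key[a [s1 [e1 z1 u1 aw E1]]] /key[b [s2 [e2 z2 u2 bw E2]]].
  rewrite (fE _ _ _ e1) (fE _ _ _ e2) => /pair_equal_spec[ab ee]; subst b.
  apply/val_inj; rewrite /= e1 e2; congr cons.
  apply: (@cycle_determined a) => //; last first.
  - have [h1|h1] := next_neighbour uw u1 (esym E1) (mem_head a s1);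
    have [h2|h2] := next_neighbour uw u2 (esym E2) (mem_head a s2).
    + by rewrite h1 h2.
    + by move: ee; rewrite h1 eqxx => /esym/eqP ->.
    + by move: ee; rewrite h2 eqxx => /eqP ->.
    + by rewrite h1 h2.
  - by rewrite E1 E2.
  - by apply/eqP; rewrite -eqSS; apply/eqP; rewrite -/(size (a :: s1)) -/(size (a :: s2)) z1.
  - by rewrite -ltnS -/(size (a :: s1)) z1.
apply: subset_leq_card; apply/subsetP => _ /imsetP[t /key[a [s [e _ _ aw _]]] ->].
by rewrite (fE _ _ _ e) !inE /= aw.
Qed.

End Cycles.

Section CycleCohomology.
Variables (A : nzRingType) (n : nat) (K : {set {set 'I_n}}).

Lemma dlt_edge (h : {set 'I_n} -> A) (x y : 'I_n) : x != y ->
  (dlt h [set x; y] == 0) = (h [set y] == h [set x]).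
Proof.
move=> xy; have yx : x \notin [set y] by rewrite inE.
have v0 : vrank (set0 : {set 'I_n}) x = 0%N.
  by apply/eqP; rewrite cards_eq0 -subset0; apply/subsetP => w; rewrite !inE.
have v1 : vrank [set y] y = 0%N.
  apply/eqP; rewrite cards_eq0 -subset0; apply/subsetP => w; rewrite !inE => /andP[/eqP ->].
  by rewrite ltnn.
by rewrite -slice_eq0 slice_dlt // /dlt big_set1 /slice setDv v0 v1 !expr0 !mul1r setU0 subr_eq0.
Qed.

(** Without triangles the indicator of one edge of the cycle is a cocycle. A primitive would be
    constant along the rest of the cycle, hence have equal values at the two ends of that edge. *)
Lemma cycle_not_acyclic w : uniq w -> (2 < size w)%N -> cycle_edges w \subset K ->
  fcount K 3 = 0%N -> ~ acyclic A K 2.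
Proof.
move=> uw sw wK /eqP; rewrite cards_eq0 => /eqP K3.
have [a aw] : exists a, a \in w by case: (w) sw => // a s _; exists a; rewrite mem_head.
set z := prev w a; have zw : z \in w by rewrite mem_prev.
have za : next w z = a by apply: next_prev.
move=> /(_ (fun t => (t == cycle_edge w z)%:R)) [s sK s3|h hE].
  have : s \in [set s in K | #|s| == 3]; last by rewrite K3 inE.
  by rewrite inE sK s3 eqxx.
have edge x : x \in w -> (h [set next w x] == h [set x]) = (x != z).
  move=> xw; have [nx _] := next_distinct uw sw xw.
  rewrite -dlt_edge 1?eq_sym // -/(cycle_edge w x) -hE; first last.
  - exact: card_cycle_edge uw sw (imset_f _ xw).
  - exact: subsetP wK _ (imset_f _ xw).
  rewrite (inj_in_eq (cycle_edge_inj uw sw)) //.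
  by case: (x == z); rewrite ?mulr0n ?mulr1n ?eqxx // eq_sym (negPf (oner_neq0 A)).
have : h [set a] == h [set z].
  have [m ->] := iter_next uw aw zw.
  suff [/eqP <- //] : h [set iter m (next w) a] == h [set a] /\ iter m (next w) a \in w by [].
  elim: m => [|m [/eqP ha mw]]; first by rewrite eqxx.
  rewrite iterS mem_next; split=> //; case: (eqVneq (iter m (next w) a) z) => [->|ne].
    by rewrite za.
  by rewrite -ha edge.
by rewrite -{1}za edge // eqxx.
Qed.

End CycleCohomology.

(** * The second moment of the number of cycles *)

Section SecondMoment.
Variables (R : realType) (I : finType) (P : I -> R).
Hypothesis P01 : forall i, 0 <= P i <= 1.
Local Notation E := (Ex P).

(** Chebyshev's inequality: if no [D j] with non-zero weight is present, the weighted count is 0 and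
    misses its mean by the whole mean. *)
Lemma second_moment (J : finType) (a : J -> R) (D : J -> {set I}) (K : R) :
  let q j := \prod_(i in D j) P i in
  \sum_i \sum_j a i * a j * \prod_(e in D i :|: D j) P e <= (\sum_j a j * q j) ^+ 2 + K ->
  (\sum_j a j * q j) ^+ 2 * prob P (fun H => forall j, a j != 0 -> ~~ (D j \subset H)) <= K.
Proof.
move=> q; set mu := \sum_j a j * q j => le.
pose Y (H : {set I}) : R := \sum_j a j * (D j \subset H)%:R.
have EY : E Y = mu.
  by rewrite /Y Ex_sum; apply: eq_bigr => j _; rewrite ExZ Ex_subset.
have EY2 : E (fun H => Y H ^+ 2) <= mu ^+ 2 + K.
  apply: le_trans le; rewrite le_eqVlt; apply/orP; left; apply/eqP.
  transitivity (E (fun H => \sum_i \sum_j a i * a j * (D i :|: D j \subset H)%:R)).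
    apply: eq_Ex => H; rewrite /Y expr2 mulr_suml; apply: eq_bigr => i _.
    rewrite mulr_sumr; apply: eq_bigr => j _; rewrite subUset mulrACA -natrM mulnb //.
  rewrite Ex_sum; apply: eq_bigr => i _; rewrite Ex_sum; apply: eq_bigr => j _.
  by rewrite ExZ Ex_subset.
have var : E (fun H => (Y H - mu) ^+ 2) <= K.
  have -> : E (fun H => (Y H - mu) ^+ 2) = E (fun H => Y H ^+ 2) - mu ^+ 2.
    rewrite (@eq_Ex _ _ _ _ (fun H => Y H ^+ 2 + ((- 2 * mu) * Y H + mu ^+ 2))); last first.
      by move=> H; ring.
    by rewrite !ExD ExZ Ex_cst // EY; ring.
  by rewrite lerBlDl.
apply: le_trans var; rewrite /prob -ExZ; apply: le_Ex => // H.
case: asboolP => [no|_]; last by rewrite mulr0 sqr_ge0.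
rewrite mulr1 /Y big1 ?sub0r ?sqrrN // => j _.
by have [->|/no/negPf ->] := eqVneq (a j) 0; rewrite ?mul0r ?mulr0.
Qed.

End SecondMoment.

Section TupleSums.
Variables (R : realType) (I : finType).

Lemma sum_tuples k (F : seq I -> R) : \sum_(t : k.-tuple I) F t = sum_seqs k F.
Proof.
elim: k F => [|k IH] F /=.
  by rewrite (big_pred1 [tuple]) // => t; apply/esym/eqP/tuple0.
under [RHS]eq_bigr do rewrite -IH.
rewrite pair_bigA /= (reindex (fun p : I * k.-tuple I => [tuple of p.1 :: p.2])) //=.
exists (fun t : k.+1.-tuple I => (thead t, [tuple of behead t])) => [[x t] _|t _] /=.
  by congr pair; apply: val_inj.
by rewrite -tuple_eta.
Qed.

Lemma sum_seqs_cat k m (F : seq I -> R) :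
  sum_seqs k (fun s => sum_seqs m (fun s' => F (s ++ s'))) = sum_seqs (k + m) F.
Proof. by elim: k F => //= k IH F; apply: eq_bigr => x _; rewrite -IH. Qed.

Lemma distinctE (s : seq I) : distinct s = #|support s|.
Proof.
rewrite /distinct -(card_uniqP (undup_uniq s)); apply: eq_card => x.
by rewrite mem_undup inE.
Qed.

End TupleSums.

(** The estimate [n ^_ k >= n ^ k * (1 - k ^ 2 / n)], cleared of division and subtraction. *)
Lemma ffact_lower n k : (n ^ k.+1 <= n * n ^_ k + k ^ 2 * n ^ k)%N.
Proof.
elim: k => [|k IH]; first by rewrite expn1 ffactn0 muln1 leq_addr.
rewrite [in leqLHS]expnS; apply: (@leq_trans (n * (n * n ^_ k + k ^ 2 * n ^ k))).
  by rewrite leq_mul2l IH orbT.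
have ffle : (n ^_ k <= n ^ k)%N.
  by elim: (k) => // j jh; rewrite ffactnSr expnSr leq_mul // leq_subr.
have nf : (n * n ^_ k <= n ^_ k.+1 + k * n ^_ k)%N.
  by rewrite ffactnSr [(_ ^_ _ * _)%N]mulnC -mulnDl leq_mul2r addnC -leq_subLR leqnn orbT.
rewrite mulnDr; apply: (@leq_trans (n * (n ^_ k.+1 + k * n ^_ k) + n * (k ^ 2 * n ^ k))).
  by rewrite leq_add2r leq_mul2l nf orbT.
rewrite mulnDr -addnA leq_add2l (expnS n k).
apply: (@leq_trans (n * (k * n ^ k) + n * (k ^ 2 * n ^ k))).
  by rewrite leq_add2r !leq_mul2l ffle !orbT.
have -> : (n * (k * n ^ k) + n * (k ^ 2 * n ^ k) = (k + k ^ 2) * (n * n ^ k))%N by ring.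
by rewrite leq_mul2r; apply/orP; right; rewrite -!mulnn; lia.
Qed.

Section CycleMoments.
Variables (R : realType) (n L : nat).
Hypothesis n0 : (0 < n)%N.
Local Notation T := 'I_n.
Local Notation J := {k : 'I_L.+1 & k.-tuple T}.
Local Notation y := (n%:R^-1 : R).
Implicit Types (w : seq T) (j : J).

Definition is_cycle w := uniq w && (2 < size w)%N.

(* Each cycle of length k underlies 2k sequences, so these weights count it twice. *)
Definition cycle_weight w : R := if is_cycle w then (size w)%:R^-1 else 0.

Definition seq_of j : seq T := tagged j.

Definition cycle_mean : R := \sum_j cycle_weight (seq_of j) * y ^+ #|cycle_edges (seq_of j)|.

(** The factorials are those of [sum_seqs_distinct], applied to the concatenation of two
    sequences. *)
Definition overlap_bound : nat := \sum_(k < L.+1) \sum_(m < L.+1) (k + m)`!.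

Lemma sum_cycle_index (F : seq T -> R) : \sum_j F (seq_of j) = \sum_(k < L.+1) sum_seqs k F.
Proof.
under [RHS]eq_bigr do rewrite -sum_tuples.
by rewrite (sig_big_dep (fun=> true) (fun _ _ => true) (fun (k : 'I_L.+1) (t : k.-tuple T) => F t)).
Qed.

Lemma invn01 : 0 <= y <= 1.
Proof. by rewrite invr_ge0 ler0n invf_le1 ?ler1n ?ltr0n. Qed.

Lemma cycle_weight01 w : 0 <= cycle_weight w <= 1.
Proof.
rewrite /cycle_weight; case: ifP => [/andP[_ w2]|_]; last by rewrite lexx ler01.
by rewrite invr_ge0 ler0n invf_le1 ?ler1n ?ltr0n // (ltn_trans _ w2).
Qed.

Lemma sum_overlaps : \sum_(i : J) \sum_(j : J) y ^+ (#|support (seq_of i) :|: support (seq_of j)|.+1)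
  <= overlap_bound%:R * y.
Proof.
have -> : \sum_(i : J) \sum_(j : J) y ^+ (#|support (seq_of i) :|: support (seq_of j)|.+1) =
   \sum_(k < L.+1) \sum_(m < L.+1) y * sum_seqs (k + m) (fun s : seq T => y ^+ distinct s).
  transitivity (\sum_(i : J) \sum_(m < L.+1)
      sum_seqs m (fun s => y * y ^+ distinct (seq_of i ++ s))).
    apply: eq_bigr => i _; rewrite -sum_cycle_index; apply: eq_bigr => j _.
    rewrite exprS distinctE; congr (_ * _ ^+ _); apply: eq_card => x.
    by rewrite !inE mem_cat.
  rewrite (sum_cycle_index (fun s => \sum_(m < L.+1) sum_seqs m (fun s' => y * y ^+ distinct (s ++ s')))).
  apply: eq_bigr => k _; rewrite sum_seqs_sum; apply: eq_bigr => m _.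
  by rewrite (sum_seqs_cat k m (fun s => y * y ^+ distinct s)) sum_seqsZ.
rewrite /overlap_bound natr_sum mulr_suml; apply: ler_sum => k _.
rewrite natr_sum mulr_suml; apply: ler_sum => m _.
have := @sum_seqs_distinct R T (k + m); rewrite card_ord => /(_ n0) le.
by rewrite mulrC ler_wpM2r // invr_ge0.
Qed.

Lemma sum_same_edges w : is_cycle w ->
  \sum_j cycle_weight (seq_of j) * (cycle_edges w == cycle_edges (seq_of j))%:R <= 2.
Proof.
move=> /andP[uw w2].
rewrite (sum_cycle_index (fun s => cycle_weight s * (cycle_edges w == cycle_edges s)%:R)).
have out k : k <> size w -> sum_seqs k (fun s => cycle_weight s * (cycle_edges w == cycle_edges s)%:R) = 0.
  move=> kw; rewrite -sum_tuples big1 // => t _; rewrite /cycle_weight.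
  case: ifP => [/andP[ut t2]|_]; last by rewrite mul0r.
  case: eqP => [e|_]; last by rewrite mulr0.
  by case: kw; rewrite -(size_tuple t) -(card_cycle_edges ut t2) -e card_cycle_edges.
have [wL|wL] := ltnP (size w) L.+1; last first.
  by rewrite big1 ?ler0n // => k _; apply: out => e; rewrite -e ltnNge -ltnS ltn_ord in wL.
rewrite (bigD1 (Ordinal wL)) //= big1 ?addr0; last first.
  by move=> k /eqP kw; apply: out => e; apply: kw; apply: val_inj.
rewrite -sum_tuples.
apply: (@le_trans _ _ (\sum_(t : (size w).-tuple T | t \in [set t : (size w).-tuple T |
   uniq t & cycle_edges t == cycle_edges w]) (size w)%:R^-1)).
  rewrite [leRHS]big_mkcond; apply: ler_sum => t _; rewrite inE /cycle_weight /is_cycle size_tuple.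
  by case: (uniq t); rewrite ?mul0r //= w2 eq_sym; case: eqP; rewrite ?mulr0 ?mulr1.
rewrite sumr_const -[leLHS]mulr_natr mulrC ler_pdivrMr ?ltr0n ?(ltn_trans _ w2) //.
by rewrite -natrM ler_nat mulnC cycle_fibre.
Qed.

(** The three terms cover pairs without a common edge, pairs with the same edges, and the remaining
    pairs, for which [card_union_edges] applies. *)
Lemma cycle_pairs w w' : cycle_weight w * cycle_weight w' * y ^+ #|cycle_edges w :|: cycle_edges w'| <=
  (cycle_weight w * y ^+ #|cycle_edges w|) * (cycle_weight w' * y ^+ #|cycle_edges w'|) +
  (cycle_weight w * y ^+ #|cycle_edges w|) * (cycle_weight w' * (cycle_edges w == cycle_edges w')%:R) +
  y ^+ (#|support w :|: support w'|.+1).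
Proof.
have /andP[y0 y1] := invn01.
have /andP[a0 a1] := cycle_weight01 w; have /andP[b0 b1] := cycle_weight01 w'.
have nn (m : nat) : 0 <= y ^+ m by rewrite exprn_ge0.
have rhs0 : 0 <= (cycle_weight w * y ^+ #|cycle_edges w|) *
    (cycle_weight w' * (cycle_edges w == cycle_edges w')%:R).
  by rewrite !mulr_ge0 ?ler0n.
have [cw|cw] := boolP (is_cycle w); last by rewrite /cycle_weight (negPf cw) !mul0r !add0r nn.
have [cw'|cw'] := boolP (is_cycle w').
  have /andP[uw w2] := cw; have /andP[uw' w2'] := cw'.
  have [dis|ndis] := eqVneq (cycle_edges w :&: cycle_edges w') set0.
    rewrite cardsU dis cards0 subn0 exprD -addrA ler_wpDr ?addr_ge0 //.
    by rewrite le_eqVlt mulrACA eqxx.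
  have [e|ne] := eqVneq (cycle_edges w) (cycle_edges w').
    rewrite -e setUid mulr1 -addrA addrCA ler_wpDr //.
      by rewrite addr_ge0 // !mulr_ge0.
    by rewrite le_eqVlt mulrAC eqxx.
  rewrite -[leLHS]add0r lerD //.
    by rewrite mulr0 mulr0 addr0 !mulr_ge0.
  apply: (@le_trans _ _ (1 * y ^+ #|cycle_edges w :|: cycle_edges w'|)).
    by rewrite ler_wpM2r // mulr_ile1.
  by rewrite mul1r ler_wiXn2l // card_union_edges.
by rewrite [cycle_weight w']/cycle_weight (negPf cw') !(mul0r, mulr0) !add0r nn.
Qed.

Lemma cycle_second_moment :
  \sum_(i : J) \sum_(j : J) cycle_weight (seq_of i) * cycle_weight (seq_of j) *
     y ^+ #|cycle_edges (seq_of i) :|: cycle_edges (seq_of j)| <=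
  cycle_mean ^+ 2 + (2 * cycle_mean + overlap_bound%:R * y).
Proof.
have /andP[y0 y1] := invn01.
apply: (@le_trans _ _ (\sum_(i : J) \sum_(j : J) (
  (cycle_weight (seq_of i) * y ^+ #|cycle_edges (seq_of i)|) *
    (cycle_weight (seq_of j) * y ^+ #|cycle_edges (seq_of j)|) +
  (cycle_weight (seq_of i) * y ^+ #|cycle_edges (seq_of i)|) *
    (cycle_weight (seq_of j) * (cycle_edges (seq_of i) == cycle_edges (seq_of j))%:R) +
  y ^+ (#|support (seq_of i) :|: support (seq_of j)|.+1)))).
  by apply: ler_sum => i _; apply: ler_sum => j _; apply: cycle_pairs.
under eq_bigr do rewrite !big_split /= -!mulr_sumr.
rewrite !big_split /= -!mulr_suml addrA lerD ?sum_overlaps // lerD ?expr2 //.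
rewrite /cycle_mean mulr_sumr; apply: ler_sum => i _.
rewrite mulrC; have [c|c] := boolP (is_cycle (seq_of i)).
  apply: ler_wpM2r; last exact: sum_same_edges.
  by rewrite mulr_ge0 ?exprn_ge0 //; have /andP[] := cycle_weight01 (seq_of i).
by rewrite /cycle_weight (negPf c) !(mul0r, mulr0).
Qed.

(** For [n >= 2 * L ^ 2], at least half of the sequences of length [k <= L] are injective; this is
    the factor 2. *)
Lemma cycle_mean_ge : (2 * L ^ 2 <= n)%N ->
  \sum_(k < L.+1 | (2 < k)%N) (2 * k%:R)^-1 <= cycle_mean.
Proof.
move=> nL; rewrite /cycle_mean (sum_cycle_index (fun s => cycle_weight s * y ^+ #|cycle_edges s|)).
rewrite big_mkcond; apply: ler_sum => k _; rewrite -sum_tuples; case: ifP => k2; last first.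
  apply: sumr_ge0 => t _; rewrite mulr_ge0 ?exprn_ge0 ?invr_ge0 //.
  by have /andP[] := cycle_weight01 t.
have -> : \sum_(t : k.-tuple T) cycle_weight t * y ^+ #|cycle_edges t| =
    \sum_(t in [set t : k.-tuple T | all predT t & uniq t]) k%:R^-1 * y ^+ k.
  rewrite [RHS]big_mkcond; apply: eq_bigr => t _; rewrite inE all_predT.
  rewrite /cycle_weight /is_cycle size_tuple k2 andbT.
  case: ifP => ut; rewrite ?mul0r // card_cycle_edges ?size_tuple //.
rewrite sumr_const card_uniq_tuples card_ord -[leRHS]mulr_natl.
have k0 : 0 < k%:R :> R by rewrite ltr0n (ltn_trans _ k2).
have nn0 : 0 < n%:R :> R by rewrite ltr0n.
rewrite invfM mulrC [leRHS]mulrCA ler_wpM2l ?invr_ge0 ?(ltW k0) //.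
rewrite exprVn ler_pdivlMr ?exprn_gt0 // mulrC ler_pdivrMr // -natrX -natrM ler_nat.
have := ffact_lower n k.
have kL : (k <= L)%N by rewrite -ltnS.
have : (2 * (k ^ 2 * n ^ k) <= n * n ^ k)%N.
  rewrite mulnA leq_mul2r (leq_trans _ nL) ?orbT // leq_mul2l leq_sqr kL orbT //.
rewrite (expnS n k) => h1 h2; have : (n * n ^ k <= n * (n ^_ k * 2))%N.
  by rewrite mulnA; move: h1 h2; set a := (n * n ^ k)%N; set b := (n * n ^_ k)%N; lia.
by rewrite leq_mul2l eqn0Ngt n0.
Qed.

End CycleMoments.

Section CriticalGraph.
Variables (R : realType) (alpha : nat -> R).
Hypothesis alpha_gt0 : forall i, (0 < i)%N -> 0 < alpha i.

(** The block from [2 ^ m.+2] to [2 ^ m.+3] has [2 ^ m.+2] terms, each at least [(2 * 2 ^ m.+3)^-1],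
    and so contributes at least [1 / 4]. *)
Lemma harmonic_lower m :
  m%:R / 4 <= \sum_(0 <= k < (2 ^ m.+2).+1 | (2 < k)%N) (2 * k%:R)^-1 :> R.
Proof.
elim: m => [|m IH].
  by rewrite mul0r; apply: sumr_ge0 => k _; rewrite invr_ge0 mulr_ge0.
have le : (2 ^ m.+2 <= 2 ^ m.+3)%N by rewrite leq_exp2l.
rewrite (@big_cat_nat _ _ _ (2 ^ m.+2).+1) //= -natr1 mulrDl lerD //.
have p0 : 0 < 2 ^+ m.+3 :> R by rewrite exprn_gt0.
have -> : \sum_((2 ^ m.+2).+1 <= k < (2 ^ m.+3).+1 | (2 < k)%N) (2 * k%:R)^-1 =
    \sum_((2 ^ m.+2).+1 <= k < (2 ^ m.+3).+1) (2 * k%:R)^-1 :> R.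
  rewrite big_nat_cond [RHS]big_nat; apply: eq_bigl => k; rewrite andb_idr // => /andP[k1 _].
  by apply: leq_trans k1; rewrite ltnS (@leq_trans (2 ^ 2)) // leq_exp2l.
apply: (@le_trans _ _ (\sum_((2 ^ m.+2).+1 <= k < (2 ^ m.+3).+1) (2 * 2 ^+ m.+3)^-1)); last first.
  apply: ler_sum_nat => k /andP[k1 k2].
  have k0 : 0 < k%:R :> R by rewrite ltr0n (leq_ltn_trans _ k1).
  rewrite lef_pV2 ?posrE ?(mulr_gt0 _ k0) ?(mulr_gt0 _ p0) //.
  by rewrite ler_wpM2l // -natrX ler_nat -ltnS.
rewrite sumr_const_nat subSS -[leRHS]mulr_natr.
have -> : (2 ^ m.+3 - 2 ^ m.+2 = 2 ^ m.+2)%N by rewrite [in LHS](expnS 2 m.+2) mul2n -addnn addnK.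
rewrite natrX exprS invfM; set p := _ ^+ m.+2 in p0 *.
have p1 : 0 < p :> R by rewrite exprn_gt0.
by rewrite le_eqVlt; apply/orP; left; apply/eqP; field; rewrite lt0r_neq0.
Qed.

Hypothesis alpha1 : alpha 1%N = 1.

Lemma edge_prob_edges n (D : {set {set 'I_n}}) : (0 < n)%N ->
  (forall e, e \in D -> #|e| = 2%N) ->
  \prod_(e in D) edge_prob alpha e = n%:R^-1 ^+ #|D|.
Proof.
move=> n0 D2; rewrite -prodr_const; apply: eq_bigr => e /D2 e2.
by rewrite /edge_prob e2 /= alpha1 powR_inv1.
Qed.

Lemma negl_no_cycle :
  negl alpha (fun n H => forall w : seq 'I_n, is_cycle w -> ~~ (cycle_edges w \subset H)).
Proof.
apply/cvgrPdist_le => d d0.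
(* The length bound [L] is fixed before [n], so the mean is only made large in terms of [d]. With
   mean [mu >= 1], Chebyshev gives [mu ^+ 2 * P <= 2 * mu + 1 <= 3 * mu], hence [P <= d] once
   [mu >= 3 / d]. *)
pose m := (Num.truncn (4 * Num.max 1 (3 / d))).+1; pose L := (2 ^ m.+2)%N.
near=> n.
have n0 : (0 < n)%N by near: n; exact: nbhs_infty_gt.
have nL : (2 * L ^ 2 <= n)%N by near: n; exact: nbhs_infty_ge.
have nC : (overlap_bound L <= n)%N by near: n; exact: nbhs_infty_ge.
have e01 := @edge_prob01 _ _ alpha_gt0 n.
rewrite sub0r normrN ger0_norm ?prob_ge0 //.
set mu := @cycle_mean R n L.
have mu_ge : Num.max 1 (3 / d) <= mu.
  apply: le_trans (cycle_mean_ge R n0 nL).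
  rewrite -(big_mkord (fun k => 2 < k)%N (fun k => (2 * k%:R)^-1)).
  apply: le_trans (harmonic_lower m); rewrite ler_pdivlMr // mulrC ltW //.
  exact: truncnS_gt.
have mu1 : 1 <= mu by apply: le_trans mu_ge; rewrite le_max lexx.
have mud : 3 / d <= mu by apply: le_trans mu_ge; rewrite le_max lexx orbT.
have edges2 w : is_cycle w -> forall e, e \in @cycle_edges 'I_n w -> #|e| = 2%N.
  by move=> /andP[uw w2] e; apply: card_cycle_edge.
have := @second_moment _ _ _ e01 _ (fun j : {k : 'I_L.+1 & k.-tuple 'I_n} => cycle_weight R (seq_of j))
  (fun j => cycle_edges (seq_of j)) (2 * mu + (overlap_bound L)%:R / n%:R).
rewrite /=.
have -> : \sum_(j : {k : 'I_L.+1 & k.-tuple 'I_n}) cycle_weight R (seq_of j) *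
    \prod_(i in cycle_edges (seq_of j)) edge_prob alpha i = mu.
  apply: eq_bigr => j _; have [c|c] := boolP (is_cycle (seq_of j)).
    by rewrite edge_prob_edges //; exact: edges2.
  by rewrite /cycle_weight (negPf c) !mul0r.
set P := prob _ _ => sm.
have {}sm : mu ^+ 2 * P <= 2 * mu + (overlap_bound L)%:R / n%:R.
  apply: sm; apply: le_trans (cycle_second_moment R L n0).
  apply: ler_sum => i _; apply: ler_sum => j _.
  have [ci|ci] := boolP (is_cycle (seq_of i)); last by rewrite /cycle_weight (negPf ci) !mul0r.
  have [cj|cj] := boolP (is_cycle (seq_of j)); last first.
    by rewrite [cycle_weight _ (seq_of j)]/cycle_weight (negPf cj) !(mulr0, mul0r).
  rewrite edge_prob_edges // => e; rewrite inE => /orP[]; exact: edges2.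
have le : prob (@edge_prob R alpha n) (fun H =>
    forall w : seq 'I_n, is_cycle w -> ~~ (cycle_edges w \subset H)) <= P.
  apply: le_prob => // H no j a0; apply: no; apply: contraNT a0 => c.
  by rewrite /cycle_weight (negPf c).
apply: (le_trans le); have mu0 : 0 < mu by apply: lt_le_trans mu1.
have nn0 : 0 < n%:R :> R by rewrite ltr0n.
have C1 : (overlap_bound L)%:R / n%:R <= 1 :> R by rewrite ler_pdivrMr // mul1r ler_nat.
have Pmu : mu * P <= 3.
  rewrite -(ler_pM2l mu0); apply: (@le_trans _ _ (2 * mu + 1)).
    by rewrite mulrA -expr2; apply: le_trans sm _; rewrite lerD2l.
  by lra.
rewrite -(ler_pM2l mu0); apply: (le_trans Pmu).
by rewrite -ler_pdivrMr.
Unshelve. all: by end_near.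
Qed.

Lemma negl_acyclic_critical : negl alpha (fun n H => acyclic rat (facesH H) 2).
Proof.
have a2 : 0 < alpha 2 by apply: alpha_gt0.
have ntri : negl alpha (fun n H => (0 < fcount (facesH H) 3)%N).
  apply: (negl_bound alpha_gt0 (@cvg_nat_powR _ 1 _ a2)); near=> n.
  have n0 : (0 < n)%N by near: n; exact: nbhs_infty_gt.
  have e01 := @edge_prob01 _ _ alpha_gt0 n.
  apply: (@le_trans _ _ (Ex (@edge_prob R alpha n) (fun H => (fcount (facesH H) 3)%:R))).
    by apply: prob_markov => // H; rewrite ler1n.
  apply: le_trans (E_fcount_le alpha_gt0 2 n0) _.
  (* For triangles the exponent is [3 - S1 0 alpha - S1 1 alpha], which is [- alpha 2] at
     [alpha 1 = 1]. *)
  rewrite mul1r le_eqVlt; apply/orP; left; apply/eqP; congr (_ `^ _).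
  by rewrite !big_ord_recr big_ord0 /= /S1 /index_iota /= !big_cons !big_nil ?bin1 ?binn alpha1; lra.
apply: (negl_sub alpha_gt0 _ (neglU alpha_gt0 ntri negl_no_cycle)).
apply: nearW => n H ac; apply: contrapT => /not_orP[/negP].
rewrite -eqn0Ngt => /eqP n3 nocyc; apply: nocyc => w cw; apply/negP => wH.
have /andP[uw w2] := cw.
apply: (cycle_not_acyclic uw w2 _ n3 ac); apply/subsetP => e ew.
apply/facesHP => t te t1; have e2 := card_cycle_edge uw w2 ew.
have /eqP -> : t == e by rewrite eqEcard te e2.
exact: subsetP wH _ ew.
Unshelve. all: by end_near.
Qed.

End CriticalGraph.

Lemma negl_no_cup_product (R : realType) (alpha : nat -> R) :
  (forall i, (0 < i)%N -> 0 < alpha i) -> (forall k, (0 < k)%N -> S1 k alpha <> 1) ->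
  alpha 1%N <= 1 -> negl alpha (fun n H => ~ has_cup_product (lower_complex H) rat 1).
Proof.
move=> alpha_gt0 S1_neq1 a1.
suff [l nac] : exists l, negl alpha (fun n H => acyclic rat (facesH H) l.+2).
  apply: (negl_sub alpha_gt0 _ nac); apply: nearW => n H no.
  by apply: contrapT => nacy; apply: no; apply: has_cup_product1 nacy.
move: a1; rewrite le_eqVlt => /orP[/eqP a1|a1].
  by exists 0%N; apply: negl_acyclic_critical.
have [l [l0 Sl Sj]] := critical_dimension alpha_gt0 S1_neq1.
exists l.-1; rewrite prednK //; apply: negl_acyclic => // k kl.
(* In degree 0 the condition reads [alpha 1 < 1], which is why the case [alpha 1 = 1] was split
   off. *)
case: k kl => [_|k kl]; last exact: Sj.
by rewrite /S1 big_nat1 binn mul1r.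
Qed.

(** For [alpha 1 > 1] the graph is a.a.s. a forest, cohomology vanishes in positive degrees and the
    cup length is 0. The exact value 1 is therefore asserted for [alpha 1 <= 1], and the upper bound
    in all cases. *)
Theorem theorem1p6 (R : realType) (alpha : nat -> R)
    (alpha_gt0 : forall i : nat, (0 < i)%N -> 0 < alpha i)
    (S1_neq1 : forall k : nat, (0 < k)%N -> S1 k alpha <> 1) :
  [/\ (alpha 1%N <= 1 -> aas_lower alpha (fun n X => cup_length_eq X rat 1)),
      aas_lower alpha (fun n X => cup_length_le X rat 1)
    & forall l : nat, (0 < l)%N -> 1 < S1 l alpha ->
        aas_lower alpha
          (fun n X => forall A : pzRingType, cup_trivial X A (2 * l)%N)].
Proof.
have le1 := negl_cup_length_gt1 alpha_gt0 S1_neq1.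
split=> [a1||]; last exact: aas_cup_trivial; last exact: aas_of_negl le1.
apply: aas_of_negl => //.
apply: (negl_sub alpha_gt0 _ (neglU alpha_gt0 (negl_no_cup_product alpha_gt0 S1_neq1 a1) le1)).
by apply: nearW => n H; rewrite /cup_length_eq => /not_andP.
Qed.
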